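(* Let $(A,\mathfrak{m})$ be a Cohen-Macaulay local ring of dimension $d \geq 2$ with infinite residue field, and assume that $A$ is an analytically unramified domain. Let $I$ be an $\mathfrak{m}$-primary ideal of $A$. If the associated graded ring $G(I) = \bigoplus_{n\geq 0} I^n/I^{n+1}$ is generalized Cohen-Macaulay, then the $S_2$-ification of the Rees algebra $\mathcal{R}(I) = A[It]$ is $\bigoplus_{n\geq 0}\widetilde{I^n}$ (that is, the subring $\bigoplus_{n\ge 0}\widetilde{I^n}t^n$ of $A[t]$). In particular, $\mathcal{R}(I^n) = A[I^n t]$ is $S_2$ for all $n\gg 0$.
   Context: Rings are commutative Noetherian. The Ratliff-Rush closure of an ideal $K$ is $\widetilde{K} = \bigcup_{m\ge 1}(K^{m+1}:K^m)$; for $n=0$ one has $\widetilde{I^0}=A$. $A$ is analytically unramified if its $\mathfrak{m}$-adic completion is reduced. $G(I)$ (which has dimension $d$) is generalized Cohen-Macaulay if the local cohomology modules $H^i_{G(I)_+}(G(I))$ have finite length for $0\le i\le d-1$, where $G(I)_+=\bigoplus_{n\ge1}I^n/I^{n+1}$. A ring satisfies $S_2$ if it satisfies Serre's condition $(S_2)$. The $S_2$-ification of a Noetherian domain $R$ is (when it exists) the ring $S$ with $R\subseteq S\subseteq \operatorname{Frac}(R)$ such that $S$ is a finitely generated $R$-module, $S$ satisfies $(S_2)$ as an $R$-module, and for every $s\in S\setminus R$ the ideal $(R:_R s)$ has height at least $2$. *)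

(* Defs.v *)
From HB Require Import structures.
From mathcomp Require Import all_boot all_order all_algebra.
From mathcomp Require Import generic_quotient ring_quotient fraction.
From mathcomp Require Import ring.
From mathcomp Require Import boolp classical_sets functions cardinality.

Set Implicit Arguments.
Unset Strict Implicit.
Unset Printing Implicit Defensive.

Import GRing.Theory.
Local Open Scope ring_scope.
Local Open Scope quotient_scope.

(* Ideals and submodules are boolean predicates; [asbool] makes every
   proposition available as a boolean.  [idealr R] and [prime_idealr R] are
   the library's types of proper ideals and of prime ideals. *)

Section Span.
Variables (R : comNzRingType) (V : lmodType R).

Definition span (X : {pred V}) : {pred V} :=
  [pred v | `[< exists2 s : seq (R * V),
      (forall p, p \in s -> p.2 \in X) & v = \sum_(p <- s) p.1 *: p.2 >] ].

Lemma spanP (X : {pred V}) v :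
  reflect (exists2 s : seq (R * V),
      (forall p, p \in s -> p.2 \in X) & v = \sum_(p <- s) p.1 *: p.2)
    (v \in span X).
Proof. exact: asboolP. Qed.

Lemma mem_span (X : {pred V}) v : v \in X -> v \in span X.
Proof.
move=> vX; apply/spanP; exists [:: (1, v)]; last by rewrite big_seq1 scale1r.
by move=> p; rewrite inE => /eqP->.
Qed.

Lemma span_submod (X : {pred V}) : submod_closed (span X).
Proof.
split; first by apply/spanP; exists [::]; rewrite ?big_nil.
move=> a u v /spanP[s sX ->] /spanP[t tX ->]; apply/spanP.
exists ([seq (a * p.1, p.2) | p <- s] ++ t) => [p|].
  by rewrite mem_cat => /orP[/mapP[q /sX qX ->]//|/tX].
rewrite big_cat big_map /= scaler_sumr; congr (_ + _).
by apply: eq_bigr => p _; rewrite scalerA.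
Qed.

Lemma submod_sum (N : {pred V}) (I : Type) (s : seq I) (P : pred I) F :
  submod_closed N -> (forall i, P i -> F i \in N) ->
  \sum_(i <- s | P i) F i \in N.
Proof.
case=> N0 NP NF; elim/big_ind: _ => // u v uN vN.
by rewrite -(scale1r u) NP.
Qed.

Lemma submodZ (N : {pred V}) a u : submod_closed N -> u \in N -> a *: u \in N.
Proof. by case=> N0 NP uN; rewrite -[_ *: _]addr0 NP. Qed.

Lemma span_min (X N : {pred V}) :
  submod_closed N -> {subset X <= N} -> {subset span X <= N}.
Proof.
move=> sN XN v /spanP[s sX ->]; rewrite big_seq.
by apply: submod_sum => // p /sX/XN; apply: submodZ.
Qed.

Definition finitely_generated : Prop :=
  exists s : seq V, forall v, v \in span [in s].

(* [composition_series B Z n N]: the [N i] induce a composition series of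
   length [n] of the subquotient [Z / B]. *)
Definition composition_series (B Z : {pred V}) (n : nat) (N : nat -> {pred V}) :=
  [/\ N 0%N =i B, N n =i Z, forall i, submod_closed (N i) &
      forall i, (i < n)%N ->
      [/\ {subset N i <= N i.+1}, ~ {subset N i.+1 <= N i} &
          forall L : {pred V}, submod_closed L ->
            {subset N i <= L} -> {subset L <= N i.+1} ->
            L =i N i \/ L =i N i.+1]].

Definition finite_length (B Z : {pred V}) : Prop :=
  exists n N, composition_series B Z n N.

End Span.

Definition noetherian (R : comNzRingType) : Prop :=
  forall J : {pred R^o}, submod_closed J ->
  exists s : seq R^o, J =i span [in s].

Definition reduced (R : nzRingType) : Prop :=
  forall (x : R) n, x ^+ n = 0 -> x = 0.

Definition maximal_ideal (R : comNzRingType) (m : idealr R) : Prop :=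
  forall J : idealr R, {subset m <= J} -> {subset J <= m}.

Definition local_ring (R : comNzRingType) (m : idealr R) : Prop :=
  maximal_ideal m /\ forall n : idealr R, maximal_ideal n -> n =i m.

Definition primary_to (R : comNzRingType) (m I : idealr R) : Prop :=
  (forall x y, x * y \in I -> x \in I \/ exists k, y ^+ k \in I) /\
  (forall x, x \in m <-> exists k, x ^+ k \in I).

Section Powers.
Variable R : comNzRingType.
Implicit Types I K : {pred R}.

Definition ideal_pow I (n : nat) : {pred R} :=
  @span R R^o [pred x | `[< exists s : seq R,
    [/\ size s = n, {subset s <= I} & x = \prod_(a <- s) a] >] ].

Definition ratliff_rush K : {pred R} :=
  [pred x | `[< exists2 m : nat, (0 < m)%N &
     forall y, y \in ideal_pow K m -> x * y \in ideal_pow K m.+1 >] ].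

Lemma ratliff_rushP K x :
  reflect (exists2 m : nat, (0 < m)%N &
     forall y, y \in ideal_pow K m -> x * y \in ideal_pow K m.+1)
   (x \in ratliff_rush K).
Proof. exact: asboolP. Qed.

Lemma ideal_pow_submod I n : submod_closed (ideal_pow I n : {pred R^o}).
Proof. exact: span_submod. Qed.

Lemma prod_ideal_pow I s : {subset s <= I} ->
  \prod_(a <- s) a \in ideal_pow I (size s).
Proof. by move=> sI; apply: mem_span; apply/asboolP; exists s. Qed.

Lemma ideal_pow_ind I n (N : {pred R}) :
  submod_closed (N : {pred R^o}) ->
  (forall s, size s = n -> {subset s <= I} -> \prod_(a <- s) a \in N) ->
  {subset ideal_pow I n <= N}.
Proof.
move=> sN NX; apply: (@span_min R R^o _ N) => // x /asboolP[s [sn sI ->]].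
exact: NX.
Qed.

Let colon (N : {pred R}) (a : R) : {pred R} := [pred y | a * y \in N].

Let colonE N a y : (y \in colon N a) = (a * y \in N). Proof. by []. Qed.

Lemma colon_submod (N : {pred R}) a : submod_closed (N : {pred R^o}) ->
  submod_closed (colon N a : {pred R^o}).
Proof.
case=> N0 NP; split=> [|b u v]; rewrite !colonE ?mulr0 // => uN vN.
by rewrite mulrDr mulrCA NP.
Qed.

Lemma ideal_pow0 I x : x \in ideal_pow I 0.
Proof.
have /(submodZ x (ideal_pow_submod I 0)) :
  1 \in ideal_pow I 0 by rewrite -(@big_nil _ 1 *%R R xpredT id) prod_ideal_pow.
by rewrite /GRing.scale /= mulr1.
Qed.

Lemma ideal_pow1 I : {subset I <= ideal_pow I 1}.
Proof.
move=> x xI; rewrite -(big_seq1 *%R x id) (@prod_ideal_pow I [:: x]) // => y.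
by rewrite inE => /eqP->.
Qed.

Lemma ideal_powM I i j x y :
  x \in ideal_pow I i -> y \in ideal_pow I j -> x * y \in ideal_pow I (i + j).
Proof.
move=> xI yI; pose N := colon (ideal_pow I (i + j)).
have sN z : submod_closed (N z : {pred R^o}).
  exact/colon_submod/ideal_pow_submod.
have step t : size t = j -> {subset t <= I} ->
    {subset ideal_pow I i <= N (\prod_(a <- t) a)}.
  move=> tj tI; apply: ideal_pow_ind => // s si sI.
  rewrite colonE mulrC -big_cat -si -tj -size_cat prod_ideal_pow // => z.
  by rewrite mem_cat => /orP[/sI|/tI].
have : {subset ideal_pow I j <= N x}.
  by apply: ideal_pow_ind => // t tj tI; rewrite colonE mulrC; apply: step.
by move=> /(_ y yI).
Qed.

Lemma ideal_powMl I i x y : y \in ideal_pow I i -> x * y \in ideal_pow I i.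
Proof. exact: (submodZ x (ideal_pow_submod I i)). Qed.

Lemma ideal_pow_split I i j (N : {pred R}) :
  submod_closed (N : {pred R^o}) ->
  (forall x y, x \in ideal_pow I i -> y \in ideal_pow I j -> x * y \in N) ->
  {subset ideal_pow I (i + j) <= N}.
Proof.
move=> sN Nxy; apply: ideal_pow_ind => // s sn sI.
have ti : size (take i s) = i by rewrite size_takel // sn leq_addr.
have dj : size (drop i s) = j by rewrite size_drop sn addKn.
rewrite -(cat_take_drop i s) big_cat; apply: Nxy.
  by rewrite -[in X in ideal_pow _ X]ti prod_ideal_pow // => z /mem_take/sI.
by rewrite -[in X in ideal_pow _ X]dj prod_ideal_pow // => z /mem_drop/sI.
Qed.

Lemma ideal_powX I a n : ideal_pow (ideal_pow I a) n =i ideal_pow I (a * n).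
Proof.
suff sub : {subset ideal_pow (ideal_pow I a) n <= ideal_pow I (a * n)} /\
           {subset ideal_pow I (a * n) <= ideal_pow (ideal_pow I a) n}.
  by move=> x; apply/idP/idP; [apply: sub.1 | apply: sub.2].
split.
  apply: ideal_pow_ind; first exact: ideal_pow_submod.
  move=> s <-; elim: s => [|x s IHs] sI; first by rewrite big_nil muln0 ideal_pow0.
  rewrite big_cons mulnS; apply: ideal_powM.
    by rewrite sI ?mem_head.
  by apply: IHs => y ys; rewrite sI // inE ys orbT.
elim: n => [|n IHn] x; first by rewrite ideal_pow0.
move: x; rewrite mulnS; apply: ideal_pow_split => [|x y xI yI].
  exact: ideal_pow_submod.
by rewrite -add1n; apply: ideal_powM; [apply: ideal_pow1 | apply: IHn].
Qed.

Lemma colon_mono K x m m' : (m <= m')%N ->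
  (forall y, y \in ideal_pow K m -> x * y \in ideal_pow K m.+1) ->
  (forall y, y \in ideal_pow K m' -> x * y \in ideal_pow K m'.+1).
Proof.
move=> /subnKC <- xK y; move: y.
apply: (@ideal_pow_split _ _ _ (colon (ideal_pow K (m + _).+1) x)) => [|y z yK zK].
  exact/colon_submod/ideal_pow_submod.
by rewrite colonE mulrA -addSn ideal_powM ?xK.
Qed.

Lemma ratliff_rush_submod K : submod_closed (ratliff_rush K : {pred R^o}).
Proof.
split=> [|a u v].
  by apply/ratliff_rushP; exists 1%N => // y _; rewrite mul0r (ideal_pow_submod _ _).1.
case/ratliff_rushP=> m m0 um /ratliff_rushP[l l0 vl]; apply/ratliff_rushP.
exists (maxn m l) => [|y yK]; first by rewrite leq_max m0.
rewrite mulrDl -mulrA; apply: (ideal_pow_submod _ _).2.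
  exact: (colon_mono (leq_maxl m l) um).
exact: (colon_mono (leq_maxr m l) vl).
Qed.

Lemma ideal_pow_ratliff_rush I i :
  {subset ideal_pow I i <= ratliff_rush (ideal_pow I i)}.
Proof.
move=> x xI; apply/ratliff_rushP; exists 1%N => // y yI.
by rewrite -add1n ideal_powM // ideal_pow1.
Qed.

Lemma ratliff_rushM I i j x y :
  x \in ratliff_rush (ideal_pow I i) -> y \in ratliff_rush (ideal_pow I j) ->
  x * y \in ratliff_rush (ideal_pow I (i + j)).
Proof.
case/ratliff_rushP=> m m0 xm /ratliff_rushP[l l0 yl]; apply/ratliff_rushP.
have {}xm := colon_mono (leq_maxl m l) xm.
have {}yl := colon_mono (leq_maxr m l) yl.
exists (maxn m l) => [|z]; first by rewrite leq_max m0.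
set n := maxn m l in xm yl *; rewrite !ideal_powX mulnDl.
move: z; apply: (@ideal_pow_split _ _ _ (colon (ideal_pow I ((i + j) * n.+1)) (x * y))) => [|u v uI vI].
  exact/colon_submod/ideal_pow_submod.
rewrite colonE mulrACA mulnDl; apply: ideal_powM.
  by rewrite -ideal_powX xm // ideal_powX.
by rewrite -ideal_powX yl // ideal_powX.
Qed.

End Powers.

Record filtration (A : comNzRingType) := Filtration {
  fil :> nat -> {pred A};
  fil_submod : forall n, submod_closed (fil n : {pred A^o});
  fil0 : forall x, x \in fil 0%N;
  filM : forall i j x y, x \in fil i -> y \in fil j -> x * y \in fil (i + j)%N
}.

Definition adic_filtration (A : comNzRingType) (I : {pred A}) : filtration A :=
  Filtration (ideal_pow_submod I) (ideal_pow0 I) (@ideal_powM A I).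

Definition ratliff_rush_filtration (A : comNzRingType) (I : {pred A}) :
  filtration A.
Proof.
apply: (@Filtration A (fun n => ratliff_rush (ideal_pow I n))).
- by move=> n; apply: ratliff_rush_submod.
- by move=> x; apply/ideal_pow_ratliff_rush/ideal_pow0.
- exact: ratliff_rushM.
Defined.

Definition fil_pred (A : comNzRingType) (F : filtration A) : {pred {poly A}} :=
  [pred p : {poly A} | `[< forall i, p`_i \in F i >] ].

Section FilPred.
Variables (A : idomainType) (F : filtration A).

Lemma fil_predP (p : {poly A}) : reflect (forall i, p`_i \in F i) (p \in fil_pred F).
Proof. exact: asboolP. Qed.

Lemma filD i : {in F i &, forall x y, x - y \in F i}.
Proof.
move=> x y xF yF; rewrite addrC -mulN1r.
exact: (fil_submod F i).2.
Qed.

Lemma fil_pred_divring : divring_closed (fil_pred F).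
Proof.
split=> [|p q /fil_predP pF /fil_predP qF|p q /fil_predP pF /fil_predP qF].
- apply/fil_predP=> i; rewrite coef1; case: i => [|i]; first exact: fil0.
  exact: (fil_submod F _).1.
- by apply/fil_predP=> i; rewrite coefB filD.
have qVF i : (q^-1)`_i \in F i.
  rewrite /GRing.inv /= /poly_inv; case: ifP => // _.
  by rewrite coefC; case: i => [|i]; rewrite ?fil0 ?(fil_submod F _).1.
apply/fil_predP=> i; rewrite coefM.
apply: (@submod_sum A A^o (F i)) => [|j _]; first exact: fil_submod.
by have := filM (pF j) (qVF (i - j)%N); rewrite subnKC // -ltnS.
Qed.

HB.instance Definition _ :=
  GRing.isDivringClosed.Build {poly A} (fil_pred F) fil_pred_divring.

(* The subring of [A[t]] whose elements are the polynomials with coefficient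
   of [t^n] in [F n] for all [n]. *)
Record fil_rees := FilRees { fil_rees_val :> {poly A}; _ : fil_rees_val \in fil_pred F }.

HB.instance Definition _ := [isSub for fil_rees_val].
HB.instance Definition _ := [Choice of fil_rees by <:].
HB.instance Definition _ := [SubChoice_isSubIntegralDomain of fil_rees by <:].

End FilPred.

Notation rees I := (fil_rees (adic_filtration I)).
Notation ratliff_rush_rees I := (fil_rees (ratliff_rush_filtration I)).

Lemma ideal_pow_sub (A : comNzRingType) (I : idealr A) n : {subset ideal_pow I n.+1 <= I}.
Proof.
apply: ideal_pow_ind => [|[//|a s] _ sI].
  by split=> [|a u v uI vI]; rewrite ?rpred0 ?rpredD // idealMr.
by rewrite big_cons mulrC idealMr // sI ?mem_head.
Qed.

Lemma ideal_powD (A : comNzRingType) (I : {pred A}) k x y :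
  x \in ideal_pow I k -> y \in ideal_pow I k -> x + y \in ideal_pow I k.
Proof. by move=> xI yI; rewrite -(mul1r x) (ideal_pow_submod _ _).2. Qed.

Section Graded.
Variables (A : idomainType) (I : idealr A).

(* The associated graded ring is the quotient of [\bigoplus_n I^n t^n] by its
   ideal [\bigoplus_n I^(n+1) t^n]. *)
Definition gr_kernel : {pred rees I} :=
  [pred p : rees I | `[< forall i, (p : {poly A})`_i \in ideal_pow I i.+1 >] ].

Lemma gr_kernel_idealr : idealr_closed gr_kernel.
Proof.
split.
- by apply/asboolP=> i; rewrite coef0 (ideal_pow_submod _ _).1.
- apply/asboolP=> /(_ 0%N); rewrite coef1 => /ideal_pow_sub.
  by rewrite idealr1.
move=> a u v /asboolP uK /asboolP vK; apply/asboolP=> i.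
rewrite coefD; apply: ideal_powD; last exact: vK.
rewrite coefM; apply: (@submod_sum A A^o) => [|j _]; first exact: ideal_pow_submod.
have /fil_predP/(_ j) aj := valP a.
by have := ideal_powM aj (uK (i - j)%N); rewrite addnS subnKC // -ltnS.
Qed.

HB.instance Definition _ := isIdealr.Build (rees I) gr_kernel gr_kernel_idealr.

Definition gr : Type := {ideal_quot gr_kernel}.
HB.instance Definition _ := GRing.ComNzRing.on gr.

Definition gr_proj (p : rees I) : gr := \pi_({ideal_quot gr_kernel}) p.

Definition gr_plus : {pred gr} :=
  [pred z | `[< exists2 p : rees I, (p : {poly A})`_0 = 0 & z = gr_proj p >] ].

End Graded.

Section Completion.
Variables (A : comNzRingType) (m : idealr A).

Definition cauchy_pred : {pred (nat -> A)} :=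
  [pred u : nat -> A | `[< forall k, exists N, forall i j, (N <= i)%N ->
     (N <= j)%N -> u i - u j \in ideal_pow m k >] ].

Lemma cauchy_subring : subring_closed cauchy_pred.
Proof.
split=> [|u v /asboolP uC /asboolP vC|u v /asboolP uC /asboolP vC].
- apply/asboolP=> k; exists 0%N => i j _ _.
  by rewrite subrr (ideal_pow_submod _ _).1.
- apply/asboolP=> k; have [[M uM] [N vN]] := (uC k, vC k).
  exists (maxn M N) => i j; rewrite !geq_max => /andP[Mi Ni] /andP[Mj Nj].
  have -> : (u - v) i - (u - v) j = (u i - u j) + (v j - v i).
    by rewrite !fctE; ring.
  by rewrite ideal_powD ?uM ?vN.
apply/asboolP=> k; have [[M uM] [N vN]] := (uC k, vC k).
exists (maxn M N) => i j; rewrite !geq_max => /andP[Mi Ni] /andP[Mj Nj].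
have -> : (u * v) i - (u * v) j = v i * (u i - u j) + u j * (v i - v j).
  by rewrite !fctE; ring.
by rewrite ideal_powD // ideal_powMl ?uM ?vN.
Qed.

HB.instance Definition _ :=
  GRing.isSubringClosed.Build (nat -> A) cauchy_pred cauchy_subring.

Record cauchy := Cauchy { cauchy_val :> nat -> A; _ : cauchy_val \in cauchy_pred }.
HB.instance Definition _ := [isSub for cauchy_val].
HB.instance Definition _ := [Choice of cauchy by <:].
HB.instance Definition _ := [SubChoice_isSubComNzRing of cauchy by <:].

Definition null_pred : {pred cauchy} :=
  [pred u : cauchy | `[< forall k, exists N, forall i, (N <= i)%N ->
     (u : nat -> A) i \in ideal_pow m k >] ].

Lemma null_idealr : idealr_closed null_pred.
Proof.
split.
- by apply/asboolP=> k; exists 0%N => i _; rewrite (ideal_pow_submod _ _).1.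
- apply/asboolP=> /(_ 1%N)[N /(_ N (leqnn N))] /ideal_pow_sub.
  by rewrite idealr1.
move=> a u v /asboolP uN /asboolP vN; apply/asboolP=> k.
have [[M uM] [N {}vN]] := (uN k, vN k).
exists (maxn M N) => i; rewrite geq_max => /andP[Mi Ni].
by apply: ideal_powD; [apply/ideal_powMl/uM | apply: vN].
Qed.

HB.instance Definition _ := isIdealr.Build cauchy null_pred null_idealr.

(* The [m]-adic completion: Cauchy sequences modulo null sequences. *)
Definition completion : Type := {ideal_quot null_pred}.
HB.instance Definition _ := GRing.ComNzRing.on completion.

End Completion.

Definition analytically_unramified (A : comNzRingType) (m : idealr A) : Prop :=
  reduced (completion m).

Section Localization.
Variables (R : comNzRingType) (P : prime_idealr R).

Section Module.
Variable M : lmodType R.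

Record prefrac := Prefrac { prefrac_val :> M * R; _ : prefrac_val.2 \notin P }.
HB.instance Definition _ := [isSub for prefrac_val].
HB.instance Definition _ := [Choice of prefrac by <:].

Lemma denP (x : prefrac) : x.2 \notin P. Proof. by case: x. Qed.

Definition loc_equiv (x y : prefrac) : bool :=
  `[< exists2 u, u \notin P & u *: (y.2 *: x.1) = u *: (x.2 *: y.1) >].

Lemma notinM u v : u \notin P -> v \notin P -> u * v \notin P.
Proof. by move=> uP vP; rewrite prime_idealrM negb_or uP. Qed.

Lemma notin1 : 1 \notin P. Proof. by rewrite idealr1. Qed.

Lemma loc_equiv_refl : reflexive loc_equiv.
Proof. by move=> x; apply/asboolP; exists 1; rewrite ?notin1. Qed.

Lemma loc_equiv_sym : symmetric loc_equiv.
Proof. by move=> x y; apply/asboolP/asboolP=> -[u uP eq]; exists u. Qed.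

Lemma loc_equiv_trans : transitive loc_equiv.
Proof.
move=> y x z /asboolP[u uP xy] /asboolP[v vP yz]; apply/asboolP.
exists (u * v * y.2); first by rewrite !notinM ?denP.
have -> : u * v * y.2 *: (z.2 *: x.1) = v * z.2 *: (u *: (y.2 *: x.1)).
  by rewrite !scalerA; congr (_ *: _); ring.
have -> : u * v * y.2 *: (x.2 *: z.1) = u * x.2 *: (v *: (y.2 *: z.1)).
  by rewrite !scalerA; congr (_ *: _); ring.
by rewrite xy -yz !scalerA; congr (_ *: _); ring.
Qed.

Canonical loc_equiv_equiv :=
  EquivRel loc_equiv loc_equiv_refl loc_equiv_sym loc_equiv_trans.

(* The localization [M_P]; its elements are the fractions [x / s], [s] not
   in [P]. *)
Definition loc : Type := {eq_quot loc_equiv}.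
HB.instance Definition _ : EqQuotient _ loc_equiv loc := EqQuotient.on loc.
HB.instance Definition _ := Choice.on loc.

Definition mkfrac (x : M) (s : R) (sP : s \notin P) : loc :=
  \pi_loc (@Prefrac (x, s) sP).

Lemma locW (K : loc -> Prop) :
  (forall x s (sP : s \notin P), K (mkfrac x sP)) -> forall z, K z.
Proof. by move=> KM; elim/quotW => -[[x s] sP]; apply: KM. Qed.

Lemma eq_mkfrac x s (sP : s \notin P) y t (tP : t \notin P) :
  (exists2 u, u \notin P & u *: (t *: x) = u *: (s *: y)) <->
  mkfrac x sP = mkfrac y tP.
Proof. by split=> [e|/eqmodP/asboolP//]; apply/eqmodP/asboolP. Qed.

Definition loc_add (a b : loc) : loc :=
  let x := repr a in let y := repr b in
  locked (mkfrac (y.2 *: x.1 + x.2 *: y.1) (notinM (denP x) (denP y))).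

Definition loc_opp (a : loc) : loc :=
  let x := repr a in locked (mkfrac (- x.1) (denP x)).

Lemma repr_mkfrac x s (sP : s \notin P) : exists2 u, u \notin P &
  u *: ((repr (mkfrac x sP)).2 *: x) = u *: (s *: (repr (mkfrac x sP)).1).
Proof.
have : mkfrac x sP = \pi_loc (repr (mkfrac x sP)) by rewrite reprK.
by case: (repr _) => -[y t] tP; rewrite -/(mkfrac y tP) => /eq_mkfrac.
Qed.

Lemma loc_addE x s (sP : s \notin P) y t (tP : t \notin P) :
  loc_add (mkfrac x sP) (mkfrac y tP) =
  mkfrac (t *: x + s *: y) (notinM sP tP).
Proof.
rewrite /loc_add -lock; apply/eq_mkfrac.
have [u uP] := repr_mkfrac x sP; have [v vP] := repr_mkfrac y tP.
set y' := repr _; set x' := repr _ => ey ex.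
exists (u * v); first exact: notinM.
rewrite !scalerDr; congr (_ + _).
  transitivity (v * (y'.2 * t) *: (u *: (s *: x'.1))).
    by rewrite !scalerA; congr (_ *: _); ring.
  by rewrite -ex !scalerA; congr (_ *: _); ring.
transitivity (u * (x'.2 * s) *: (v *: (t *: y'.1))).
  by rewrite !scalerA; congr (_ *: _); ring.
by rewrite -ey !scalerA; congr (_ *: _); ring.
Qed.

Lemma loc_oppE x s (sP : s \notin P) :
  loc_opp (mkfrac x sP) = mkfrac (- x) sP.
Proof.
rewrite /loc_opp -lock; apply/eq_mkfrac; have [u uP e] := repr_mkfrac x sP; exists u => //.
by rewrite !scalerN e.
Qed.

Definition loc_zero : loc := mkfrac 0 notin1.

Lemma loc_addA : associative loc_add.
Proof.
elim/locW=> x s sP; elim/locW=> y t tP; elim/locW=> z r rP.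
rewrite !loc_addE; apply/eq_mkfrac; exists 1; rewrite ?notin1 //.
rewrite !scalerDr !scalerA addrA.
by congr (_ *: _ + _ *: _ + _ *: _) => /=; ring.
Qed.

Lemma loc_addC : commutative loc_add.
Proof.
elim/locW=> x s sP; elim/locW=> y t tP.
rewrite !loc_addE; apply/eq_mkfrac; exists 1; rewrite ?notin1 //.
by rewrite !scalerDr !scalerA addrC; congr (_ *: _ + _ *: _) => /=; ring.
Qed.

Lemma loc_add0 : left_id loc_zero loc_add.
Proof.
elim/locW=> x s sP; rewrite loc_addE; apply/eq_mkfrac.
exists 1; rewrite ?notin1 //.
by rewrite scaler0 add0r !scalerA; congr (_ *: _) => /=; ring.
Qed.

Lemma loc_addN : left_inverse loc_zero loc_opp loc_add.
Proof.
elim/locW=> x s sP; rewrite loc_oppE loc_addE; apply/eq_mkfrac.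
by exists 1; rewrite ?notin1 // scalerN addNr !scaler0.
Qed.

HB.instance Definition _ :=
  GRing.isZmodule.Build loc loc_addA loc_addC loc_add0 loc_addN.

End Module.

Definition loc_scale (M : lmodType R) (a : loc R^o) (b : loc M) : loc M :=
  let x := repr a in let y := repr b in
  locked (mkfrac (x.1 *: y.1) (notinM (denP x) (denP y))).

Lemma loc_scaleE (M : lmodType R) (a : R^o) s (sP : s \notin P)
    (x : M) t (tP : t \notin P) :
  loc_scale (mkfrac a sP) (mkfrac x tP) = mkfrac (a *: x) (notinM sP tP).
Proof.
rewrite /loc_scale -lock; apply/eq_mkfrac.
have [u uP] := repr_mkfrac a sP; have [v vP] := repr_mkfrac x tP.
set x' := repr _; set a' := repr _ => ex ea.
exists (u * v); first exact: notinM.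
transitivity ((u *: (s *: a'.1) : R^o) *: (v *: (t *: x'.1))).
  by rewrite !scalerA; congr (_ *: _); rewrite /GRing.scale /=; ring.
by rewrite -ea -ex !scalerA; congr (_ *: _); rewrite /GRing.scale /=; ring.
Qed.

Definition loc_ring : Type := loc R^o.
HB.instance Definition _ := GRing.Zmodule.on loc_ring.

Definition loc_one : loc_ring := @mkfrac R^o 1 1 notin1.

Section ScaleTheory.
Variable M : lmodType R.

Lemma loc_scaleA (a b : loc_ring) (z : loc M) :
  loc_scale a (loc_scale b z) = loc_scale (loc_scale a b : loc R^o) z.
Proof.
elim/locW: a => a s sP; elim/locW: b => b t tP; elim/locW: z => x r rP.
rewrite !loc_scaleE.
apply/eq_mkfrac; exists 1; rewrite ?notin1 //.
by rewrite !scalerA; congr (_ *: _); rewrite /GRing.scale /=; ring.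
Qed.

Lemma loc_scale1 (z : loc M) : loc_scale loc_one z = z.
Proof.
elim/locW: z => x r rP; rewrite loc_scaleE; apply/eq_mkfrac.
by exists 1; rewrite ?notin1 // !scale1r mul1r.
Qed.

Lemma loc_scaleDr (a : loc_ring) (y z : loc M) :
  loc_scale a (y + z) = loc_scale a y + loc_scale a z.
Proof.
elim/locW: a => a s sP; elim/locW: y => y t tP; elim/locW: z => x r rP.
rewrite [y in loc_scale _ y]loc_addE !loc_scaleE [RHS]loc_addE.
apply/eq_mkfrac; exists 1; rewrite ?notin1 // !scalerDr !scalerA.
by congr (_ *: _ + _ *: _); ring.
Qed.

Lemma loc_scaleDl (a b : loc_ring) (z : loc M) :
  loc_scale (a + b : loc R^o) z = loc_scale a z + loc_scale b z.
Proof.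
elim/locW: a => a s sP; elim/locW: b => b t tP; elim/locW: z => x r rP.
rewrite [y in loc_scale y _]loc_addE !loc_scaleE [RHS]loc_addE.
apply/eq_mkfrac; exists 1; rewrite ?notin1 // scalerDl !scalerDr !scalerA.
by congr (_ *: _ + _ *: _); rewrite /GRing.scale /=; ring.
Qed.

End ScaleTheory.

Definition loc_mul : loc_ring -> loc_ring -> loc_ring := @loc_scale R^o.

Lemma loc_mulA : associative loc_mul.
Proof. exact: loc_scaleA. Qed.

Lemma loc_mulC : commutative loc_mul.
Proof.
elim/locW=> x s sP; elim/locW=> y t tP.
rewrite /loc_mul !loc_scaleE; apply/eq_mkfrac; exists 1; rewrite ?notin1 //.
by rewrite /GRing.scale /=; ring.
Qed.

Lemma loc_mul1 : left_id loc_one loc_mul.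
Proof. exact: loc_scale1. Qed.

Lemma loc_mulDl : left_distributive loc_mul +%R.
Proof. by move=> a b c; apply: loc_scaleDl. Qed.

Lemma loc_one_neq0 : loc_one != 0.
Proof.
apply/eqP=> /eq_mkfrac[u uP]; rewrite !scale1r scaler0 /GRing.scale /= mulr1.
by move=> u0; rewrite u0 idealr0 in uP.
Qed.

HB.instance Definition _ := GRing.Zmodule_isComNzRing.Build loc_ring
  loc_mulA loc_mulC loc_mul1 loc_mulDl loc_one_neq0.

HB.instance Definition _ (M : lmodType R) :=
  GRing.Zmodule_isLmodule.Build loc_ring (loc M)
    (@loc_scaleA M) (@loc_scale1 M) (@loc_scaleDr M) (fun z => fun a b => loc_scaleDl a b z).

Definition loc_max : {pred loc_ring} :=
  [pred z | `[< exists (x s : R) (sP : s \notin P),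
     x \in P /\ z = @mkfrac R^o x s sP >] ].

End Localization.

Arguments loc_max {R} P.

Section Dimension.
Variable R : comNzRingType.

Definition prime_chain (n : nat) (Q : nat -> prime_idealr R) : Prop :=
  forall i, (i < n)%N -> {subset Q i <= Q i.+1} /\ ~ {subset Q i.+1 <= Q i}.

Definition ring_dim_ge (n : nat) : Prop := exists Q, prime_chain n Q.

Definition ring_dim (n : nat) : Prop := ring_dim_ge n /\ ~ ring_dim_ge n.+1.

(* Height at least [n]: every prime containing [J] has height at least [n];
   the unit ideal has infinite height. *)
Definition height_ge (J : {pred R}) (n : nat) : Prop :=
  forall P : prime_idealr R, {subset J <= P} ->
  exists2 Q, prime_chain n Q & Q n =i P.

Variable M : lmodType R.

Definition annihilator : {pred R} :=
  [pred a | `[< forall x : M, a *: x = 0 >] ].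

Definition mod_dim_ge (n : nat) : Prop :=
  exists2 Q, prime_chain n Q & {subset annihilator <= Q 0%N}.

Definition ideal_smul (xs : seq R) : {pred M} :=
  span [pred v : M | `[< exists2 x, x \in xs & exists w, v = x *: w >] ].

Definition regular_seq (xs : seq R) : Prop :=
  (forall i, (i < size xs)%N -> forall v : M,
     xs`_i *: v \in ideal_smul (take i xs) -> v \in ideal_smul (take i xs)) /\
  exists v : M, v \notin ideal_smul xs.

Definition depth_ge (J : {pred R}) (n : nat) : Prop :=
  exists xs : seq R, [/\ size xs = n, {subset xs <= J} & regular_seq xs].

End Dimension.

Definition cohen_macaulay (R : comNzRingType) (m : idealr R) : Prop :=
  exists d, [/\ ring_dim R d, depth_ge R^o m d & ~ depth_ge R^o m d.+1].

(* [depth M_P >= min (n, dim M_P)] for every prime [P]. *)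
Definition serre (R : comNzRingType) (n : nat) (M : lmodType R) : Prop :=
  forall (P : prime_idealr R) (k : nat), (k <= n)%N ->
  mod_dim_ge (loc P M) k -> depth_ge (loc P M) (loc_max P) k.

Section LocalCohomology.
Variable R : comNzRingType.

Definition injective_module (E : lmodType R) : Prop :=
  forall (U V : lmodType R) (f : {linear U -> V}) (g : {linear U -> E}),
  injective f -> exists h : {linear V -> E}, forall x, h (f x) = g x.

Record injective_resolution (M : lmodType R) := InjectiveResolution {
  ires :> nat -> lmodType R;
  ires_aug : {linear M -> ires 0%N};
  ires_diff : forall i, {linear ires i -> ires i.+1};
  ires_injective : forall i, injective_module (ires i);
  ires_aug_inj : injective ires_aug;
  ires_exact0 : forall y, ires_diff 0 y = 0 <-> exists x, ires_aug x = y;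
  ires_exact : forall i y,
    ires_diff i.+1 y = 0 <-> exists x, ires_diff i x = y
}.

Definition torsion (J : {pred R}) (E : lmodType R) : {pred E} :=
  [pred x | `[< exists n, forall a, a \in ideal_pow J n -> a *: x = 0 >] ].

Arguments torsion : clear implicits.

Definition lc_cycles (J : {pred R}) (M : lmodType R)
    (E : injective_resolution M) (i : nat) : {pred E i} :=
  [pred x | (x \in torsion J (E i)) && (ires_diff E i x == 0)].

Definition lc_boundaries (J : {pred R}) (M : lmodType R)
    (E : injective_resolution M) (i : nat) : {pred E i} :=
  match i with
  | 0 => pred1 0
  | j.+1 => [pred y | `[< exists2 x, x \in torsion J (E j) &
                          ires_diff E j x = y >] ]
  end.

Arguments lc_cycles J {M} E i.
Arguments lc_boundaries J {M} E i.

(* The [i]-th local cohomology of [M] with support in [J] is the cohomology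
   of the [J]-torsion of an injective resolution of [M]; up to isomorphism it
   does not depend on the resolution. *)
Definition local_cohomology_finite_length (J : {pred R}) (M : lmodType R)
    (i : nat) : Prop :=
  exists E : injective_resolution M,
    finite_length (lc_boundaries J E i) (lc_cycles J E i).

End LocalCohomology.

Definition gr_generalized_CM (A : idomainType) (I : idealr A) (d : nat) : Prop :=
  forall i, (i < d)%N ->
  local_cohomology_finite_length (@gr_plus A I) (gr I)^o i.

Section RestrictScalars.
Variables (R S : comNzRingType) (f : {rmorphism R -> S}).

(* [S] as an [R]-module through [f]. *)
Definition restrict_scalars (g : {rmorphism R -> S}) : Type := S.

HB.instance Definition _ := GRing.Zmodule.on (restrict_scalars f).

Definition restrict_scale (a : R) (x : restrict_scalars f) :
  restrict_scalars f := (f a * (x : S) : S).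

Lemma restrict_scaleA a b x :
  restrict_scale a (restrict_scale b x) = restrict_scale (a * b) x.
Proof. by rewrite /restrict_scale rmorphM mulrA. Qed.

Lemma restrict_scale1 : left_id 1 restrict_scale.
Proof. by move=> x; rewrite /restrict_scale rmorph1 mul1r. Qed.

Lemma restrict_scaleDr : right_distributive restrict_scale +%R.
Proof. by move=> a x y; apply: mulrDr. Qed.

Lemma restrict_scaleDl x :
  {morph restrict_scale^~ x : a b / a + b >-> a + b}.
Proof. by move=> a b; rewrite /restrict_scale rmorphD; apply: mulrDl. Qed.

HB.instance Definition _ := GRing.Zmodule_isLmodule.Build R (restrict_scalars f)
  restrict_scaleA restrict_scale1 restrict_scaleDr restrict_scaleDl.

End RestrictScalars.

(* [iota] exhibits [S] as the S2-ification of [R]; the map [j] realises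
   [R \subset S \subset Frac R]. *)
Definition is_S2ification (R : idomainType) (S : comNzRingType)
    (iota : {rmorphism R -> S}) : Prop :=
  [/\ exists2 j : {rmorphism S -> {fraction R}}, injective j &
        forall r : R, j (iota r) = @FracField.tofrac R r,
      finitely_generated (restrict_scalars iota),
      serre 2 (restrict_scalars iota) &
      forall s : S, ~ (exists r, iota r = s) ->
        height_ge [pred r : R | `[< exists r', iota r * s = iota r' >] ] 2].

Section ReesInclusion.
Variables (A : idomainType) (I : {pred A}).

Lemma rees_incl_subproof (p : rees I) :
  (p : {poly A}) \in fil_pred (ratliff_rush_filtration I).
Proof.
apply/fil_predP=> i; apply: ideal_pow_ratliff_rush.
by have /fil_predP := valP p.
Qed.

Definition rees_incl (p : rees I) : ratliff_rush_rees I :=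
  FilRees (rees_incl_subproof p).

Lemma rees_incl_is_zmod_morphism : zmod_morphism rees_incl.
Proof. by move=> p q; apply: val_inj. Qed.

Lemma rees_incl_is_monoid_morphism : monoid_morphism rees_incl.
Proof. by split=> [|p q]; apply: val_inj. Qed.

HB.instance Definition _ := GRing.isZmodMorphism.Build
  (rees I) (ratliff_rush_rees I) rees_incl rees_incl_is_zmod_morphism.
HB.instance Definition _ := GRing.isMonoidMorphism.Build
  (rees I) (ratliff_rush_rees I) rees_incl rees_incl_is_monoid_morphism.

End ReesInclusion.

(* Main.v *)
Require Import Defs.
From HB Require Import structures.
From mathcomp Require Import all_boot all_order all_algebra.
From mathcomp Require Import generic_quotient ring_quotient fraction ring.
From mathcomp Require Import boolp classical_sets functions cardinality.

(* Write [R = A[It]] and let [S] be the Ratliff-Rush Rees algebra. For large [n]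
   the [n]-th power of [I] is Ratliff-Rush closed, so some nonzero constant [c]
   satisfies [c S <= R]; hence [S] is a finite [R]-module, and every [s] in [S] is
   multiplied into [R] by powers of [I] and of [I t], which generate an ideal of
   height at least 2.

   [S] satisfies (S2) as soon as no prime [P] of height at least 2 has the form
   [(x S : s)]. Moving from [x] to a constant, such a [P] is homogeneous, and as
   [dim R = d + 1] it suffices to find a chain of length [d] of primes above [P]
   inside the irrelevant maximal ideal. If [P] does not contain [I], such a chain
   extends one of [A], which is Cohen-Macaulay. If [P] contains [I] but not [I t],
   then [P] is the preimage of an associated prime of [G(I)]; since [G(I)_+^c]
   kills the local cohomology below degree [d], multiplication by powers of
   elements of [G(I)_+] is null-homotopic on injective resolutions, so that [Ext]
   modules vanish away from [G(I)_+] and, as for Cohen-Macaulay rings, associated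
   primes have long chains above them. The irrelevant ideal itself is excluded by
   [depth A >= 2] and the Ratliff-Rush property. For the powers of [I] the chains
   are contracted along the integral extension [A[I^n t] -> A[It]], [t |-> t^n]. *)

Set Implicit Arguments.
Unset Strict Implicit.
Unset Printing Implicit Defensive.
Import GRing.Theory.
Local Open Scope ring_scope.

(* Otherwise [span] is the one of [vector]. *)
Local Notation span := Defs.span.

(** * Submodules, ideals and chains of primes *)

(** Only chains of primes are compared, so neither catenarity nor a dimension formula is needed: if
    [P] had height 2, a chain of length [d] above it would give the irrelevant ideal height [d + 2].
    The upper bound [d + 1] comes from writing [A[It]] as a quotient of a polynomial ring over [A]
    in [s] variables: the preimage of the irrelevant ideal is minimal over [d + s] elements, whereas
    the kernel has height at least [s - 1]. Localizations are formed only for Serre's condition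
    itself; elsewhere an assertion about [M_P] is one about multiples by some [u] outside [P], and
    Krull's theorem and Nakayama's lemma are proved in that form. On the side of [G(I)], the usual
    passage by duality from finite local cohomology to depth on the punctured spectrum is replaced
    by an induction on Ext modules, carried out on the cocycles of one injective resolution. *)

Section Submodules.
Variables (R : comNzRingType) (V : lmodType R).
Implicit Types (N X : {pred V}) (v w : V).

Lemma sub0 N : submod_closed N -> 0 \in N. Proof. by case. Qed.

Lemma subD N v w : submod_closed N -> v \in N -> w \in N -> v + w \in N.
Proof. by case=> _ sN vN wN; rewrite -[v]scale1r sN. Qed.

Lemma subN N v : submod_closed N -> v \in N -> - v \in N.
Proof. by move=> sN vN; rewrite -scaleN1r submodZ. Qed.

Lemma subB N v w : submod_closed N -> v \in N -> w \in N -> v - w \in N.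
Proof. by move=> sN vN wN; rewrite subD ?subN. Qed.

Lemma subBK N v w : submod_closed N -> w \in N -> (v - w \in N) = (v \in N).
Proof.
move=> sN wN; apply/idP/idP => vN; last exact: subB.
by rewrite -[v](subrK w) subD.
Qed.

Lemma subDl N v w : submod_closed N -> w \in N -> (w + v \in N) = (v \in N).
Proof. by move=> sN wN; rewrite -(@subBK N (w + v) w) // addrC addKr. Qed.

Definition adjoin N v : {pred V} := [pred w | `[< exists a : R, w - a *: v \in N >] ].

Lemma adjoinP N v w : reflect (exists a : R, w - a *: v \in N) (w \in adjoin N v).
Proof. exact: asboolP. Qed.

Lemma adjoin_sub N v : submod_closed N -> submod_closed (adjoin N v).
Proof.
move=> sN; split=> [|a x y /adjoinP[b xN] /adjoinP[c yN]].
  by apply/adjoinP; exists 0; rewrite scale0r subr0 sub0.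
apply/adjoinP; exists (a * b + c).
have -> : a *: x + y - (a * b + c) *: v = a *: (x - b *: v) + (y - c *: v).
  by rewrite scalerBr scalerDl scalerA opprD addrACA.
by rewrite subD // submodZ.
Qed.

Lemma adjoinl N v w : w \in N -> w \in adjoin N v.
Proof. by move=> wN; apply/adjoinP; exists 0; rewrite scale0r subr0. Qed.

Lemma adjoinr N v : submod_closed N -> v \in adjoin N v.
Proof. by move=> sN; apply/adjoinP; exists 1; rewrite scale1r subrr sub0. Qed.

Lemma adjoin_min N v N' : submod_closed N' -> {subset N <= N'} -> v \in N' ->
  {subset adjoin N v <= N'}.
Proof.
move=> sN' NN' vN' w /adjoinP[a /NN' wN'].
by rewrite -(subrK (a *: v) w) subD // submodZ.
Qed.

Definition colon N v : {pred R} := [pred a | a *: v \in N].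

Lemma colonE N v a : (a \in colon N v) = (a *: v \in N). Proof. by []. Qed.

Lemma colon_sub N v : submod_closed N -> submod_closed (colon N v : {pred R^o}).
Proof.
move=> sN; split=> [|a b c]; rewrite !colonE ?scale0r ?sub0 // => bv cv.
by rewrite scalerDl -[a *: b]/(a * b) -scalerA subD // submodZ.
Qed.

Lemma span_sub X : submod_closed (span X). Proof. exact: span_submod. Qed.

Lemma span_mono X X' : {subset X <= X'} -> {subset span X <= span X'}.
Proof. by move=> XX'; apply: span_min => [|v /XX']; [apply: span_sub | apply: mem_span]. Qed.

Lemma inseqE (T : eqType) (s : seq T) (x : T) : (x \in [in s]) = (x \in s).
Proof. by []. Qed.

Definition noetherian_module := forall N, submod_closed N ->
  exists s : seq V, N =i span [in s].

Lemma span_seq X (s : seq V) : {subset s <= span X} ->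
  exists2 t : seq V, {subset t <= X} & {subset s <= span [in t]}.
Proof.
elim: s => [|v s IHs] sX; first by exists [::].
have [|t tX st] := IHs; first by move=> w ws; rewrite sX // inE ws orbT.
have /spanP[c cX vc] := sX v (mem_head _ _).
exists ([seq p.2 | p <- c] ++ t) => [w|w].
  by rewrite mem_cat => /orP[/mapP[p /cX pX ->]|/tX].
rewrite inE => /orP[/eqP->|/st]; last first.
  by apply: span_mono => x; rewrite !inseqE mem_cat => ->; rewrite orbT.
rewrite vc big_seq; apply: submod_sum => [|p pc]; first exact: span_sub.
apply: submodZ; first exact: span_sub.
by apply: mem_span; rewrite inseqE mem_cat map_f.
Qed.

Lemma scale_preim_sub (N : {pred V}) (a : R) : submod_closed N ->
  submod_closed [pred v | a *: v \in N].
Proof.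
move=> sN; split=> [|b v w]; rewrite !inE ?scaler0 ?sub0 // => vN wN.
by rewrite scalerDr scalerA mulrC -scalerA; apply: subD => //; apply: submodZ.
Qed.

Lemma noeth_gen X : noetherian_module ->
  exists2 s : seq V, {subset s <= X} & {subset X <= span [in s]}.
Proof.
move=> nV; have [s sX] := nV _ (span_sub X).
have [v|t tX st] := @span_seq X s.
  by move=> vs; rewrite sX mem_span.
exists t => // v vX; have := mem_span vX; rewrite sX; move: v {vX}.
by apply: span_min => //; apply: span_sub.
Qed.

Lemma noeth_max (C : {pred V} -> Prop) (N0 : {pred V}) : noetherian_module ->
  (forall N, C N -> submod_closed N) -> C N0 ->
  exists N, [/\ C N, {subset N0 <= N} &
    forall N', C N' -> {subset N <= N'} -> {subset N' <= N}].
Proof.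
move=> nV CN C0; apply: contrapT => nomax.
pose T := {N | C N /\ {subset N0 <= N}}.
have step (x : T) : {y : T | {subset sval x <= sval y} /\
    ~ {subset sval y <= sval x}}.
  case: x => N [NC N0N] /=; apply: cid; apply: contrapT => nN; apply: nomax.
  exists N; split=> // N' N'C NN'; apply: contrapT => nN'; apply: nN.
  by exists (exist _ N' (conj N'C (fun v vN => NN' v (N0N v vN)))).
pose f := fix f i : T := if i is j.+1 then sval (step (f j))
  else exist _ N0 (conj C0 (fun v vN => vN)).
have fS i : {subset sval (f i) <= sval (f i.+1)} by case: (svalP (step (f i))).
have fN i : ~ {subset sval (f i.+1) <= sval (f i)} by case: (svalP (step (f i))).
have fmono i j : (i <= j)%N -> {subset sval (f i) <= sval (f j)}.
  by move/subnK <-; elim: (j - i)%N => // k IH v vi; apply: fS; apply: IH.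
have fsub i : submod_closed (sval (f i)) by case: (svalP (f i)) => NC _; exact: CN.
pose U : {pred V} := [pred v | `[< exists i, v \in sval (f i) >] ].
have sU : submod_closed U.
  split=> [|a u v /asboolP[i ui] /asboolP[j vj]]; apply/asboolP.
    by exists 0%N; rewrite sub0.
  exists (maxn i j); apply: subD; rewrite ?submodZ //.
    by apply: fmono ui; rewrite leq_maxl.
  by apply: fmono vj; rewrite leq_maxr.
have [s Us] := nV U sU.
have [k sk] : exists k, {subset s <= sval (f k)}.
  have : {subset s <= U} by move=> v vs; rewrite Us mem_span.
  elim: s {Us} => [|v s IHs] sU'; first by exists 0%N.
  have [k sk] := IHs (fun w ws => sU' w (mem_behead (s := v :: s) ws)).
  have /asboolP[i vi] := sU' v (mem_head _ _).
  exists (maxn i k) => w; rewrite inE => /orP[/eqP->|/sk].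
    by apply: fmono vi; rewrite leq_maxl.
  by apply: fmono; rewrite leq_maxr.
case: (fN k) => v vk; have : v \in U by apply/asboolP; exists k.+1.
by rewrite Us; move: v {vk}; apply: span_min.
Qed.

End Submodules.

Section Primes.
Variable R : comNzRingType.
Implicit Types (p q J K M : {pred R}) (P : prime_idealr R).

Definition is_ideal J := submod_closed (J : {pred R^o}).

Definition is_prime q := [/\ is_ideal q, 1 \notin q &
  forall x y, x * y \in q -> (x \in q) || (y \in q)].

Lemma prime_sub q : is_prime q -> is_ideal q. Proof. by case. Qed.
Lemma prime_not1 q : is_prime q -> 1 \notin q. Proof. by case. Qed.

Lemma primeM q x y : is_prime q -> (x * y \in q) = (x \in q) || (y \in q).
Proof.
case=> sq _ qP; apply/idP/idP => [/qP //|/orP[xq|yq]].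
  by rewrite mulrC; apply: (submodZ y sq).
exact: (submodZ x sq).
Qed.

Lemma primeX q x n : is_prime q -> x ^+ n \in q -> x \in q.
Proof.
move=> qP; elim: n => [|n IHn]; first by rewrite expr0 (negbTE (prime_not1 qP)).
by rewrite exprS primeM // => /orP[].
Qed.

Lemma idealM J a x : is_ideal J -> x \in J -> a * x \in J.
Proof. by move=> sJ; apply: (submodZ a sJ). Qed.

Lemma idealrM J a x : is_ideal J -> x \in J -> x * a \in J.
Proof. by move=> sJ; rewrite mulrC; apply: idealM. Qed.

Lemma ideal0 J : is_ideal J -> 0 \in J. Proof. exact: sub0. Qed.

Lemma idealD J x y : is_ideal J -> x \in J -> y \in J -> x + y \in J.
Proof. exact: subD. Qed.

Lemma idealB J x y : is_ideal J -> x \in J -> y \in J -> x - y \in J.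
Proof. exact: subB. Qed.

Lemma idealBK J x y : is_ideal J -> y \in J -> (x - y \in J) = (x \in J).
Proof. exact: subBK. Qed.

Lemma idealDl J x y : is_ideal J -> x \in J -> (x + y \in J) = (y \in J).
Proof. by move=> sJ; apply: (@subDl R R^o J). Qed.

Lemma ideal_sum J (T : Type) (s : seq T) (Pr : pred T) (F : T -> R) : is_ideal J ->
  (forall i, Pr i -> F i \in J) -> \sum_(i <- s | Pr i) F i \in J.
Proof. by move=> sJ FJ; apply: (@submod_sum R R^o J T s Pr F sJ FJ). Qed.

Definition iadj J x : {pred R} := [pred y | `[< exists a : R, y - a * x \in J >] ].

Lemma iadjP J x y : reflect (exists a : R, y - a * x \in J) (y \in iadj J x).
Proof. exact: asboolP. Qed.

Lemma iadj_ideal J x : is_ideal J -> is_ideal (iadj J x).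
Proof. exact: (@adjoin_sub R R^o). Qed.

Lemma iadjl J x y : y \in J -> y \in iadj J x.
Proof. exact: (@adjoinl R R^o). Qed.

Lemma iadjr J x : is_ideal J -> x \in iadj J x.
Proof. exact: (@adjoinr R R^o). Qed.

Lemma iadj_min J x J' : is_ideal J' -> {subset J <= J'} -> x \in J' ->
  {subset iadj J x <= J'}.
Proof. exact: (@adjoin_min R R^o). Qed.

Definition icolon J x : {pred R} := [pred a | a * x \in J].

Lemma icolonE J x a : (a \in icolon J x) = (a * x \in J). Proof. by []. Qed.

Lemma icolon_ideal J x : is_ideal J -> is_ideal (icolon J x).
Proof. exact: (@colon_sub R R^o). Qed.

Lemma idealr_is_ideal (J : idealr R) : is_ideal J.
Proof.
split=> [|a x y xJ yJ]; first exact: idealr0.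
by rewrite rpredD // idealMr.
Qed.

Lemma prime_idealr_is_prime P : is_prime P.
Proof.
split; first exact: idealr_is_ideal.
  by rewrite idealr1.
by move=> x y; rewrite prime_idealrM.
Qed.

Lemma prime_eq q q' : q =i q' -> is_prime q -> is_prime q'.
Proof.
move=> e [[q0 sq] q1 qM]; split; [split|..].
- by rewrite -e.
- by move=> a x y; rewrite -!e; apply: sq.
- by rewrite -e.
by move=> x y; rewrite -!e; apply: qM.
Qed.

End Primes.

Section MkPrime.
Variables (R : comNzRingType) (q : {pred R}) (hq : is_prime q).
Let q' : R -> bool := fun x => x \in q.
Let q'_ideal : idealr_closed (q' : {pred R}).
Proof. by case: hq => -[q0 sq] q1 _; split. Qed.
Let q'_prime : prime_idealr_closed (q' : {pred R}).
Proof. by case: hq. Qed.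
HB.instance Definition _ := isIdealr.Build R q' q'_ideal.
HB.instance Definition _ := isPrimeIdealrClosed.Build R q' q'_prime.
Definition mkprime : prime_idealr R := q'.
End MkPrime.

Section Chains.
Variable R : comNzRingType.
Implicit Types (p q J K M P : {pred R}).

Definition psub p q := {subset p <= q} /\ exists2 x, x \in q & x \notin p.

(** Chains are unfolded from the fixed prime [P], downwards here and upwards in [up_ge], and their
    members are plain predicates; [prime_chain_ht] and [ht_prime_chain] give the link with
    [prime_chain]. *)
Fixpoint ht_ge n P : Prop := is_prime P /\
  if n is n'.+1 then exists2 Q, ht_ge n' Q & psub Q P else True.

(** [Theta] is imposed on every member, [P] included; it confines chains to the primes below a
    maximal ideal or to a punctured spectrum. *)
Fixpoint up_ge (Theta : {pred R} -> Prop) n P : Prop := Theta P /\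
  if n is n'.+1 then exists2 Q, up_ge Theta n' Q & psub P Q else True.

Lemma ht_prime n P : ht_ge n P -> is_prime P. Proof. by case: n => [|n] []. Qed.

Lemma psub_subl p p' q : {subset p <= p'} -> psub p' q -> psub p q.
Proof.
move=> pp' [p'q [x xq xp']]; split; first by move=> y /pp' /p'q.
by exists x => //; apply: contra xp' => /pp'.
Qed.

Lemma psub_subr p q q' : {subset q <= q'} -> psub p q -> psub p q'.
Proof.
move=> qq' [pq [x xq xp]]; split; first by move=> y /pq /qq'.
by exists x => //; apply: qq'.
Qed.

Lemma ht_ge_sub n P P' : {subset P <= P'} -> is_prime P' -> ht_ge n P -> ht_ge n P'.
Proof.
case: n => [|n] PP' P'P //= -[_ [Q htQ QP]]; split=> //.
by exists Q => //; apply: psub_subr QP.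
Qed.

Lemma ht_ge_pred n P : ht_ge n.+1 P -> ht_ge n P.
Proof. by case=> pP [Q htQ [QP _]]; apply: ht_ge_sub htQ. Qed.

Lemma ht_ge_leq m n P : (m <= n)%N -> ht_ge n P -> ht_ge m P.
Proof. by move/subnK<-; elim: (n - m)%N => // k IH /ht_ge_pred. Qed.

Lemma up_ge_leq Theta m n P : (m <= n)%N -> up_ge Theta n P -> up_ge Theta m P.
Proof.
elim: m n P => [|m IHm] [|n] P //=; first by move=> _ [].
by rewrite ltnS => mn [TP [Q uQ PQ]]; split=> //; exists Q => //; apply: IHm uQ.
Qed.

Lemma up_ht (Theta : {pred R} -> Prop) n k P : (forall q, Theta q -> is_prime q) ->
  up_ge Theta n P -> ht_ge k P -> exists2 Q, Theta Q & ht_ge (n + k) Q.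
Proof.
move=> Tp; elim: n k P => [|n IHn] k P; first by case=> TP _ htP; exists P.
case=> TP [Q uQ PQ] htP; have pQ : is_prime Q by apply: Tp; case: (n) uQ => [|?] [].
by rewrite addSnnS; apply: IHn uQ _; split; last by exists P.
Qed.

Lemma prime_chain_ht n (Q : nat -> prime_idealr R) :
  prime_chain n Q -> ht_ge n (Q n).
Proof.
elim: n => [|n IHn] QC /=; first by split=> //; apply: prime_idealr_is_prime.
split; first exact: prime_idealr_is_prime.
exists (Q n : {pred R}); first by apply: IHn => i /ltnW; apply: QC.
have [QS nQ] := QC n (ltnSn n); split=> //.
apply: contrapT => nx; apply: nQ => x xQ; apply: contrapT => /negP xn.
by apply: nx; exists x.
Qed.

Lemma ht_prime_chain n P : ht_ge n P ->
  exists2 Q : nat -> prime_idealr R, prime_chain n Q & Q n =i P.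
Proof.
elim: n P => [|n IHn] P /=; first by case=> pP _; exists (fun=> mkprime pP).
case=> pP [Q /IHn[f fC fQ] [QP [x xP xQ]]].
exists (fun i => if (i <= n)%N then f i else mkprime pP); last by rewrite ltnn.
move=> i; rewrite ltnS => lein; rewrite lein; case: ltngtP (lein) => // [lt_in|ein] _.
  exact: fC.
rewrite ein; split=> [y|sub]; first by rewrite fQ => /QP.
by move: (sub x xP); rewrite fQ (negbTE xQ).
Qed.

Lemma ring_dim_geP n : ring_dim_ge R n <-> exists P, ht_ge n P.
Proof.
split=> [[Q /prime_chain_ht htQ]|[P /ht_prime_chain[Q QC _]]]; last by exists Q.
by exists (Q n : {pred R}).
Qed.

End Chains.

Lemma ideal_pow_mul_in (R : comNzRingType) (I : {pred R}) k u (J : {pred R}) :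
  is_ideal J -> (forall s, size s = k -> {subset s <= I} -> u * \prod_(a <- s) a \in J) ->
  forall y, y \in ideal_pow I k -> u * y \in J.
Proof.
move=> sJ h; apply: (@ideal_pow_ind R I k [pred y | u * y \in J]) => //.
split=> [|a x y]; rewrite !inE ?mulr0 ?(ideal0 sJ) // => xJ yJ.
by rewrite mulrDr [u * _]mulrCA (idealD sJ) // idealM.
Qed.

(** * Primes obtained by maximality: radicals, associated primes, avoidance *)

Section Noetherian.
Variable R : comNzRingType.
Hypothesis nR : noetherian R.
Implicit Types (p q J K M P : {pred R}).

Lemma adjoin_mul K v w x y : is_ideal K -> v * w \in K ->
  x \in iadj K v -> y \in iadj K w -> x * y \in K.
Proof.
move=> sK vwK /iadjP[a xK] /iadjP[b yK].
rewrite -(subrK (a * v) x) mulrDl; apply: (idealD sK); first exact: idealrM.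
rewrite -(subrK (b * w) y) mulrDr; apply: (idealD sK); first exact: idealM.
by rewrite mulrACA idealM.
Qed.

(** An ideal maximal among those containing no [u I^k] with [u] outside [M] is prime: if [v w] is in
    [K], such multiples for [K + v] and [K + w] combine into one for [K]. In the localization at
    [M], [I] is thus nilpotent modulo [J] unless some prime between [J] and [M] omits an element of
    [I]. *)
Lemma radical (I J M : {pred R}) : is_ideal J -> is_prime M ->
  (exists q, [/\ is_prime q, {subset J <= q}, {subset q <= M} &
     exists2 a, a \in I & a \notin q]) \/
  (exists2 u, u \notin M & exists k, forall y, y \in ideal_pow I k -> u * y \in J).
Proof.
move=> sJ pM; have sM := prime_sub pM.
pose C (K : {pred R^o}) := submod_closed K /\
  ~ exists2 u, u \notin M & exists k, forall y, y \in ideal_pow I k -> u * y \in K.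
case: (pselect (exists2 u, u \notin M & exists k, forall y, y \in ideal_pow I k -> u * y \in J)); first by right.
move=> nJ; left.
have [||K [[sK nK] JK Kmax]] := @noeth_max R R^o C J nR; first by move=> ? [].
  by split.
exists K; split=> //.
- split=> //.
    apply: contra_notN nK => K1; exists 1; first exact: prime_not1.
    by exists 0%N => y _; rewrite mul1r -[y]mulr1 idealM.
  move=> v w vwK; apply: contrapT => /negP; rewrite negb_or => /andP[vK wK].
  have big z : z \notin K -> exists2 u, u \notin M & exists k, forall y,
      y \in ideal_pow I k -> u * y \in iadj K z.
    move=> zK; apply: contrapT => nz; case/negP: zK.
    apply: (Kmax (iadj K z)).
    - by split=> //; apply: iadj_ideal.
    - by move=> y; apply: iadjl.
    exact: iadjr.
  have [u uM [k uk]] := big v vK; have [u' u'M [k' uk']] := big w wK.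
  apply: nK; exists (u * u'); first by rewrite primeM // negb_or uM.
  exists (k + k')%N => y yI.
  have := @ideal_pow_split R I k k' [pred y | u * u' * y \in K]; apply=> //.
    split=> [|a x z]; rewrite !inE ?mulr0 ?(ideal0 sK) // => xJ zJ.
    by rewrite mulrDr [_ * (a *: x)]mulrCA (idealD sK) // idealM.
  by move=> x z xI zI; rewrite inE mulrACA (adjoin_mul sK vwK) ?uk ?uk'.
- move=> r rK; apply: contrapT => /negP rM; apply: nK; exists r => //.
  by exists 0%N => y _; rewrite idealrM.
apply: contrapT => nI; apply: nK; exists 1; first exact: prime_not1.
exists 1%N => y; rewrite mul1r; move: y; apply: ideal_pow_ind => //.
move=> [|a [|//]] // _ aI; rewrite big_seq1.
by apply: contrapT => /negP aK; apply: nI; exists a; rewrite ?aI ?mem_head.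
Qed.

Lemma noeth_ind (Pr : {pred R} -> Prop) :
  (forall J, is_ideal J -> (forall J', is_ideal J' -> psub J J' -> Pr J') -> Pr J) ->
  forall J, is_ideal J -> Pr J.
Proof.
move=> ind J sJ; apply: contrapT => nJ.
pose C (K : {pred R^o}) := submod_closed K /\ ~ Pr K.
have [||K [[sK nK] _ Kmax]] := @noeth_max R R^o C J nR; first by move=> ? [].
  by split.
apply: nK; apply: ind => // J' sJ' [KJ' [x xJ' xK]]; apply: contrapT => nJ'.
by case/negP: xK; apply: (Kmax J').
Qed.

(** If [x y v] is in [N] and [y v] is not, the annihilator of [y v] contains [x] and that of [v], so
    only the multiples of [v] have to be compared. *)
Lemma max_colon_prime (V : lmodType R) (N : {pred V}) v : submod_closed N ->
  v \notin N ->
  (forall r, r *: v \notin N ->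
     {subset colon N v <= colon N (r *: v)} ->
     {subset colon N (r *: v) <= colon N v}) ->
  is_prime (colon N v).
Proof.
move=> sN vN vmax; split; first exact: colon_sub.
  by rewrite colonE scale1r.
move=> x y; rewrite !colonE -scalerA => xyN; apply/orP.
case: (boolP (y *: v \in N)) => yN; first by right.
left; rewrite -colonE; apply: (vmax y) => // z; rewrite !colonE => zN.
by rewrite scalerA mulrC -scalerA submodZ.
Qed.

Lemma assoc_above (V : lmodType R) (N : {pred V}) v : submod_closed N ->
  v \notin N -> exists r, r *: v \notin N /\ is_prime (colon N (r *: v)).
Proof.
move=> sN vN; pose C (K : {pred R^o}) :=
  exists2 r, r *: v \notin N & K = colon N (r *: v).
have [||K [[r rN ->] _ Kmax]] := @noeth_max R R^o C (colon N (1 *: v)) nR.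
- by move=> ? [r _ ->]; apply: colon_sub.
- by exists 1; rewrite ?scale1r.
exists r; split=> //; apply: max_colon_prime => // t tN le.
by apply: Kmax => //; exists (t * r); rewrite -scalerA.
Qed.

(** Repetitions are allowed but strict inclusions are not. This provides an [e] in all the primes
    already avoided and outside [p i], so that adding [z * e] to [y] leaves [p i] without entering
    the others. *)
Lemma prime_avoidance J (I : eqType) (p : I -> {pred R}) (s : seq I) : is_ideal J ->
  (forall i, i \in s -> is_prime (p i)) ->
  (forall i j, i \in s -> j \in s -> {subset p i <= p j} -> {subset p j <= p i}) ->
  (forall i, i \in s -> exists2 y, y \in J & y \notin p i) ->
  exists2 y, y \in J & forall i, i \in s -> y \notin p i.
Proof.
move=> sJ; elim: s => [|i s IHs] pP pI pJ; first by exists 0 => //; apply: ideal0 sJ.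
have [|||y yJ ys] := IHs.
- by move=> j js; apply: pP; rewrite inE js orbT.
- by move=> j k js ks; apply: pI; rewrite inE ?js ?ks orbT.
- by move=> j js; apply: pJ; rewrite inE js orbT.
case: (boolP (y \in p i)) => yi; last first.
  by exists y => // j; rewrite inE => /orP[/eqP->//|/ys].
have ip : is_prime (p i) by apply: pP; rewrite mem_head.
have [z zJ zi] := pJ i (mem_head _ _).
have [e ei es] : exists2 e, e \notin p i & forall j, j \in s -> e \in p j.
  have sub (t : seq I) : {subset t <= s} ->
      exists2 e, e \notin p i & forall j, j \in t -> e \in p j.
    elim: t => [|j t IHt] ts; first by exists 1 => //; apply: prime_not1.
    have [|e ei et] := IHt; first by move=> k kt; rewrite ts // inE kt orbT.
    have js : j \in s by rewrite ts ?mem_head.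
    have jp : is_prime (p j) by apply: pP; rewrite inE js orbT.
    have [f fj fi] : exists2 f, f \in p j & f \notin p i.
      apply: contrapT => nf; have /pI: {subset p j <= p i}.
        by move=> f fj; apply: contrapT => /negP fi; apply: nf; exists f.
      rewrite mem_head inE js orbT => /(_ isT isT y yi).
      by apply/negP; apply: ys.
    exists (e * f); first by rewrite primeM // negb_or ei.
    move=> k; rewrite inE => /orP[/eqP->|kt]; first by rewrite primeM // fj orbT.
    have kp : is_prime (p k).
      by apply: pP; rewrite inE (ts k) ?orbT // inE kt orbT.
    by rewrite primeM // et.
  exact: sub.
exists (y + z * e).
  by apply: (idealD sJ) => //; rewrite idealrM.
move=> j; rewrite inE => /orP[/eqP->|js].
  by rewrite (idealDl _ (prime_sub ip)) // primeM // negb_or zi.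
have jp : is_prime (p j) by apply: pP; rewrite inE js orbT.
by rewrite addrC (idealDl _ (prime_sub jp)) ?ys // primeM // es ?orbT.
Qed.

(* The maximal annihilators form a finite set of primes: a relation expressing
   one generator by finitely many others traps its annihilator. *)
Lemma regular_element (V : lmodType R) (N : {pred V}) (J : {pred R}) :
  noetherian_module V -> submod_closed N -> is_ideal J ->
  (forall v, (forall y, y \in J -> y *: v \in N) -> v \in N) ->
  exists2 y, y \in J & forall v, y *: v \in N -> v \in N.
Proof.
move=> nV sN sJ JN.
pose X : {pred V} := [pred v | `[< v \notin N /\ forall w, w \notin N ->
  {subset colon N v <= colon N w} -> {subset colon N w <= colon N v} >] ].
have Xp v : v \in X -> is_prime (colon N v).
  case/asboolP=> vN vmax; apply: max_colon_prime => // r rN; exact: vmax.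
have [s sX Xs] := noeth_gen X nV.
have [|||y yJ ys] := @prime_avoidance J _ (fun v => colon N v : {pred R}) s sJ.
- by move=> v /sX /Xp.
- move=> v w /sX/asboolP[vN vmax] /sX/asboolP[wN _]; exact: vmax.
- move=> v /sX/asboolP[vN _]; apply: contrapT => ny; case/negP: vN; apply: JN => y yJ.
  by apply: contrapT => /negP yv; apply: ny; exists y.
exists y => // v yv; apply: contrapT => /negP vN.
pose C (K : {pred R^o}) := exists2 w, w \notin N & K = colon N w.
have [||K [[w wN ->] vw wmax]] := @noeth_max R R^o C (colon N v) nR.
- by move=> ? [r _ ->]; apply: colon_sub.
- by exists v.
have wX : w \in X.
  by apply/asboolP; split=> // w' w'N; apply: wmax; exists w'.
have wp := Xp w wX.
have yw : y \in colon N w by apply: vw.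
suff [t ts tw] : exists2 t, t \in s & {subset colon N t <= colon N w}.
  have /asboolP[tN tmax] := sX t ts.
  by case/negP: (ys t ts); apply: (tmax w).
have /spanP[c cs wE] := Xs w wX.
apply: contrapT => nt.
have [e ew ec] : exists2 e, e \notin colon N w & forall p : R * V, p \in c -> e *: p.2 \in N.
  elim: c cs {wE} => [|p c IHc] cs; first by exists 1 => //; apply: prime_not1 wp.
  have [|e ew ec] := IHc; first by move=> q qc; rewrite cs // inE qc orbT.
  have [f fp fw] : exists2 f, f \in colon N p.2 & f \notin colon N w.
    apply: contrapT => nf; apply: nt; exists p.2; first by apply: cs; rewrite mem_head.
    by move=> f fp; apply: contrapT => /negP fw; apply: nf; exists f.
  exists (e * f); first by rewrite primeM // negb_or ew.
  move=> q; rewrite inE => /orP[/eqP->|qc]; first by rewrite -scalerA submodZ.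
  by rewrite mulrC -scalerA submodZ ?ec.
case/negP: ew; rewrite colonE wE scaler_sumr big_seq; apply: submod_sum => // p pc.
by rewrite scalerA mulrC -scalerA submodZ ?ec.
Qed.

End Noetherian.

(** * Nakayama's lemma at a prime, with denominators cleared *)

Section Nakayama.
Variables (R : comNzRingType) (V : lmodType R) (Q : {pred R}).
Hypothesis pQ : is_prime Q.

Let qspan (s : seq V) : {pred V} :=
  span [pred v | `[< exists2 q, q \in Q & exists2 t, t \in s & v = q *: t >] ].

Let qspan_cons t s v : v \in qspan (t :: s) -> exists2 q, q \in Q & v - q *: t \in qspan s.
Proof.
move=> vs; apply/asboolP; move: v vs.
apply: (@span_min _ _ _ [pred v | `[< exists2 q, q \in Q & v - q *: t \in qspan s >] ]).
  split=> [|a u v /asboolP[q qQ uq] /asboolP[q' qQ' vq']]; apply/asboolP.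
    by exists 0; [exact: ideal0 (prime_sub pQ) | rewrite scale0r subr0 sub0 //; apply: span_sub].
  exists (a * q + q'); first by apply: (idealD (prime_sub pQ)) => //; apply: (idealM _ (prime_sub pQ)).
  rewrite scalerDl -scalerA opprD addrACA -scalerBr.
  by rewrite subD ?submodZ //; apply: span_sub.
move=> v /asboolP[q qQ [t' t's ->]]; apply/asboolP.
move: t's; rewrite inE => /orP[/eqP->|t's]; first by exists q => //; rewrite subrr sub0 //; apply: span_sub.
exists 0; first exact: ideal0 (prime_sub pQ).
by rewrite scale0r subr0; apply: mem_span; apply/asboolP; exists q => //; exists t'.
Qed.

(** Generators are eliminated one at a time, in place of a determinant: some [w] outside [Q] kills
    the others modulo [B + R t0], and substituting back turns the relation for [t0] into [w' t0] in
    [B], where [w' = w (z - q) - e] is outside [Q]. *)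
Let nakayama_seq (s : seq V) (B : {pred V}) : submod_closed B ->
  (forall t, t \in s ->
     exists2 z, z \notin Q & exists2 v, v \in qspan s & z *: t - v \in B) ->
  exists2 w, w \notin Q & forall t, t \in s -> w *: t \in B.
Proof.
have sQ := prime_sub pQ.
elim: s B => [|t0 s IHs] B sB zs; first by exists 1 => //; apply: prime_not1.
have [|w wQ ws] := IHs (adjoin B t0) (adjoin_sub _ sB).
  move=> t ts; have [|z zQ [v vs vB]] := zs t; first by rewrite inE ts orbT.
  have [q qQ vq] := qspan_cons vs; exists z => //; exists (v - q *: t0) => //.
  by apply/adjoinP; exists q; rewrite opprB addrCA [_ + _ in X in X - _]addrC addrK.
have [z zQ [v vs vB]] := zs t0 (mem_head _ _); have [q qQ vq] := qspan_cons vs.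
have [e eQ eB] : exists2 e, e \in Q & w *: (v - q *: t0) - e *: t0 \in B.
  move: {vs vB} (v - q *: t0) vq => u us; apply/asboolP; move: u us.
  apply: (@span_min _ _ _ [pred u | `[< exists2 e, e \in Q & w *: u - e *: t0 \in B >] ]).
    split=> [|a x y /asboolP[e eQ xe] /asboolP[f fQ yf]]; apply/asboolP.
      by exists 0; [exact: ideal0 sQ | rewrite scaler0 scale0r subr0 sub0].
    exists (a * e + f); first by apply: (idealD sQ) => //; apply: idealM.
    rewrite scalerDr scalerDl opprD addrACA -(scalerA a e) [w *: (a *: x)]scalerA mulrC.
    by rewrite -scalerA -scalerBr subD ?submodZ.
  move=> u /asboolP[q' q'Q [t ts ->]]; apply/asboolP.
  have /adjoinP[c wc] := ws t ts; exists (q' * c); first by rewrite idealrM.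
  by rewrite scalerA mulrC -!scalerA -scalerBr submodZ.
pose w' := w * (z - q) - e.
have w't0 : w' *: t0 \in B.
  have -> : w' *: t0 = w *: (z *: t0 - v) + (w *: (v - q *: t0) - e *: t0).
    rewrite /w' scalerBl addrA; congr (_ - _).
    by rewrite -scalerDr addrA subrK -scalerBl scalerA.
  by rewrite subD // submodZ.
have w'Q : w' \notin Q.
  apply: contra wQ => w'Q; have : w * (z - q) \in Q by rewrite -(subrK e (w * _)) (idealD sQ).
  by rewrite primeM // (idealBK _ sQ qQ) (negbTE zQ) orbF.
exists (w' * w); first by rewrite primeM // negb_or w'Q.
move=> t; rewrite inE => /orP[/eqP->|/ws /adjoinP[c wc]].
  by rewrite mulrC -scalerA submodZ.
rewrite -scalerA -(subrK (c *: t0) (w *: t)) scalerDr.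
apply: subD => //; first exact: submodZ.
by rewrite scalerA mulrC -scalerA submodZ.
Qed.

(** Rewriting the elements of [Q Z] through [s] modulo [B] reduces to relations between the members
    of [s]. The multipliers outside [Q] stand for the localization at [Q], in which [Z] is contained
    in [B + Q Z]. *)
Lemma nakayama (Z B : {pred V}) (s : seq V) : submod_closed B ->
  {subset s <= Z} ->
  (forall v, v \in Z -> exists2 w, w \in span [in s] & v - w \in B) ->
  (forall v, v \in Z -> exists2 z, z \notin Q &
      z *: v \in span [pred w | `[< w \in B \/
        exists2 q, q \in Q & exists2 v', v' \in Z & w = q *: v' >] ]) ->
  exists2 w, w \notin Q & forall v, v \in Z -> w *: v \in B.
Proof.
move=> sB sZ Zs Zz; have sQ := prime_sub pQ.
have [|w wQ ws] := @nakayama_seq s B sB.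
  move=> t ts; have [z zQ zt] := Zz t (sZ t ts); exists z => //; move: zt; move: (z *: t) => u us; apply/asboolP; move: u us.
  apply: (@span_min _ _ _ [pred u | `[< exists2 v, v \in qspan s & u - v \in B >] ]).
    split=> [|a x y /asboolP[e eQ xe] /asboolP[f fQ yf]]; apply/asboolP.
      by exists 0; rewrite ?subr0 sub0 //; apply: span_sub.
    exists (a *: e + f); first by rewrite subD ?submodZ //; apply: span_sub.
    by rewrite opprD addrACA -scalerBr subD ?submodZ.
  move=> v /asboolP[vB|[q qQ [v' v'Z ->]]]; apply/asboolP.
    by exists 0; rewrite ?subr0 // sub0 //; apply: span_sub.
  have [w ws wB] := Zs v' v'Z; exists (q *: w); last by rewrite -scalerBr submodZ.
  move: w ws {wB}; apply: (@span_min _ _ _ [pred w | q *: w \in qspan s]).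
    exact/scale_preim_sub/span_sub.
  move=> t' t's; suff: q *: t' \in qspan s by [].
  apply: mem_span; apply/asboolP.
  by exists q => //; exists t'.
exists w => // v /Zs[u us vu]; rewrite -(subrK u v) scalerDr.
apply: subD => //; first exact: submodZ.
move: u us {vu}; apply: (@span_min _ _ _ [pred u | w *: u \in B]) => //.
exact: scale_preim_sub.
Qed.

End Nakayama.

(** * Hilbert's basis theorem and Krull's height theorem *)

Section HilbertBasis.
Variable R : comNzRingType.
Hypothesis nR : noetherian R.

Theorem hilbert_basis : noetherian {poly R}.
Proof.
move=> J sJ.
have sJ' : is_ideal (J : {pred {poly R}}) := sJ.
(* For an ideal [T], these [a] are the coefficients of degree [n] of the members of degree at most
   [n]; bounding the size instead of fixing the degree admits 0, so that they form an ideal. *)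
pose lift n (T : {pred {poly R}}) a :=
  exists g : {poly R}, [/\ g \in T, (size g <= n.+1)%N & g`_n = a].
have lift_sub n (T : {pred {poly R}}) : is_ideal T ->
    is_ideal [pred a | `[< lift n T a >] ].
  move=> sT; split=> [|a b c /asboolP[g [gT sg gb]] /asboolP[h [hT sh hc]]]; apply/asboolP.
    by exists 0; rewrite size_poly0 coef0 ideal0.
  exists (a%:P * g + h); split.
  - by apply: idealD => //; apply: idealM.
  - rewrite (leq_trans (size_polyD _ _)) // geq_max sh andbT mul_polyC.
    exact: leq_trans (size_scale_leq _ _) sg.
  by rewrite coefD coefCM gb hc.
pose sp (T : seq {poly R}) : {pred {poly R}} := @span {poly R} {poly R}^o [in T].
have sp_sub T : is_ideal (sp T) by apply: span_sub.
have sp_mono T T' : {subset T <= T'} -> {subset sp T <= sp T'}.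
  by move=> TT'; apply: (@span_mono _ {poly R}^o [in T] [in T'] TT').
have lift_mono n (T T' : {pred {poly R}}) a : {subset T <= T'} -> lift n T a -> lift n T' a.
  by move=> TT' [g [/TT' gT sg ga]]; exists g.
(* The leading coefficients of all degrees together are finitely generated; [D] bounds the degrees
   of the generators, which powers of ['X] carry to any degree [n >= D]. The finitely many lower
   degrees are treated one by one. *)
have [D [T TJ TD]] : exists D, exists2 T : seq {poly R}, {subset T <= J} &
    forall n a, (D <= n)%N -> lift n J a -> lift n (sp T) a.
  pose X : {pred R^o} := [pred a | `[< exists n, lift n J a >] ].
  have [s sX Xs] := noeth_gen X nR.
  have [D [T TJ TD]] : exists D, exists2 T : seq {poly R}, {subset T <= J} &
      forall n a, (D <= n)%N -> a \in s -> lift n (sp T) a.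
    elim: s sX {Xs} => [|a s IHs] sX; first by exists 0%N; exists [::].
    have [|D [T TJ TD]] := IHs; first by move=> b bs; rewrite sX // inE bs orbT.
    have /asboolP[d [g [gJ sg ga]]] := sX a (mem_head _ _).
    exists (maxn d D); exists (g :: T) => [f|n b].
      by rewrite inE => /orP[/eqP->|/TJ].
    rewrite geq_max inE => /andP[dn Dn] /orP[/eqP->|bs]; last first.
      apply: lift_mono (TD n b Dn bs); apply: sp_mono => f fT.
      by rewrite inE fT orbT.
    exists ('X^(n - d) * g); split.
    - by apply: idealM; [apply: sp_sub | apply: mem_span; rewrite inseqE mem_head].
    - rewrite (leq_trans (size_polyMleq _ _)) // size_polyXn /=.
      by rewrite (leq_trans (leq_add (leqnn _) sg)) // addnS subnK.
    by rewrite coefXnM ltnNge leq_subr /= subKn.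
  exists D; exists T => // n a Dn aJ.
  have : a \in X by apply/asboolP; exists n.
  move/Xs => as_; apply/asboolP; move: a as_ {aJ}.
  apply: (@span_min R R^o _ [pred a | `[< lift n (sp T) a >] ]).
    exact/lift_sub/sp_sub.
  by move=> a as_; apply/asboolP; apply: TD.
have fin n : exists2 T : seq {poly R}, {subset T <= J} &
    forall a, lift n J a -> lift n (sp T) a.
  pose X : {pred R^o} := [pred a | `[< lift n J a >] ].
  have [s sX Xs] := noeth_gen X nR.
  have [T' T'J T's] : exists2 T : seq {poly R}, {subset T <= J} &
      forall a, a \in s -> lift n (sp T) a.
    elim: s sX {Xs} => [|a s IHs] sX; first by exists [::].
    have [|T' T'J T's] := IHs; first by move=> b bs; rewrite sX // inE bs orbT.
    have /asboolP[g [gJ sg ga]] := sX a (mem_head _ _).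
    exists (g :: T') => [f|b]; first by rewrite inE => /orP[/eqP->|/T'J].
    rewrite inE => /orP[/eqP->|bs]; last first.
      by apply: lift_mono (T's b bs); apply: sp_mono => f fT; rewrite inE fT orbT.
    by exists g; split=> //; apply: mem_span; rewrite inseqE mem_head.
  exists T' => // a aJ; have : a \in X by apply/asboolP.
  move/Xs => as_; apply/asboolP; move: a as_ {aJ}.
  apply: (@span_min R R^o _ [pred a | `[< lift n (sp T') a >] ]).
    exact/lift_sub/sp_sub.
  by move=> a as_; apply/asboolP; apply: T's.
have [T' T'J T'D] : exists2 T' : seq {poly R}, {subset T' <= J} &
    forall n a, (n < D)%N -> lift n J a -> lift n (sp T') a.
  elim: D {TD} => [|D [T' T'J T'D]]; first by exists [::].
  have [T'' T''J T''D] := fin D; exists (T'' ++ T') => [f|n a].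
    by rewrite mem_cat => /orP[/T''J|/T'J].
  rewrite ltnS leq_eqVlt => /orP[/eqP->|nD] aJ.
    by apply: lift_mono (T''D a aJ); apply: sp_mono => f fT; rewrite mem_cat fT.
  by apply: lift_mono (T'D n a nD aJ); apply: sp_mono => f fT; rewrite mem_cat fT orbT.
pose U := T ++ T'.
have UJ : {subset sp U <= J}.
  apply: (@span_min _ {poly R}^o [in U] J) => // f.
  by rewrite inseqE mem_cat => /orP[/TJ|/T'J].
have liftU n a : lift n J a -> lift n (sp U) a.
  case: (ltnP n D) => nD aJ.
    by apply: lift_mono (T'D n a nD aJ); apply: sp_mono => f fT; rewrite mem_cat fT orbT.
  by apply: lift_mono (TD n a nD aJ); apply: sp_mono => f fT; rewrite mem_cat fT.
exists U => f; apply/idP/idP => [fJ|/UJ //].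
have [n] := ubnP (size f); elim: n f fJ => // n IHn f fJ; rewrite ltnS => sf.
case: n IHn sf => [|n] IHn sf.
  by move: sf; rewrite leqn0 size_poly_eq0 => /eqP->; apply: ideal0 (sp_sub U).
have [|g [gU sg gn]] := liftU n f`_n; first by exists f.
rewrite -(subrK g f); apply: (idealD (sp_sub U)) => //.
apply: IHn; first by apply: idealB => //; apply: UJ.
rewrite ltnS; apply/leq_sizeP => j nj; rewrite coefB.
move: nj; rewrite leq_eqVlt => /orP[/eqP<-|nj]; first by rewrite gn subrr.
by rewrite (leq_sizeP _ _ sf) ?(leq_sizeP _ _ sg) ?subrr.
Qed.

End HilbertBasis.

Lemma preim_ideal (R S : comNzRingType) (f : {rmorphism R -> S}) (J : {pred S}) :
  is_ideal J -> is_ideal [pred x | f x \in J].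
Proof.
move=> sJ; split=> [|a x y]; rewrite !inE ?rmorph0 ?ideal0 // => xJ yJ.
by rewrite rmorphD idealD // rmorphM idealM.
Qed.

Lemma preim_prime (R S : comNzRingType) (f : {rmorphism R -> S}) (q : {pred S}) :
  is_prime q -> is_prime [pred x | f x \in q].
Proof.
move=> [sq q1 qM]; split; first exact: preim_ideal.
  by rewrite inE rmorph1.
by move=> x y; rewrite !inE rmorphM => /qM.
Qed.

Lemma noetherian_image (R S : comNzRingType) (f : {rmorphism R -> S}) :
  noetherian R -> (forall y, exists x, f x = y) -> noetherian S.
Proof.
move=> nR fs J sJ; have sJ' : is_ideal (J : {pred S}) := sJ.
pose K : {pred R^o} := [pred x | f x \in J].
have sK : submod_closed K by apply: preim_ideal.
have [s Ks] := nR K sK; exists (map f s) => y; apply/idP/idP.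
  have [x <-] := fs y => fxJ; have : x \in K by [].
  rewrite Ks; move: x {fxJ}.
  apply: (@span_min R R^o _ [pred x | f x \in (@span S S^o [in map f s])]).
    by apply: preim_ideal; apply: (@span_sub S S^o).
  move=> x xs; suff: f x \in (@span S S^o [in map f s]) by [].
  by apply: mem_span; rewrite inseqE map_f.
move: y; apply: span_min => // y; rewrite inseqE => /mapP[x xs ->].
have : x \in K by rewrite Ks mem_span.
by [].
Qed.

Section Krull.
Variable R : comNzRingType.
Hypothesis nR : noetherian R.
Implicit Types (p q J K L M P : {pred R}).

Definition addi K L : {pred R} := [pred r | `[< exists2 a, a \in K & r - a \in L >] ].

Lemma addiP K L r : reflect (exists2 a, a \in K & r - a \in L) (r \in addi K L).
Proof. exact: asboolP. Qed.

Lemma addi_ideal K L : is_ideal K -> is_ideal L -> is_ideal (addi K L).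
Proof.
move=> sK sL; split=> [|a x y /addiP[b bK xL] /addiP[c cK yL]]; apply/addiP.
  by exists 0; rewrite ?subr0 ideal0.
exists (a * b + c); first by apply: idealD => //; apply: idealM.
have -> : a *: (x : R^o) + y - (a * b + c) = a * (x - b) + (y - c).
  by rewrite /GRing.scale /=; ring.
by apply: idealD => //; apply: idealM.
Qed.

Lemma addil K L r : is_ideal L -> r \in K -> r \in addi K L.
Proof. by move=> sL rK; apply/addiP; exists r; rewrite ?subrr ?ideal0. Qed.

Lemma addir K L r : is_ideal K -> r \in L -> r \in addi K L.
Proof. by move=> sK rL; apply/addiP; exists 0; rewrite ?subr0 ?ideal0. Qed.

(* A strictly descending chain of subspaces yields a strictly ascending one,
   spanned by witnesses of the strict inclusions. *)
Lemma dcc_residue P (Z B : {pred R}) (L : nat -> {pred R}) : is_prime P ->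
  is_ideal B -> (forall x z, x \in P -> z \in Z -> x * z \in B) ->
  (forall n, is_ideal (L n)) -> (forall n, {subset L n.+1 <= L n}) ->
  (forall n, {subset B <= L n}) -> (forall n, {subset L n <= Z}) ->
  exists N, forall n, (N <= n)%N -> forall r, r \in L n ->
    exists2 u, u \notin P & u * r \in L n.+1.
Proof.
move=> pP sB PZ sL Lmono BL LZ.
have Lleq i j : (i <= j)%N -> {subset L j <= L i}.
  by move/subnK <-; elim: (j - i)%N => // k IH x /Lmono; apply: IH.
pose fail n r := r \in L n /\ forall u, u \notin P -> u * r \notin L n.+1.
(* [v n] is a witness of the failure at stage [n] if there is one, and 0 otherwise. *)
have [v vP] : exists v : nat -> R, forall n,
    v n \in L n /\ (v n = 0 \/ fail n (v n)) /\ ((exists r, fail n r) -> fail n (v n)).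
  suff /choice[v vP] n : exists r, r \in L n /\ (r = 0 \/ fail n r) /\
     ((exists r, fail n r) -> fail n r) by exists v.
  case: (pselect (exists r, fail n r)) => [[r rf]|nr].
    by exists r; split; [case: rf | split=> //; right].
  by exists 0; rewrite ideal0 //; split=> //; split; [left|].
pose X : {pred R} := [pred x | (x \in B) || `[< exists n, x = v n >] ].
have [s sX Xs] := @noeth_gen R R^o X nR.
have [N sN] : exists N, forall x, x \in s ->
    x \in B \/ exists2 j, (j < N)%N & x = v j.
  elim: s sX {Xs} => [|x s IHs] sX; first by exists 0%N.
  have [|N sN] := IHs; first by move=> y ys; rewrite sX // inE ys orbT.
  have /orP[xB|/asboolP[j xj]] := sX x (mem_head _ _).
    by exists N => y; rewrite inE => /orP[/eqP->|/sN //]; left.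
  exists (maxn N j.+1) => y; rewrite inE => /orP[/eqP->|/sN[yB|[i iN yi]]].
  - by right; exists j => //; rewrite leq_maxr.
  - by left.
  by right; exists i => //; rewrite (leq_trans iN) ?leq_maxl.
have XN x : x \in X -> exists a : nat -> R,
    x - \sum_(0 <= j < N) a j * v j \in B.
  move/Xs => xs; apply/asboolP; move: x xs.
  apply: (@span_min R R^o _ [pred x | `[< exists a : nat -> R,
    x - \sum_(0 <= j < N) a j * v j \in B >] ]).
    split=> [|c x y /asboolP[a xa] /asboolP[b yb]]; apply/asboolP.
      exists (fun=> 0); rewrite big1 ?subr0 ?ideal0 // => j _; exact: mul0r.
    exists (fun j => c * a j + b j).
    have -> : c *: (x : R^o) + y - \sum_(0 <= j < N) (c * a j + b j) * v j =
        c * (x - \sum_(0 <= j < N) a j * v j) + (y - \sum_(0 <= j < N) b j * v j).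
      rewrite mulrBr mulr_sumr addrACA -opprD -big_split /=; congr (_ - _).
      by apply: eq_bigr => j _; rewrite mulrA mulrDl.
    by apply: idealD => //; apply: idealM.
  move=> x xs; apply/asboolP; have [xB|[j jN ->]] := sN x xs.
    by exists (fun=> 0); rewrite big1 ?subr0 // => j _; exact: mul0r.
  exists (fun i => (i == j)%:R).
  rewrite (bigD1_seq j) ?iota_uniq ?mem_index_iota //= eqxx mul1r big1 => [|i /negbTE->].
    by rewrite addr0 subrr ideal0.
  exact: mul0r.
exists N => n Nn r rL; apply: contrapT => nr.
have rf : fail n r by split=> // u uP; apply/negP => ur; apply: nr; exists u.
have [vL [_ /(_ (ex_intro _ r rf)) [_ vf]]] := vP n.
have [|a aB] := XN (v n); first by rewrite inE; apply/orP; right; apply/asboolP; exists n.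
(* The earlier terms are in [B] by induction and the later ones in [L k.+1], so [a k * v k] is in
   [L k.+1] as well; unless [v k = 0], it is a witness of failure, which forces [a k] into [P]. *)
have sumB k : (k <= N)%N -> \sum_(0 <= j < k) a j * v j \in B.
  elim: k => [|k IHk] kN; first by rewrite big_nil ideal0.
  rewrite big_nat_recr //=; apply: (idealD sB) (IHk (ltnW kN)) _.
  have [vk [[->|[_ fk]] _]] := vP k; first by rewrite mulr0 ideal0.
  apply: PZ (LZ k _ vk); apply: contrapT => /negP /fk /negP; apply.
  have -> : a k * v k = v n - (v n - \sum_(0 <= j < N) a j * v j) -
      \sum_(0 <= j < k) a j * v j - \sum_(k.+1 <= j < N) a j * v j.
    rewrite (big_cat_nat (n := k) (m := 0) (p := N)) ?(ltnW kN) //= (@big_ltn _ _ _ k N) //; ring.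
  apply: (idealB (sL _)); last first.
    rewrite big_nat; apply: ideal_sum => // i /andP[ki _]; apply: idealM => //.
    by apply: Lleq ki _ _; case: (vP i).
  apply: (idealB (sL _)); last by apply: BL; apply: IHk (ltnW kN).
  apply: (idealB (sL _)); last exact: BL.
  by apply: Lleq vL; apply: leq_trans Nn.
have vB : v n \in B.
  by rewrite -(subrK (\sum_(0 <= j < N) a j * v j) (v n)); apply: idealD => //; apply: sumB.
by have /negP := vf 1 (prime_not1 pP); rewrite mul1r; apply; apply: BL.
Qed.

Lemma ideal_pow_succ (I : {pred R}) i : {subset ideal_pow I i.+1 <= ideal_pow I i}.
Proof.
have := @ideal_pow_split R I 1 i (ideal_pow I i) (ideal_pow_submod _ _); rewrite add1n.
by apply=> x y _ yI; apply: ideal_powMl.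
Qed.

(** [L i n] is the trace of [K n] on the layer [P^i / P^(i+1)], which [P] annihilates, so
    [dcc_residue] stabilizes each of the [k] layers. This replaces the finite length of the local
    ring at [P] modulo a power of [P]. *)
Lemma dcc_primary P (K : nat -> {pred R}) u0 k : is_prime P ->
  (forall n, is_ideal (K n)) -> (forall n, {subset K n.+1 <= K n}) ->
  u0 \notin P -> (forall n y, y \in ideal_pow P k -> u0 * y \in K n) ->
  exists n, forall r, r \in K n -> exists2 u, u \notin P & u * r \in K n.+1.
Proof.
move=> pP sK Kmono u0P PK.
pose L i n := addi [pred x | (x \in K n) && (x \in ideal_pow P i)] (ideal_pow P i.+1).
have sI i : is_ideal (ideal_pow P i) by apply: ideal_pow_submod.
have sKI i n : is_ideal [pred x | (x \in K n) && (x \in ideal_pow P i)].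
  split=> [|a x y /andP[xK xI] /andP[yK yI]]; rewrite inE; first by rewrite !ideal0.
  by apply/andP; split; apply: idealD => //; apply: idealM.
have [N NP] : exists N, forall i, (i < k)%N -> forall n, (N <= n)%N ->
    forall r, r \in L i n -> exists2 u, u \notin P & u * r \in L i n.+1.
  elim: k {PK} => [|k [N NP]]; first by exists 0%N.
  have [||||||M MP] := @dcc_residue P (ideal_pow P k) (ideal_pow P k.+1) (L k) pP.
  - exact: sI.
  - by move=> x z xP zI; rewrite -add1n; apply: ideal_powM => //; apply: ideal_pow1.
  - by move=> n; apply: addi_ideal.
  - move=> n x /addiP[a /andP[aK aI] xa]; apply/addiP; exists a => //.
    by rewrite inE aI Kmono.
  - by move=> n x xI; apply: addir.
  - move=> n x /addiP[a /andP[aK aI] xa]; rewrite -(subrK a x).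
    by apply: idealD => //; apply: ideal_pow_succ.
  exists (maxn N M) => i; rewrite ltnS leq_eqVlt => /orP[/eqP->|ik] n; rewrite geq_max.
    by case/andP=> _; apply: MP.
  by case/andP=> Nn _; apply: NP.
exists N => r rK.
(* Modulo [K N.+1] the element is pushed down one layer at a time until it lies in [P^k], which [u0]
   multiplies into every [K n]. *)
suff [u uP [p pK [pI rp]]] : exists2 u, u \notin P & exists2 p, p \in K N &
    p \in ideal_pow P k /\ u * r - p \in K N.+1.
  exists (u0 * u); first by rewrite primeM // negb_or u0P.
  rewrite -(subrK p (u * r)) in rp *.
  rewrite -mulrA -(subrK p (u * r)) mulrDr; apply: idealD => //; last exact: PK.
  by apply: idealM => //; move: rp; rewrite subrK.
elim: k NP {PK} => [|i IHi] NP.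
  exists 1; first exact: prime_not1.
  by exists r => //; rewrite ideal_pow0 mul1r subrr ideal0.
have [|u uP [p pK [pI rp]]] := IHi; first by move=> j ji; apply: NP; apply: leqW.
have [|u' u'P /addiP[q /andP[qK qI] pq]] := NP i (ltnSn i) N (leqnn N) p.
  by apply: addil => //; rewrite inE pK.
exists (u' * u); first by rewrite primeM // negb_or u'P.
exists (u' * p - q).
  by apply: idealB => //; [apply: idealM | apply: Kmono].
split=> //; have -> : u' * u * r - (u' * p - q) = u' * (u * r - p) + q by ring.
by apply: idealD => //; apply: idealM.
Qed.

(** Krull's principal ideal theorem modulo [Q0], by symbolic powers [S n] of [Q]. Locally at [P] the
    ideals [S n + x R] contain a power of [P], so they stabilize; as [x] is not in [Q], [S n] lies
    in [S n.+1 + x S n]. Nakayama's lemma at [P], then at [Q], puts a multiple of [Q^n] by an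
    element outside [Q] into [Q0], although [Q0] is strictly below [Q]. *)
Lemma krull_pit x Q0 Q P : is_prime Q0 -> is_prime Q -> is_prime P ->
  psub Q0 Q -> psub Q P -> x \in P ->
  (forall P', is_prime P' -> {subset Q0 <= P'} -> x \in P' -> {subset P' <= P} ->
     {subset P <= P'}) -> False.
Proof.
move=> pQ0 pQ pP [Q0Q [a aQ aQ0]] [QP [b bP bQ]] xP xmin.
have [[sQ0 sQ] sP] := (prime_sub pQ0, prime_sub pQ, prime_sub pP).
have xQ : x \notin Q by apply: contra bQ => xQ; apply: (xmin Q).
have [u0 u0P [k u0k]] : exists2 u, u \notin P & exists k, forall y,
    y \in ideal_pow P k -> u * y \in iadj Q0 x.
  have [[q [pq Jq qP [c cP cq]]]|//] := radical nR P (iadj_ideal x sQ0) pP.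
  case/negP: cq; apply: (xmin q) => // [y yQ0|]; apply: Jq; first exact: iadjl.
  exact: iadjr.
pose S n : {pred R} := [pred r | `[< exists2 v, v \notin Q &
  v * r \in addi (ideal_pow Q n) Q0 >] ].
have sA n : is_ideal (addi (ideal_pow Q n) Q0).
  by apply: addi_ideal => //; apply: ideal_pow_submod.
have sS n : is_ideal (S n).
  split=> [|c y z /asboolP[v vQ yv] /asboolP[w wQ zw]]; apply/asboolP.
    by exists 1; [exact: prime_not1 | rewrite mulr0 ideal0].
  exists (v * w); first by rewrite primeM // negb_or vQ.
  have -> : v * w * (c *: (y : R^o) + z) = c * w * (v * y) + v * (w * z).
    by rewrite /GRing.scale /=; ring.
  by apply: idealD => //; apply: idealM.
have Smono n : {subset S n.+1 <= S n}.
  move=> r /asboolP[v vQ /addiP[c cI rc]]; apply/asboolP; exists v => //.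
  by apply/addiP; exists c => //; apply: ideal_pow_succ.
have Q0S n : {subset Q0 <= S n}.
  move=> r rQ0; apply/asboolP; exists 1; first exact: prime_not1.
  by rewrite mul1r; apply: addir => //; apply: ideal_pow_submod.
have IS n : {subset ideal_pow Q n <= S n}.
  move=> r rI; apply/asboolP; exists 1; first exact: prime_not1.
  by rewrite mul1r; apply: addil.
have Sx n c : x * c \in S n -> c \in S n.
  move/asboolP=> [v vQ xc]; apply/asboolP; exists (v * x); rewrite -?mulrA //.
  by rewrite primeM // negb_or vQ.
have [n nP] : exists n, forall r, r \in iadj (S n) x ->
    exists2 u, u \notin P & u * r \in iadj (S n.+1) x.
  apply: (@dcc_primary P (fun n => iadj (S n) x) u0 k) => // [n|n|n y /u0k].
  - exact: iadj_ideal.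
  - apply: iadj_min; first exact: iadj_ideal.
      by move=> r /Smono; apply: iadjl.
    exact: iadjr.
  move: (u0 * y); apply: iadj_min; first exact: iadj_ideal.
    by move=> r /(Q0S n); apply: iadjl.
  exact: iadjr.
have [w wP wS] : exists2 w, w \notin P & forall v, v \in S n -> w * v \in S n.+1.
  have [s sE] := nR (sS n).
  apply: (@nakayama R R^o P pP (S n) (S n.+1) s) => //; first exact: sS.
  - by move=> v vs; rewrite sE mem_span.
  - by move=> v vS; exists v; [rewrite -sE | rewrite subrr; apply: sub0 (sS _)].
  move=> v vS; have [u uP /iadjP[c uc]] := nP v (iadjl x vS); exists u => //.
  have -> : u *: (v : R^o) = (u * v - c * x) + x * c.
    by rewrite /GRing.scale /=; ring.
  apply: (idealD (span_sub _)); apply: mem_span; apply/asboolP; first by left.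
  right; exists x => //; exists c => //; apply: (Sx n); rewrite mulrC.
  rewrite -(subKr (u * v) (c * x)); apply: idealB => //; first exact: idealM.
  exact: Smono.
have [w' w'Q w'S] : exists2 w, w \notin Q & forall v, v \in ideal_pow Q n -> w * v \in Q0.
  have [s sE] := nR (ideal_pow_submod Q n).
  apply: (@nakayama R R^o Q pQ (ideal_pow Q n) Q0 s) => //.
  - by move=> v vs; rewrite sE mem_span.
  - by move=> v vS; exists v; [rewrite -sE | rewrite subrr; apply: sub0 sQ0].
  move=> v /IS /wS /asboolP[z zQ /addiP[c cI vc]]; exists (z * w).
    by rewrite primeM // negb_or zQ; apply: contra wP; apply: QP.
  have -> : (z * w) *: (v : R^o) = (z * (w * v) - c) + c.
    by rewrite /GRing.scale /=; ring.
  apply: (idealD (span_sub _)); first by apply: mem_span; apply/asboolP; left.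
  move: c cI {vc}; apply: ideal_pow_ind; first exact: span_sub.
  move=> [//|c t] [tn] tQ; rewrite big_cons; apply: mem_span; apply/asboolP; right.
  exists c; first by rewrite tQ ?mem_head.
  exists (\prod_(e <- t) e) => //; rewrite -tn; apply: prod_ideal_pow => e et.
  by rewrite tQ // inE et orbT.
have : w' * a ^+ n \in Q0.
  apply: w'S; have := @prod_ideal_pow R Q (nseq n a); rewrite size_nseq.
  by rewrite big_nseq iter_mulr_1; apply=> e /nseqP[-> _].
rewrite primeM // => /orP[/Q0Q|/(primeX pQ0)]; first by rewrite (negbTE w'Q).
by rewrite (negbTE aQ0).
Qed.

(** Take [Q] maximal among the primes strictly below [P] and above [Q1], and [x] in [s] outside [Q].
    Then [P] is minimal over [Q + x], so every other [y] yields some [u y^k - c x] in [Q]. These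
    elements replace the [y], one fewer in number, and [krull_pit] shows that [Q] is minimal over
    them. *)
Theorem krull_height (s : seq R) P : is_prime P -> {subset s <= P} ->
  (forall P', is_prime P' -> {subset s <= P'} -> {subset P' <= P} ->
     {subset P <= P'}) ->
  ~ ht_ge (size s).+1 P.
Proof.
have [n] := ubnP (size s); elim: n s P => // n IHn s P; rewrite ltnS => sn pP sP smin.
case=> _ [Q1 htQ1 Q1P].
have [s0|[x xs xQ1]] : {subset s <= Q1} \/ exists2 x, x \in s & x \notin Q1.
  case: (pselect (exists2 x, x \in s & x \notin Q1)) => [|nx]; [by right | left].
  by move=> x xs; apply: contrapT => /negP xQ1; apply: nx; exists x.
  case: Q1P => Q1P [y yP /negP]; apply.
  by apply: (smin Q1) => //; apply: ht_prime htQ1.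
pose C (K : {pred R^o}) := is_prime K /\ psub K P.
have [||Q [[pQ QP] Q1Q Qmax]] := @noeth_max R R^o C Q1 nR.
- by move=> ? [/prime_sub].
- by split=> //; apply: ht_prime htQ1.
have {htQ1 xs xQ1 x} htQ := ht_ge_sub Q1Q pQ htQ1.
have [x xs xQ] : exists2 x, x \in s & x \notin Q.
  apply: contrapT => nx; case: QP => QP [y yP /negP]; apply.
  apply: (smin Q) => // x xs; apply: contrapT => /negP xQ; apply: nx.
  by exists x.
have sQ := prime_sub pQ.
have reduce y : y \in rem x s -> exists2 z, z \in Q & exists2 u, u \notin P &
    exists k c, z = u * y ^+ k - c * x.
  move/mem_rem => ys.
  have [[q [pq Jq qP [c]]]|[u uP [k uk]]] := radical nR (pred1 y) (iadj_ideal x sQ) pP.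
    rewrite inE => /eqP-> yq; case/negP: xQ; apply: (Qmax q).
    - by split=> //; split=> //; exists y; rewrite ?sP.
    - by move=> z zQ; apply: Jq; apply: iadjl.
    by apply: Jq; apply: iadjr.
  have /uk /iadjP[c yc] : y ^+ k \in ideal_pow (pred1 y) k.
    have := @prod_ideal_pow R (pred1 y) (nseq k y); rewrite size_nseq big_nseq iter_mulr_1.
    by apply=> e /nseqP[-> _]; rewrite inE.
  by exists (u * y ^+ k - c * x) => //; exists u => //; exists k, c.
have [t [ts tQ tP]] : exists t : seq R, [/\ size t = size (rem x s), {subset t <= Q} &
    forall y, y \in rem x s -> exists2 z, z \in t & exists2 u, u \notin P &
      exists k c, z = u * y ^+ k - c * x].
  elim: (rem x s) reduce => [|y r IHr] red; first by exists [::].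
  have [|t [tr tQ tP]] := IHr; first by move=> z zr; apply: red; rewrite inE zr orbT.
  have [z zQ zP] := red y (mem_head _ _); exists (z :: t); split=> /=.
  - by rewrite tr.
  - by move=> e; rewrite inE => /orP[/eqP->|/tQ].
  move=> e; rewrite inE => /orP[/eqP->|/tP[f ft fP]].
    by exists z => //; rewrite mem_head.
  by exists f => //; rewrite inE ft orbT.
have ss : size s = (size t).+1.
  by rewrite ts size_rem // prednK //; case: (s) xs.
apply: (IHn t Q) => //.
- by rewrite -ltnS -ss ltnS.
- move=> P' pP' tP' P'Q; apply: contrapT => nQ; have P'Qs : psub P' Q.
    split=> //; apply: contrapT => ny; apply: nQ => y yQ.
    by apply: contrapT => /negP yP'; apply: ny; exists y.
  apply: (@krull_pit x P' Q P) => //; first exact: sP.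
  move=> P'' pP'' P'P'' xP'' P''P; apply: smin => // y ys.
  case: (eqVneq y x) => [->//|yx].
  have [|z zt [u uP [k [c zE]]]] := tP y.
    by move: ys; rewrite (perm_mem (perm_to_rem xs)) inE (negbTE yx).
  have : u * y ^+ k \in P''.
    rewrite -(subrK (c * x) (u * _)) -zE; have sP'' := prime_sub pP''.
    by apply: idealD => //; [apply: P'P''; apply: tP' | apply: idealM].
  rewrite primeM // => /orP[/P''P|/(primeX pP'')//]; by rewrite (negbTE uP).
by rewrite -ss.
Qed.

End Krull.

Lemma eq_pred (T : Type) (p q : {pred T}) : p =i q -> p = q.
Proof. by move=> e; apply: funext => x; apply: e. Qed.

Lemma expr_ideal_pow (R : comNzRingType) (I : {pred R}) x k :
  x \in I -> x ^+ k \in ideal_pow I k.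
Proof.
move=> xI; have := @prod_ideal_pow R I (nseq k x); rewrite size_nseq big_nseq iter_mulr_1.
by apply=> e /nseqP[-> _].
Qed.

(** * Primes over regular sequences *)

Section RegularSequences.
Variable R : comNzRingType.
Hypothesis nR : noetherian R.
Implicit Types (p q J K M P : {pred R}) (zs : seq R).

(** Regular sequences on [R / K]: the ideal [K] grows along the sequence, in place of successive
    quotient rings. *)
Fixpoint reg_mod K zs : Prop :=
  if zs is z :: zs' then (forall v, z * v \in K -> v \in K) /\ reg_mod (iadj K z) zs'
  else True.

(** Below a prime over [K + z] there is a prime over [K] omitting [z]: otherwise [u z^k] is in [K]
    with [u] outside the first prime, and the regularity of [z] puts [u] into [K]. *)
Lemma reg_ht K zs p : is_ideal K -> is_prime p -> {subset K <= p} ->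
  {subset zs <= p} -> reg_mod K zs -> ht_ge (size zs) p.
Proof.
move=> sK pp Kp zp rz.
suff [q [pq Kq uq]] : exists q, [/\ is_prime q, {subset K <= q} &
    up_ge (fun q => is_prime q /\ {subset q <= p}) (size zs) q].
  have [||Q [pQ Qp]] := up_ht (k := 0) _ uq; [by move=> ? []|by split|rewrite addn0].
  exact: ht_ge_sub.
elim: zs K sK Kp zp rz => [|z zs IHz] K sK Kp zp.
  by move=> _; exists p; split=> //; split=> //; split.
case=> zK rz; have [|||q0 [pq0 Kq0 uq0]] := IHz (iadj K z) _ _ _ rz.
- exact: iadj_ideal.
- by apply: iadj_min => //; [exact: prime_sub | rewrite zp ?mem_head].
- by move=> y yz; rewrite zp // inE yz orbT.
have [[q [pq Kq qq0 [a]]]|[u uq [k uk]]] := radical nR (pred1 z) sK pq0.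
  rewrite inE => /eqP-> zq; exists q; split=> //.
  have q0p : {subset q0 <= p} by case: (size zs) uq0 => [|n] [[]].
  split; first by split=> // y /qq0 /q0p.
  by exists q0 => //; split=> //; exists z => //; apply: Kq0; apply: iadjr.
case/negP: uq; apply: Kq0; apply: iadjl.
have {uk} := uk _ (expr_ideal_pow (I := pred1 z) k (eqxx z)).
elim: k => [|k IHk]; first by rewrite expr0 mulr1.
by rewrite exprS mulrCA => /zK /IHk.
Qed.

Section Local.
Variable m : {pred R}.
Hypothesis pm : is_prime m.
Hypothesis hm : forall J, is_ideal J -> 1 \notin J -> {subset J <= m}.

Lemma notin_local u K w : is_ideal K -> u \notin m -> u * w \in K -> w \in K.
Proof.
move=> sK um uw; apply: contrapT => /negP wK; case/negP: um.
by apply: (hm (icolon_ideal w sK)) => //; rewrite icolonE mul1r.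
Qed.

Lemma krull_regular K (Z : {pred R}) z : is_ideal K -> is_ideal Z -> z \in m ->
  (forall v, v \in Z -> exists2 c, c \in Z & v - c * z \in K) -> {subset Z <= K}.
Proof.
move=> sK sZ zm ZK; have [s sE] := nR sZ.
have [|||w wm wZ] := @nakayama R R^o m pm Z K s sK.
- by move=> v vs; rewrite sE mem_span.
- by move=> v vS; exists v; [rewrite -sE | rewrite subrr; apply: sub0 sK].
- move=> v /ZK[c cZ vc]; exists 1; first exact: prime_not1.
  have -> : 1 *: (v : R^o) = (v - c * z) + z * c by rewrite /GRing.scale /=; ring.
  apply: (idealD (span_sub _)); apply: mem_span; apply/asboolP; first by left.
  by right; exists z => //; exists c.
by move=> v /wZ; apply: notin_local.
Qed.

(** Let [U = (K : p)]. If [U] were inside [K + z R], regularity of [z] would put it inside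
    [K + z U], hence inside [K] by Nakayama's lemma; but [w] is in [U]. *)
Lemma colon_not_adjoin K p z w : is_ideal K -> is_ideal p -> z \in m ->
  (forall v, z * v \in K -> v \in K) -> w \notin K -> (forall a, a \in p -> a * w \in K) ->
  exists2 u, u \notin iadj K z & forall a, a \in p -> a * u \in K.
Proof.
move=> sK sp zm zK wK pw; apply: contrapT => nu; case/negP: wK.
pose U : {pred R} := [pred u | `[< forall a, a \in p -> a * u \in K >] ].
have sU : is_ideal U.
  split=> [|c x y /asboolP xU /asboolP yU]; apply/asboolP => a ap.
    by rewrite mulr0 ideal0.
  by rewrite mulrDr [a * _]mulrCA; apply: idealD; rewrite ?yU //; apply/idealM/xU.
apply: (@krull_regular K U z) => //; last exact/asboolP.
move=> u /asboolP uU; have /iadjP[c uc] : u \in iadj K z.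
  by apply: contrapT => /negP uz; apply: nu; exists u.
exists c => //; apply/asboolP => a ap; apply: zK.
have -> : z * (a * c) = a * u - a * (u - c * z) by ring.
by apply: idealB; [|apply: uU|apply: idealM].
Qed.

Lemma icolon_above K v : is_ideal K -> v \notin K ->
  exists r, r * v \notin K /\ is_prime (icolon K (r * v)).
Proof. exact: (@assoc_above R nR R^o K v). Qed.

(** The depth of [R / K] bounds the dimension of [R / p] from below for an associated prime [p]: by
    [colon_not_adjoin], [p] lies in an associated prime of [K + z]. That prime contains [z], while
    [p] does not, [z] being regular modulo [K]. *)
Lemma icolon_chain K zs w : is_ideal K -> {subset zs <= m} -> reg_mod K zs ->
  is_prime (icolon K w) -> up_ge (@is_prime R) (size zs) (icolon K w).
Proof.
elim: zs K w => [|z zs IHz] K w sK zm rz pw; first by split.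
case: rz => zK rz; split=> //.
have wK : w \notin K by have := prime_not1 pw; rewrite icolonE mul1r.
have zm' : z \in m by rewrite zm ?mem_head.
have [|u uK pu] := @colon_not_adjoin K (icolon K w) z w sK (prime_sub pw) zm' zK wK.
  by move=> a; rewrite icolonE.
have sKz := iadj_ideal z sK.
have [r [ruK pq]] := icolon_above sKz uK.
exists (icolon (iadj K z) (r * u)).
  by apply: IHz => // y yz; rewrite zm // inE yz orbT.
split=> [a /pu au|]; first by rewrite icolonE mulrCA idealM ?iadjl.
exists z; first by rewrite icolonE mulrC idealM ?iadjr.
by rewrite icolonE; apply: contra wK; apply: zK.
Qed.

(* [y / x] and [y' / x'] are the same element of the module of fractions. *)
Lemma exchange K x x' y : is_ideal K ->
  (forall v, x * v \in K -> v \in K) -> (forall v, x' * v \in K -> v \in K) ->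
  x' \in icolon (iadj K x) y ->
  exists y', icolon (iadj K x) y =i icolon (iadj K x') y'.
Proof.
move=> sK xK x'K; rewrite icolonE => /iadjP[y' yy']; exists y' => r.
have e c : x * (r * y' - c * x') + r * (x' * y - y' * x) = x' * (r * y - c * x) by ring.
rewrite !icolonE; apply/iadjP/iadjP => -[c rc]; exists c.
  by apply: xK; rewrite -(idealDl _ sK (idealM r sK yy')) addrC e idealM.
by apply: x'K; rewrite -e idealD // idealM.
Qed.

Lemma iadjC K x z : is_ideal K -> iadj (iadj K x) z =i iadj (iadj K z) x.
Proof.
move=> sK y; apply/iadjP/iadjP => -[a /iadjP[b yb]]; exists b; apply/iadjP; exists a.
  by rewrite addrAC.
by rewrite addrAC.
Qed.

(** The difficulty is that [zs] is unrelated to [x]. If [z] is in [p], [exchange] replaces [x] by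
    [z]. If not, either [p] lies in an associated prime of [K + z], which has long chains, or [p]
    contains some [x'] regular modulo [K + z]; exchanging [x] for [x'] then allows the induction
    over [K + z]. *)
Lemma icolon_adj_chain K zs x y : is_ideal K -> {subset zs <= m} -> reg_mod K zs ->
  (forall v, x * v \in K -> v \in K) -> x \in icolon (iadj K x) y ->
  is_prime (icolon (iadj K x) y) ->
  up_ge (@is_prime R) (size zs).-1 (icolon (iadj K x) y).
Proof.
elim: zs K x y => [|z zs IHz] K x y sK zm rz xK xp pp; first by split.
case: zs => [|z2 zs] in IHz zm rz *; first by split.
set zs' := z2 :: zs in IHz zm rz *; case: rz => zK rz.
have zm0 : z \in m by rewrite zm ?mem_head.
have zm' : {subset zs' <= m} by move=> t tz; rewrite zm // inE tz orbT.
have sp := prime_sub pp; have sKz := iadj_ideal z sK.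
case: (boolP (z \in icolon (iadj K x) y)) => zp.
  have [y' /eq_pred e] := exchange sK xK zK zp.
  by rewrite e; apply: (@icolon_chain (iadj K z) zs') => //; rewrite -e.
case: (pselect (forall v, (forall a, a \in icolon (iadj K x) y -> a * v \in iadj K z) ->
    v \in iadj K z)) => [pK1|]; last first.
  move/existsNP=> [v /not_implyP[pv /negP vK1]].
  have [r [rvK pq]] := icolon_above sKz vK1.
  apply: (@up_ge_leq _ _ _ (size zs').+1) => //; split=> //.
  exists (icolon (iadj K z) (r * v)); first exact: icolon_chain.
  split=> [a /pv av|]; first by rewrite icolonE mulrCA idealM.
  by exists z; rewrite // icolonE mulrC idealM ?iadjr.
have [x' x'p x'K1] := @regular_element R nR R^o (iadj K z) _ nR sKz sp pK1.
have x'm : x' \in m by apply: (hm sp); rewrite ?prime_not1.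
(* The regular sequence [z, x'] may be permuted. For [x'] modulo [K], the ideal [V = (K : x')]
   satisfies [V] in [K + z V], so it is contained in [K]; the regularity of [z] modulo [K + x'] is
   then shown in [zKx']. *)
have x'K v : x' * v \in K -> v \in K.
  pose V : {pred R} := [pred v | x' * v \in K].
  have sV : is_ideal V.
    split=> [|a b c]; rewrite !inE ?mulr0 ?ideal0 // => bK cK.
    by rewrite mulrDr [x' * _]mulrCA; apply: idealD => //; apply: idealM.
  apply: (@krull_regular K V z) => // t tV; have /iadjP[c tc] : t \in iadj K z.
    by apply: x'K1; apply: iadjl.
  exists c => //; rewrite inE; apply: zK.
  have -> : z * (x' * c) = x' * t - x' * (t - c * z) by ring.
  by apply: idealB => //; apply: idealM.
have [y' /eq_pred e] := exchange sK xK x'K x'p.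
rewrite e in sp pp xp zp x'p *; have sKx' := iadj_ideal x' sK.
have zKx' v : z * v \in iadj K x' -> v \in iadj K x'.
  case/iadjP=> c zc; have /iadjP[c' cc'] : c \in iadj K z.
    apply: x'K1; apply/iadjP; exists v.
    have -> : x' * c - v * z = - (z * v - c * x') by ring.
    by rewrite -mulN1r idealM.
  apply/iadjP; exists c'; apply: zK.
  have -> : z * (v - c' * x') = (z * v - c * x') + x' * (c - c' * z) by ring.
  by apply: idealD => //; apply: idealM.
have y'K : y' \notin iadj K x' by have := prime_not1 pp; rewrite icolonE mul1r.
have [|u uK pu] := @colon_not_adjoin _ (icolon (iadj K x') y') z y' sKx' sp zm0 zKx' y'K.
  by move=> a; rewrite icolonE.
have [r [ruK pq]] := icolon_above (iadj_ideal z sKx') uK.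
have sKK := iadj_ideal z sKx'.
split=> //; exists (icolon (iadj (iadj K x') z) (r * u)); last first.
  split=> [a /pu au|].
    by rewrite icolonE mulrCA; apply: idealM => //; apply: iadjl.
  by exists z => //; rewrite icolonE mulrC; apply: idealM => //; apply: iadjr.
have /eq_pred e' := iadjC x' z sK; rewrite e' in pq *.
apply: IHz => //.
rewrite icolonE mulrC; apply: idealM; first exact: iadj_ideal.
exact: iadjr.
Qed.

End Local.

Lemma ideal_smul_rcons (ys : seq R) x :
  @ideal_smul R R^o (rcons ys x) =i iadj (@ideal_smul R R^o ys) x.
Proof.
have sI zs : is_ideal (@ideal_smul R R^o zs) by apply: span_sub.
have sJ := iadj_ideal x (sI ys).
move=> y; apply/idP/idP; move: y.
  apply: (@span_min R R^o _ _ sJ) => y /asboolP[z zs [w ->]].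
  move: zs; rewrite mem_rcons inE => /orP[/eqP->|zs]; last first.
    by apply: iadjl; apply: mem_span; apply/asboolP; exists z => //; exists w.
  by rewrite -[_ *: _]/(x * w) mulrC; apply: idealM => //; apply: iadjr.
apply: iadj_min => //.
  apply: span_mono => y /asboolP[z zs [w ->]]; apply/asboolP.
  by exists z; [rewrite mem_rcons inE zs orbT | exists w].
apply: mem_span; apply/asboolP; exists x; first by rewrite mem_rcons mem_head.
by exists 1; rewrite -[_ *: _]/(x * 1) mulr1.
Qed.

Lemma regular_seq_mod (xs : seq R) : @regular_seq R R^o xs ->
  reg_mod (pred1 0) xs.
Proof.
case=> rxs _; have -> : pred1 (0 : R) = @ideal_smul R R^o [::] :> {pred R}.
  apply: eq_pred => y; apply/idP/idP => [/eqP->|].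
    by apply: (@sub0 R R^o); apply: span_sub.
  move: y; apply: (@span_min R R^o _ (pred1 0)) => [|y /asboolP[z //]].
  split=> [|a x y /eqP-> /eqP->]; first exact: eqxx.
  by rewrite scaler0 addr0; apply: eqxx.
have : forall i v, (size (Nil R) <= i < size ([::] ++ xs))%N ->
   ([::] ++ xs)`_i * v \in @ideal_smul R R^o (take i ([::] ++ xs)) ->
   v \in @ideal_smul R R^o (take i ([::] ++ xs)).
  by move=> i v /andP[_ ix]; apply: rxs.
elim: xs {rxs} [::] => [|x xs IHx] ys rxs //=; split.
  move=> v; have := rxs (size ys) v.
  rewrite nth_cat ltnn subnn take_size_cat //=; apply.
  by rewrite leqnn size_cat /= addnS ltnS leq_addr.
rewrite [iadj _ _](_ : _ = @ideal_smul R R^o (rcons ys x)); last first.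
  exact/esym/eq_pred/ideal_smul_rcons.
apply: IHx => i v; rewrite size_rcons cat_rcons.
by case/andP=> ysi ix; apply: rxs; rewrite (ltnW ysi).
Qed.

End RegularSequences.

(** * Extension of linear maps to injective modules *)

Section SubModule.
Variables (R : comNzRingType) (V : lmodType R) (N : {pred V}) (sN : submod_closed N).

Definition sub_pred of submod_closed N : V -> bool := fun v => v \in N.

Lemma sub_pred_closed : submod_closed (sub_pred sN : {pred V}).
Proof. exact: sN. Qed.

HB.instance Definition _ := GRing.isSubmodClosed.Build R V (sub_pred sN) sub_pred_closed.

Record sub_mod := SubMod { sub_mod_val : V; _ : sub_mod_val \in sub_pred sN }.

HB.instance Definition _ := [isSub for sub_mod_val].
HB.instance Definition _ := [Choice of sub_mod by <:].
HB.instance Definition _ := [SubChoice_isSubLmodule of sub_mod by <:].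

End SubModule.

Section Linear.
Variables (R : comNzRingType) (U V : lmodType R) (f : U -> V) (hf : linear f).
Definition mklin : {linear U -> V} := HB.pack f (GRing.isLinear.Build R U V _ f hf).
Lemma mklinE u : mklin u = f u. Proof. by []. Qed.
End Linear.

(** On [N] the map [beta] factors through [alpha]; this defines it on the image of [N], a submodule
    of [V], from which it extends. No quotient of [W] is formed. *)
Lemma injective_extension (R : comNzRingType) (E W V : lmodType R) (N : {pred W})
    (alpha : {linear W -> V}) (beta : {linear W -> E}) :
  injective_module E -> submod_closed N ->
  (forall x, x \in N -> alpha x = 0 -> beta x = 0) ->
  exists h : {linear V -> E}, forall x, x \in N -> h (alpha x) = beta x.
Proof.
move=> injE sN ab.
pose Im : {pred V} := [pred v | `[< exists2 x, x \in N & alpha x = v >] ].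
have sI : submod_closed Im.
  split=> [|a u v /asboolP[x xN <-] /asboolP[y yN <-]]; apply/asboolP.
    by exists 0; rewrite ?sub0 ?linear0.
  by exists (a *: x + y); rewrite ?linearP //; apply: (sN.2).
have ex (u : sub_mod sI) : exists x, x \in N /\ alpha x = sub_mod_val u.
  by have /asboolP[x xN xv] := valP u; exists x.
have [g gP] := choice ex.
have gE (u : sub_mod sI) x : x \in N -> alpha x = sub_mod_val u -> beta (g u) = beta x.
  move=> xN xu; have [gN gu] := gP u; apply/eqP; rewrite -subr_eq0 -linearB.
  by rewrite ab // ?subB // linearB gu xu subrr.
have lin : linear (fun u => beta (g u)).
  move=> a u v; have [uN gu] := gP u; have [vN gv] := gP v.
  by rewrite (@gE _ (a *: g u + g v)) ?linearP //; [apply: (sN.2) | rewrite gu gv].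
have vlin : linear (@sub_mod_val _ _ _ sI) by move=> a u v; apply: (linearP val).
have [|h hP] := injE (sub_mod sI) V (mklin vlin) (mklin lin).
  exact: val_inj.
exists h => x xN; have xI : alpha x \in sub_pred sI by apply/asboolP; exists x.
by rewrite -[alpha x]/(sub_mod_val (SubMod xI)) -[sub_mod_val _]/(mklin vlin (SubMod xI)) hP mklinE; apply: gE.
Qed.

(** * Ext modules over a Noetherian ring *)

Section FgNoetherian.
Variables (R : comNzRingType) (V : lmodType R).
Hypothesis nR : noetherian R.

Lemma span_cons (t : V) (s : seq V) v :
  (v \in span [in t :: s]) <-> exists a, v - a *: t \in span [in s].
Proof.
split=> [vs|[a vs]].
  apply/asboolP; move: v vs.
  apply: (@span_min R V _ [pred v | `[< exists a, v - a *: t \in span [in s] >] ]).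
    exact: (adjoin_sub t (span_sub [in s])).
  move=> v; rewrite inseqE inE => /orP[/eqP->|vs]; apply/asboolP.
    by exists 1; rewrite scale1r subrr sub0 //; apply: span_sub.
  by exists 0; rewrite scale0r subr0 mem_span.
rewrite -(subrK (a *: t) v); apply: subD; first exact: span_sub.
  by apply: span_mono vs => w; rewrite !inseqE inE => ->; rewrite orbT.
apply: submodZ; first exact: span_sub.
by apply: mem_span; rewrite inseqE mem_head.
Qed.

Lemma fg_noetherian (s : seq V) (N : {pred V}) : submod_closed N ->
  {subset N <= span [in s]} -> exists t : seq V, N =i span [in t].
Proof.
elim: s N => [|v s IHs] N sN Ns.
  exists [::] => x; apply/idP/idP => [/Ns //|].
  by case/spanP=> -[|p c] cs ->; [rewrite big_nil sub0 | have := cs p (mem_head _ _)].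
pose J : {pred R^o} := [pred a | `[< exists2 x, x \in N & x - a *: v \in span [in s] >] ].
have sJ : submod_closed J.
  split=> [|a b c /asboolP[x xN xb] /asboolP[y yN yc]]; apply/asboolP.
    by exists 0; rewrite ?scale0r ?subr0 sub0 //; apply: span_sub.
  exists (a *: x + y); first exact: (sN.2).
  rewrite scalerDl -[(a *: b)]/(a * b) -scalerA opprD addrACA -scalerBr.
  by apply: (span_sub _).2.
have [c cE] := nR sJ.
have [t tN tc] : exists2 t : seq V, {subset t <= N} &
    forall a, a \in c -> exists2 x, x \in t & x - a *: v \in span [in s].
  have : {subset c <= J} by move=> a ac; rewrite cE mem_span.
  elim: c {cE} => [|a c IHc] cJ; first by exists [::].
  have [|t tN tc] := IHc; first by move=> b bc; rewrite cJ // inE bc orbT.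
  have /asboolP[x xN xa] := cJ a (mem_head _ _); exists (x :: t).
    by move=> y; rewrite inE => /orP[/eqP->|/tN].
  move=> b; rewrite inE => /orP[/eqP->|/tc[y yt yb]]; first by exists x; rewrite ?mem_head.
  by exists y; rewrite // inE yt orbT.
have [|x|t' t'E] := IHs [pred x | (x \in N) && (x \in span [in s])].
- split=> [|a x y /andP[xN xs] /andP[yN ys]]; apply/andP.
    by rewrite !sub0 //; apply: span_sub.
  by split; [apply: (sN.2) | apply: (span_sub _).2].
- by case/andP.
have t'N x : x \in span [in t'] -> x \in N by rewrite -t'E => /andP[].
have lift a : a \in J -> exists2 x, x \in span [in t] & x - a *: v \in span [in s].
  rewrite cE => ac; apply/asboolP; move: a ac.
  apply: (@span_min R R^o _
    [pred a | `[< exists2 x, x \in span [in t] & x - a *: v \in span [in s] >] ]).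
    split=> [|a b e /asboolP[x xt xb] /asboolP[y yt ye]]; apply/asboolP.
      by exists 0; rewrite ?scale0r ?subr0 sub0 //; apply: span_sub.
    exists (a *: x + y); first exact: (span_sub _).2.
    rewrite scalerDl -[(a *: b)]/(a * b) -scalerA opprD addrACA -scalerBr.
    by apply: (span_sub _).2.
  move=> a /tc[x xt xa]; apply/asboolP; exists x => //; exact: mem_span.
exists (t ++ t') => x; apply/idP/idP => [xN|].
  have /span_cons[a xa] := Ns x xN.
  have [|y yt ya] := lift a; first by apply/asboolP; exists x.
  rewrite -(subrK y x) addrC; apply: subD; first exact: span_sub.
    by apply: span_mono yt => z; rewrite !inseqE mem_cat => ->.
  have : x - y \in span [in t'].
    rewrite -t'E; apply/andP; split.
      apply: subB => //; move: y yt {ya}; apply: span_min => //.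
    have -> : x - y = (x - a *: v) - (y - a *: v) by rewrite opprB addrA subrK.
    by apply: subB => //; apply: span_sub.
  by apply: span_mono => z; rewrite !inseqE mem_cat => ->; rewrite orbT.
move: x; apply: span_min => // x; rewrite inseqE mem_cat => /orP[/tN //|xt'].
by apply: t'N; apply: mem_span.
Qed.

Lemma fg_noetherian_module : finitely_generated V -> noetherian_module V.
Proof. by case=> s sV N sN; apply: (@fg_noetherian s). Qed.

End FgNoetherian.

Lemma row_noetherian (R : comNzRingType) n : noetherian R -> noetherian_module 'rV[R]_n.
Proof.
move=> nR; apply: fg_noetherian_module => //.
exists [seq delta_mx 0 j | j <- enum 'I_n] => v.
rewrite [v]row_sum_delta; apply: submod_sum => [|j _]; first exact: span_sub.
apply: submodZ; first exact: span_sub.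
by apply: mem_span; rewrite inseqE map_f // mem_enum.
Qed.

Lemma preim_sub (R : comNzRingType) (U V : lmodType R) (f : U -> V) (N : {pred V}) :
  linear f -> submod_closed N -> submod_closed [pred u | f u \in N].
Proof.
move=> lf sN; split=> [|a u v]; rewrite !inE.
  by rewrite -[f 0]/(mklin lf 0) linear0 sub0.
by move=> uN vN; rewrite lf; apply: (sN.2).
Qed.

Section Ext.
Variable R : comNzRingType.
Hypothesis nR : noetherian R.
Variable E : injective_resolution (R^o : lmodType R).
Implicit Types (J : {pred R}) (i n : nat).

Local Notation d := (ires_diff E).

Lemma diff2 i (e : E i) : d i.+1 (d i e) = 0.
Proof. by apply/ires_exact; exists e. Qed.

Lemma diff_aug x : d 0%N (ires_aug E x) = 0.
Proof. by apply/ires_exact0; exists x. Qed.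

(** The value at [a] of the linear map from [R^n] to [M] whose values on the basis are the [e j]. *)
Definition dot n (M : lmodType R) (a : 'rV[R]_n) (e : 'I_n -> M) : M :=
  \sum_j a 0 j *: e j.

Lemma dotDl n (M : lmodType R) c (a b : 'rV[R]_n) (e : 'I_n -> M) :
  dot (c *: a + b) e = c *: dot a e + dot b e.
Proof.
rewrite scaler_sumr -big_split; apply: eq_bigr => j _.
by rewrite !mxE scalerDl scalerA.
Qed.

Lemma dotDr n (M : lmodType R) c (a : 'rV[R]_n) (e f : 'I_n -> M) :
  dot a (c *: e + f) = c *: dot a e + dot a f.
Proof.
rewrite scaler_sumr -big_split; apply: eq_bigr => j _ /=.
by rewrite -[(c *: e + f) j]/(c *: e j + f j) scalerDr !scalerA mulrC.
Qed.

Lemma dot_linear n (M N : lmodType R) (f : {linear M -> N}) a (e : 'I_n -> M) :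
  f (dot a e) = dot a (fun j => f (e j)).
Proof. by rewrite linear_sum; apply: eq_bigr => j _; rewrite linearZ. Qed.

Lemma dot_delta n (M : lmodType R) (e : 'I_n -> M) j : dot (delta_mx 0 j) e = e j.
Proof.
rewrite /dot (bigD1 j) //= !mxE !eqxx scale1r big1 ?addr0 // => k /negbTE kj.
by rewrite mxE kj andbF scale0r.
Qed.

Definition fkill n (M : lmodType R) (K : {pred 'rV[R]_n}) (e : 'I_n -> M) :=
  forall k, k \in K -> dot k e = 0.

(* [fcoc i K] and [fbnd i K] are the cocycles and the coboundaries of
   [Hom(R^n / K, E)], an element of which is the tuple of the images of the
   canonical basis. *)
Definition fcoc i n (K : {pred 'rV[R]_n}) : {pred ('I_n -> E i)} :=
  [pred e | `[< (forall j, d i (e j) = 0) /\ fkill K e >] ].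

Definition fbnd i n (K : {pred 'rV[R]_n}) : {pred ('I_n -> E i)} :=
  match i return {pred ('I_n -> E i)} with
  | 0 => [pred e | `[< forall j, e j = 0 >] ]
  | i'.+1 => [pred e | `[< exists2 f : 'I_n -> E i', fkill K f & forall j, d i' (f j) = e j >] ]
  end.

Arguments fcoc i {n} K.
Arguments fbnd i {n} K.

Lemma fcoc_sub i n (K : {pred 'rV[R]_n}) : submod_closed (fcoc i K).
Proof.
split=> [|a e f /asboolP[de Ke] /asboolP[df Kf]]; apply/asboolP; split.
- by move=> j; rewrite linear0.
- by move=> k _; rewrite /dot big1 // => j _; rewrite scaler0.
- by move=> j; rewrite -[(a *: e + f) j]/(a *: e j + f j) linearP de df scaler0 addr0.
by move=> k kK; rewrite dotDr Ke // Kf // scaler0 addr0.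
Qed.

(** Dimension shift along a presentation of [K] by the rows of a matrix [A], with relations [K']: a
    cocycle of degree [i.+1] on [R^n / K] is [d g], and the values of [g] at the rows form a cocycle
    of degree [i] on [R^m / K']. In degree 0 the cocycles come from [R^n] through the
    augmentation. *)
Lemma ext_fg i n (K : {pred 'rV[R]_n}) : submod_closed K ->
  exists2 s : seq ('I_n -> E i), {subset s <= fcoc i K} &
    forall e, e \in fcoc i K -> exists2 w, w \in span [in s] & e - w \in fbnd i K.
Proof.
elim: i n K => [|i IHi] n K sK.
  pose au (x : 'rV[R]_n) : 'I_n -> E 0%N := fun j => ires_aug E (x 0 j : R^o).
  have auP c x y : au (c *: x + y) = c *: au x + au y.
    by apply: funext => j; rewrite /au !mxE -[c * _]/(c *: (x 0 j : R^o)) linearP.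
  pose N : {pred 'rV[R]_n} := [pred x | au x \in fcoc 0 K].
  have sN : submod_closed N by apply: preim_sub => //; apply: fcoc_sub.
  have [s sE] := row_noetherian nR sN; exists (map au s).
    by move=> e /mapP[x xs ->]; have : x \in N by rewrite sE mem_span.
  move=> e eZ; have /asboolP[de Ke] := eZ.
  have [x xe] : exists x, au x = e.
    have /choice[x xe] j : exists x, ires_aug E x = e j by apply/ires_exact0.
    by exists (\row_j x j); apply: funext => j; rewrite /au mxE.
  exists e; last by apply/asboolP => j; rewrite subrr.
  have : x \in N by rewrite -[x \in N]/(au x \in fcoc 0 K) xe.
  rewrite sE -xe; move: x {xe}; apply: (@span_min R _ _ [pred x | au x \in span [in map au s]]).
    by apply: preim_sub => //; apply: span_sub.
  by move=> x xs; suff: au x \in span [in map au s] by []; apply: mem_span; rewrite inseqE map_f.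
have [t tE] := row_noetherian nR sK; pose m := size t.
pose A : 'M[R]_(m, n) := \matrix_j t`_j.
have tA (j : 'I_m) : row j A \in K by rewrite rowK tE mem_span // inseqE mem_nth.
have KA (e : 'I_n -> E i.+1) : (forall j : 'I_m, dot (row j A) e = 0) -> fkill K e.
  move=> eA k; rewrite tE => kt; apply/eqP; move: k kt.
  apply: (@span_min R _ _ [pred k | dot k e == 0]).
    split=> [|a x y]; rewrite !inE.
      by rewrite /dot big1 // => j _; rewrite mxE scale0r.
    by move=> /eqP x0 /eqP y0; rewrite dotDl x0 y0 scaler0 addr0.
  move=> k; rewrite inseqE => kt; apply/eqP; have kt' := kt; rewrite -index_mem in kt'.
  by rewrite -(eA (Ordinal kt')) rowK nth_index.
pose K' : {pred 'rV[R]_m} := [pred a | a *m A == 0].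
have sK' : submod_closed K'.
  split=> [|c a b]; rewrite !inE ?mul0mx // => /eqP a0 /eqP b0.
  by rewrite mulmxDl -scalemxAl a0 b0 scaler0 addr0.
(* A map on [R^m] that kills the relations is a map on [K], and extends to [R^n] because [E l] is
   injective. *)
have lift l (f : 'I_m -> E l) : fkill K' f -> exists e : 'I_n -> E l,
    forall j, dot (row j A) e = f j.
  move=> Kf; have flin : linear (fun a : 'rV[R]_m => dot a f).
    by move=> c a b; apply: dotDl.
  have Alin : linear (fun a : 'rV[R]_m => a *m A).
    by move=> c a b; rewrite mulmxDl scalemxAl.
  have [|||h hP] := @injective_extension R (E l) _ _ predT (mklin Alin) (mklin flin).
  - exact: ires_injective.
  - by split.
  - by move=> a _ aA; apply: Kf; rewrite inE -[a *m A]/(mklin Alin a) aA.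
  exists (fun j => h (delta_mx 0 j)) => j.
  rewrite -(dot_linear h (row j A) (fun j => delta_mx 0 j)) /dot -row_sum_delta rowE.
  by rewrite -[delta_mx 0 j *m A]/(mklin Alin (delta_mx 0 j)) hP // mklinE dot_delta.
have lift_bnd (b : 'I_m -> E i) : b \in fbnd i K' -> exists e : 'I_n -> E i,
    (forall j, d i (e j) = 0) /\ forall j, dot (row j A) e = b j.
  case: i {IHi KA} b => [|i] b /asboolP.
    move=> b0; exists (fun=> 0); split=> j; first by rewrite linear0.
    by rewrite b0 /dot big1 // => k _; rewrite scaler0.
  case=> f Kf fb; have [e eP] := lift i f Kf.
  exists (fun j => d i (e j)); split=> j; first exact: diff2.
  by rewrite -dot_linear eP fb.
have [s sZ sP] := IHi m K' sK'.
have [G GP] : exists G : ('I_m -> E i) -> ('I_n -> E i),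
    forall f, f \in s -> forall j, dot (row j A) (G f) = f j.
  suff /choice[G GP] : forall f, exists e : 'I_n -> E i,
    f \in s -> forall j, dot (row j A) e = f j by exists G.
  move=> f; case: (boolP (f \in s)) => [/sZ/asboolP[_ Kf]|]; last by exists (fun=> 0).
  by have [e eP] := lift i f Kf; exists e.
pose D (e : 'I_n -> E i) : 'I_n -> E i.+1 := fun j => d i (e j).
have DP c e f : D (c *: e + f) = c *: D e + D f.
  by apply: funext => j; rewrite /D -[(c *: e + f) j]/(c *: e j + f j) linearP.
exists (map (fun f => D (G f)) s).
  move=> e /mapP[f fs ->]; apply/asboolP; split=> [j|]; first exact: diff2.
  apply: KA => j; rewrite -dot_linear GP //.
  by have /asboolP[df _] := sZ f fs.
move=> e /asboolP[de Ke].
have /choice[g gP] j : exists f, d i f = e j by apply/ires_exact.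
have [|w ws fw] := sP (fun j => dot (row j A) g).
  apply/asboolP; split=> [j|a /eqP aA].
    rewrite dot_linear -(Ke _ (tA j)); congr dot; apply: funext => l; exact: gP.
  transitivity (dot (a *m A) g); last by rewrite aA /dot big1 // => j _; rewrite mxE scale0r.
  have -> : a *m A = \sum_j a 0 j *: row j A.
    by rewrite mulmx_sum_row.
  have glin : linear (fun k : 'rV[R]_n => dot k g) by move=> c x y; apply: dotDl.
  rewrite -[dot (\sum_j _) g]/(mklin glin _) linear_sum; apply: eq_bigr => j _.
  by rewrite linearZ.
have [W [WA Ws]] : exists W : 'I_n -> E i, (forall j, dot (row j A) W = w j) /\
    D W \in span [in map (fun f => D (G f)) s].
  apply/asboolP; move: w ws {fw}.
  apply: (@span_min R _ _ [pred w | `[< exists W : 'I_n -> E i,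
    (forall j, dot (row j A) W = w j) /\ D W \in span [in map (fun f => D (G f)) s] >] ]).
    split=> [|a x y /asboolP[X [XA Xs]] /asboolP[Y [YA Ys]]]; apply/asboolP.
      exists 0; split=> [j|]; first by rewrite /dot big1 // => k _; rewrite scaler0.
      rewrite (_ : D 0 = 0); first exact: sub0 (span_sub _).
      by apply: funext => j; rewrite /D linear0.
    exists (a *: X + Y); split=> [j|]; first by rewrite dotDr XA YA.
    by rewrite DP; apply: (span_sub _).2.
  move=> f fs; apply/asboolP; exists (G f); split; first exact: GP.
  by apply: mem_span; apply: (map_f (fun f => D (G f))).
exists (D W) => //; have [H [dH HA]] := lift_bnd _ fw.
(* Subtracting [W] and the closed correction [H] makes [g] vanish on the rows of [A], hence on [K],
   while its differential becomes [e - D W]. *)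
apply/asboolP; exists (g - W - H) => [k|j].
  rewrite tE => kt; apply/eqP; move: k kt.
  apply: (@span_min R _ _ [pred k | dot k (g - W - H) == 0]).
    split=> [|a x y]; rewrite !inE.
      by rewrite /dot big1 // => j _; rewrite mxE scale0r.
    by move=> /eqP x0 /eqP y0; rewrite dotDl x0 y0 scaler0 addr0.
  move=> k; rewrite inseqE => kt; have kt' := kt; rewrite -index_mem in kt'.
  have -> : k = row (Ordinal kt') A by rewrite rowK nth_index.
  set j := Ordinal _; apply/eqP.
  have -> : g - W - H = (-1) *: (H + W) + g by rewrite scaleN1r addrC addrA addrAC opprD.
  rewrite dotDr -[H]scale1r dotDr scale1r HA WA.
  rewrite -[(_ - w) j]/(dot (row j A) g - w j) subrK scaleN1r addNr //.
by rewrite -[(g - W - H) j]/(g j - W j - H j) !linearB /= dH subr0 gP.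
Qed.

End Ext.

Local Notation tors J M := (@torsion _ J M).

(* [J] annihilates each factor of a composition series, since every element is
   killed by a power of [J]. *)
Lemma finite_length_torsion (R : comNzRingType) (V : lmodType R) (J : {pred R})
    (B Z : {pred V}) : finite_length B Z -> {subset Z <= tors J V} ->
  exists c, forall y v, y \in ideal_pow J c -> v \in Z -> y *: v \in B.
Proof.
case=> n [N [NB NZ sN Nsimple]] Zt; exists n => y v.
have Nmono l k : (k + l <= n)%N -> {subset N k <= N (k + l)%N}.
  elim: l => [|l IHl]; first by rewrite addn0 => _ x.
  rewrite addnS => kl x xk; have [sub _ _] := Nsimple (k + l)%N kl.
  by apply: sub; apply: IHl => //; apply: ltnW.
have Nle k : (k <= n)%N -> {subset N k <= Z}.
  by move=> kn x xk; rewrite -NZ -(subnKC kn); apply: Nmono; rewrite ?subnKC.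
have step k : (k < n)%N -> forall a v, a \in J -> v \in N k.+1 -> a *: v \in N k.
  move=> kn a w aJ wN; have [NN nN max] := Nsimple k kn.
  pose X : {pred V} := [pred x | (x \in N k) ||
    `[< exists2 a, a \in J & exists2 w, w \in N k.+1 & x = a *: w >] ].
  have XN : {subset span X <= N k.+1}.
    apply: span_min => // x /orP[/NN //|/asboolP[b bJ [u uN ->]]].
    exact: submodZ.
  have XL : {subset N k <= span X} by move=> x xN; apply: mem_span; rewrite inE xN.
  have aX : a *: w \in span X.
    by apply: mem_span; apply/orP; right; apply/asboolP; exists a => //; exists w.
  have [LN|LN] := max (span X) (span_sub X) XL XN; first by rewrite -LN.
  exfalso; have [t tN tk] : exists2 t, t \in N k.+1 & t \notin N k.
    apply: contrapT => nt; apply: nN => x xN; apply: contrapT => /negP xk.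
    by apply: nt; exists x.
  have tN' : {subset N k.+1 <= adjoin (N k) t}.
    have [||LN'|LN' x] := max (adjoin (N k) t) (adjoin_sub t (sN k)).
    - by move=> x; apply: adjoinl.
    - exact: adjoin_min.
    - by case/negP: tk; rewrite -LN'; apply: adjoinr.
    by rewrite LN'.
  (* If [J] did not annihilate the simple factor, it would generate it, and [t] would be congruent
     to [al *: t] with [al] in the ideal generated by [J]. Iterating, the power of [J] that kills
     [t] brings [t] into [N k]. *)
  have [al alJ alt] : exists2 al, al \in ideal_pow J 1 & t - al *: t \in N k.
    have : t \in span X by rewrite LN.
    move=> ts; apply/asboolP; move: t tN tk tN' ts => t tN tk tN'.
    suff gen x : x \in span X -> x \in [pred x | `[< exists2 al, al \in ideal_pow J 1 &
        x - al *: t \in N k >] ] by apply: gen.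
    move: x; apply: span_min.
      split=> [|b x x' /asboolP[be beJ xb] /asboolP[ga gaJ yg]]; apply/asboolP.
        by exists 0; rewrite ?scale0r ?subr0 ?sub0 // (ideal_pow_submod _ _).1.
      exists (b * be + ga); first by apply: (ideal_pow_submod J 1).2.
      by rewrite scalerDl -scalerA opprD addrACA -scalerBr (sN k).2.
    move=> x /orP[xN|/asboolP[b bJ [u /tN'/adjoinP[r ur] ->]]]; apply/asboolP.
      by exists 0; rewrite ?scale0r ?subr0 // (ideal_pow_submod _ _).1.
    exists (b * r); first by rewrite mulrC; apply: ideal_powMl; apply: ideal_pow1.
    by rewrite -scalerA -scalerBr submodZ.
  have /asboolP[l lt] := Zt t (Nle k.+1 kn t tN).
  suff : forall y, y \in ideal_pow J 0 -> y *: t \in N k.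
    by move/(_ 1 (ideal_pow0 _ _)); rewrite scale1r (negbTE tk).
  have : forall z, z \in ideal_pow J l -> z *: t \in N k.
    by move=> z /lt ->; apply: sub0.
  elim: l {lt} => // l IHl lt; apply: IHl => z zJ.
  have -> : z *: t = z *: (t - al *: t) + (z * al) *: t.
    by rewrite scalerBr scalerA subrK.
  apply: subD => //; first exact: submodZ.
  by apply: lt; rewrite -addn1; apply: ideal_powM.
suff main k : (k <= n)%N -> forall v, v \in N k -> forall y, y \in ideal_pow J k -> y *: v \in B.
  by move=> yJ vZ; apply: (main n) => //; rewrite NZ.
elim: k {v} => [|k IHk] kn v vN.
  by move=> z _; rewrite -NB; apply: submodZ => //.
have sB : submod_closed B.
  by have -> : B = N 0%N; [exact/esym/eq_pred | exact: sN].
move=> z; have := @ideal_pow_split R J 1 k [pred z | z *: v \in B]; rewrite add1n; apply.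
  exact: colon_sub.
move=> a b aJ bJ; rewrite inE mulrC -scalerA; apply: IHk => //; first exact: ltnW.
move: a aJ; apply: (@ideal_pow_ind R J 1 [pred a | a *: v \in N k]).
  exact: colon_sub.
move=> [|a [|//]] // _ aJ; rewrite big_seq1 inE; apply: step => //.
by rewrite aJ ?mem_head.
Qed.

Lemma ideal_pow_leq (R : comNzRingType) (I : {pred R}) m n : (m <= n)%N ->
  {subset ideal_pow I n <= ideal_pow I m}.
Proof.
by move/subnK<-; elim: (n - m)%N => // k IH x /ideal_pow_succ; apply: IH.
Qed.

Section ExtIdeal.
Variable R : comNzRingType.
Hypothesis nR : noetherian R.
Variable E : injective_resolution (R^o : lmodType R).
Implicit Types (J q : {pred R}) (i n : nat).

Local Notation d := (ires_diff E).

Definition kill J (M : lmodType R) (e : M) := forall a, a \in J -> a *: e = 0.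

(* Cocycles and coboundaries of [Hom(R / J, E)], whose cohomology is
   [Ext^i(R / J, R)]. *)
Definition coc i J : {pred E i} := [pred e | `[< d i e = 0 /\ kill J e >] ].

Definition bnd i J : {pred E i} :=
  match i return {pred E i} with
  | 0 => pred1 0
  | i'.+1 => [pred e | `[< exists2 f : E i', kill J f & d i' f = e >] ]
  end.

Arguments coc i J : clear implicits.
Arguments bnd i J : clear implicits.

Definition kills_ext z i J := forall e, e \in coc i J -> z *: e \in bnd i J.

Lemma killP J (M : lmodType R) c (e f : M) : kill J e -> kill J f -> kill J (c *: e + f).
Proof.
by move=> Je Jf a aJ; rewrite scalerDr scalerA mulrC -scalerA Je // Jf // scaler0 addr0.
Qed.

Lemma kill0 J (M : lmodType R) : kill J (0 : M).
Proof. by move=> a _; rewrite scaler0. Qed.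

Lemma killZ J (M : lmodType R) c (e : M) : kill J e -> kill J (c *: e).
Proof. by move=> Je; rewrite -[_ *: _]addr0; apply: killP => //; apply: kill0. Qed.

Lemma kill_linear J (M N : lmodType R) (f : {linear M -> N}) (e : M) :
  kill J e -> kill J (f e).
Proof. by move=> Je a aJ; rewrite -linearZ /= Je // linear0. Qed.

Lemma bnd_sub i J : submod_closed (bnd i J).
Proof.
case: i => [|i] /=.
  split=> [|c e f /eqP-> /eqP->]; first exact: eqxx.
  by rewrite scaler0 addr0; apply: eqxx.
split=> [|c e f /asboolP[e' Je <-] /asboolP[f' Jf <-]]; apply/asboolP.
  by exists 0; [exact: kill0 | exact: linear0].
by exists (c *: e' + f'); [exact: killP | rewrite linearP].
Qed.

Lemma bnd_mono i J J' : {subset J <= J'} -> {subset bnd i J' <= bnd i J}.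
Proof.
case: i => [|i] JJ' e //= /asboolP[f Jf fe]; apply/asboolP; exists f => //.
by move=> a /JJ'; apply: Jf.
Qed.

Lemma ext_ideal_fg i J : is_ideal J -> exists2 s : seq (E i), {subset s <= coc i J} &
  forall e, e \in coc i J -> exists2 w, w \in span [in s] & e - w \in bnd i J.
Proof.
move=> sJ; pose K : {pred 'rV[R]_1} := [pred k : 'rV[R]_1 | (k 0 0 : R) \in J].
have sK : submod_closed K.
  split=> [|a x y]; rewrite !inE ?mxE ?ideal0 // => xJ yJ.
  by apply: idealD => //; apply: idealM.
have fkillE l (f : 'I_1 -> E l) : fkill K f <-> kill J (f 0).
  split=> fk a aJ.
    have := fk (const_mx a); rewrite inE mxE => /(_ aJ).
    by rewrite /dot big_ord1 mxE.
  by rewrite /dot big_ord1 fk.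
have [s sZ sP] := ext_fg nR E i sK.
exists (map (fun f : 'I_1 -> E i => f 0) s) => [e /mapP[f /sZ/asboolP[df Kf] ->]|e].
  by apply/asboolP; split=> //; apply/fkillE.
case/asboolP=> de Je; have [|w ws ew] := sP (fun=> e).
  by apply/asboolP; split=> //; apply/fkillE.
exists (w 0).
  move: w ws {ew}; apply: (@span_min R _ _
      [pred w : 'I_1 -> E i | w 0 \in span [in map (fun f : 'I_1 -> E i => f 0) s]]).
    by apply: preim_sub; [move=> a u v | apply: span_sub].
  move=> f fs; suff: f 0 \in span [in map (fun f : 'I_1 -> E i => f 0) s] by [].
  by apply: mem_span; apply: (map_f (fun f : 'I_1 -> E i => f 0)).
case: i {sZ sP} s e w de Je ws ew => [|i] s e w _ _ _ /asboolP.
  by move/(_ 0) => ew; apply/eqP.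
by case=> f /fkillE Kf fe; apply/asboolP; exists (f 0) => //; rewrite fe.
Qed.

(** Injectivity of [E i] against the embedding of [R / (J : u)] into [R / J] by multiplication by
    [u]. On [R x J] the map [al] has image [J + u R], and [be] vanishes on its kernel because
    [(J : u)] kills [f]. *)
Lemma divide i J u (f : E i) : is_ideal J -> kill (icolon J u) f ->
  exists2 g, kill J g & u *: g = f.
Proof.
move=> sJ Jf; pose al (x : R^o * R^o) : R^o := x.1 * u + x.2.
have al_lin : linear al.
  by move=> c x y; rewrite /al /= /GRing.scale /=; ring.
pose be (x : R^o * R^o) : E i := (x.1 : R) *: f.
have be_lin : linear be.
  by move=> c x y; rewrite /be /= scalerDl scalerA.
have [|||h hP] := @injective_extension R (E i) _ _ [pred x : R^o * R^o | (x.2 : R) \in J]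
    (mklin al_lin) (mklin be_lin).
- exact: ires_injective.
- split=> [|c x y]; rewrite !inE /= ?ideal0 // => xJ yJ.
  by apply: idealD => //; apply: idealM.
- move=> x xJ alx; have /eqP : al x = 0 := alx.
  rewrite addr_eq0 => /eqP xu; suff : be x = 0 by [].
  by apply: Jf; rewrite icolonE xu -mulN1r idealM.
have hal x : (x.2 : R) \in J -> h (x.1 * u + x.2) = (x.1 : R) *: f by move=> xJ; apply: (hP x).
exists (h 1) => [a aJ|].
  rewrite -linearZ /=; have := hal (0, a) aJ; rewrite /= mul0r add0r scale0r => <-.
  by congr (h _); apply: mulr1.
rewrite -linearZ /=; have := hal (1, 0) (ideal0 sJ); rewrite /= mul1r addr0 scale1r => <-.
by congr (h _); apply: mulr1.
Qed.

Lemma divide_bnd i J u (b : E i) : is_ideal J -> b \in bnd i (icolon J u) ->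
  exists2 b', b' \in bnd i J & u *: b' = b.
Proof.
case: i b => [|i] b sJ; first by move/eqP->; exists 0; [exact: eqxx | exact: scaler0].
case/asboolP=> f Jf <-; have [g Jg <-] := divide sJ Jf.
by exists (d i g); [apply/asboolP; exists g | rewrite linearZ].
Qed.

Lemma bnd_kill i J (b : E i) : b \in bnd i J -> d i b = 0 /\ kill J b.
Proof.
case: i b => [|i] b; first by move/eqP->; split; [exact: linear0 | exact: kill0].
by case/asboolP=> f Jf <-; split; [exact: diff2 | exact: kill_linear].
Qed.

Lemma kill_iadj J u (M : lmodType R) (e : M) : kill J e -> u *: e = 0 -> kill (iadj J u) e.
Proof.
move=> Je ue a /iadjP[c ac]; rewrite -(subrK (c * u) a) scalerDl Je // -scalerA ue.
by rewrite scaler0 addr0.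
Qed.

(** The sequence [0 -> R / (J : u) -> R / J -> R / (J + u R) -> 0] is exact, so annihilators of the
    two outer Ext modules multiply to one of the middle. *)
Lemma kills_ext_split z z' i J u : is_ideal J ->
  kills_ext z i (icolon J u) -> kills_ext z' i (iadj J u) -> kills_ext (z' * z) i J.
Proof.
move=> sJ zk z'k e /asboolP[de Je].
have [|b bJ ub] := @divide_bnd i J u (z *: (u *: e)) sJ.
  apply: zk; apply/asboolP; split; first by rewrite linearZ /= de scaler0.
  by move=> a; rewrite icolonE scalerA => /Je.
have [db Jb] := bnd_kill bJ.
have : z *: e - b \in coc i (iadj J u).
  apply/asboolP; split; first by rewrite linearB linearZ /= de db scaler0 subr0.
  apply: kill_iadj; first by rewrite addrC -scaleN1r; apply: killP; [|apply: killZ].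
  by rewrite scalerBr ub !scalerA mulrC subrr.
move/z'k => /(bnd_mono (fun x xJ => iadjl u xJ)) zb.
rewrite -scalerA -(subrK b (z *: e)) scalerDr; apply: (subD (bnd_sub _ _)) => //.
by apply: submodZ => //; apply: bnd_sub.
Qed.

(** From [0 -> R / q -> R / q -> R / (q + x R) -> 0], whose first map is multiplication by [x]: the
    connecting map sends [e = x g] to [d g]. The conclusion is an equality of cocycles, not only of
    classes. *)
Lemma kills_ext_connect z i q x e : is_prime q -> x \notin q ->
  kills_ext z i.+1 (iadj q x) -> e \in coc i q ->
  exists2 v, v \in coc i q & z *: e = x *: v.
Proof.
move=> pq xq zk /asboolP[de qe]; have sq := prime_sub pq.
have [|g qg xg] := @divide i q x e sq.
  by move=> a; rewrite icolonE primeM // (negbTE xq) orbF => /qe.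
have /zk/asboolP[g' qg' dg] : d i g \in coc i.+1 (iadj q x).
  apply/asboolP; split; first exact: diff2.
  apply: kill_iadj; first exact: kill_linear.
  by rewrite -linearZ /= xg de.
exists (z *: g - g').
  apply/asboolP; split; first by rewrite linearB linearZ /= -dg subrr.
  rewrite addrC -scaleN1r; apply: killP; last exact: killZ.
  by move=> a aq; apply: qg'; apply: iadjl.
rewrite scalerBr scalerA mulrC -scalerA xg.
by rewrite [x *: g'](qg' x (iadjr _ sq)) subr0.
Qed.


(** * Ext away from an ideal a power of which kills local cohomology *)

Section Homotopy.
Variables (I : {pred R}) (dim c : nat).
Hypothesis lc_killed : forall i y e, (i < dim)%N -> y \in ideal_pow I c ->
  e \in @lc_cycles R I R^o E i -> y *: e \in @lc_boundaries R I R^o E i.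

Lemma torsion_sub (M : lmodType R) : submod_closed (tors I M).
Proof.
split=> [|a e f /asboolP[n ne] /asboolP[k kf]]; apply/asboolP.
  by exists 0%N => b _; rewrite scaler0.
exists (maxn n k) => y yI; rewrite scalerDr scalerA mulrC -scalerA.
rewrite ne ?kf ?scaler0 ?addr0 //.
  by apply: ideal_pow_leq yI; apply: leq_maxr.
by apply: ideal_pow_leq yI; apply: leq_maxl.
Qed.

Lemma torsion_linear (M N : lmodType R) (f : {linear M -> N}) e :
  e \in tors I M -> f e \in tors I N.
Proof.
case/asboolP=> n ne; apply/asboolP; exists n => a aI.
by rewrite -linearZ /= ne // linear0.
Qed.

(* The homotopy comes from the injectivity of the [E i]; being linear, it maps
   [Hom(R / J, E)] to itself for every [J]. *)
Lemma homotopy x i : x \in I -> (i < dim)%N ->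
  exists (g : {linear E i -> E i}) (h : {linear E i.+1 -> E i}),
    (forall J e, kill J e -> g e \in bnd i J) /\
    (forall e, e \in tors I (E i) -> x ^+ (c * i.+1) *: e = g e + h (d i e)).
Proof.
move=> xI; have xcI : x ^+ c \in ideal_pow I c by apply: expr_ideal_pow.
elim: i => [|i IHi] idim.
  have blin : linear (fun e : E 0%N => x ^+ c *: e).
    by move=> a u v; rewrite scalerDr !scalerA mulrC.
  have [|||h hP] := @injective_extension R (E 0%N) _ _ (tors I (E 0%N)) (d 0%N) (mklin blin).
  - exact: ires_injective.
  - exact: torsion_sub.
  - move=> e eT de; have := lc_killed idim xcI (e := e).
    by rewrite inE eT /= de eqxx => /(_ isT) /eqP.
  have zlin : linear (fun e : E 0%N => 0 : E 0%N) by move=> a u v; rewrite scaler0 addr0.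
  exists (mklin zlin), h; split=> [J e _|e eT]; first exact: eqxx.
  by rewrite muln1 hP // !mklinE add0r.
have [g [h [gP hP]]] := IHi (ltnW idim).
set s := x ^+ _ in hP.
pose phi (e : E i.+1) := s *: e - d i (h e).
have phi_lin : linear phi.
  move=> a u v; rewrite /phi.
  have -> : d i (h (a *: u + v)) = a *: d i (h u) + d i (h v) by rewrite !linearP.
  have -> : s *: (a *: u + v) = a *: (s *: u) + s *: v by rewrite scalerDr !scalerA mulrC.
  by rewrite scalerBr opprD addrACA.
(* On torsion elements [phi (d e) = d (g e)], and [gP] for the zero ideal makes [g e] a coboundary,
   hence closed. *)
have phid e : e \in tors I (E i) -> phi (d i e) = 0.
  move=> eT; rewrite /phi -linearZ /= hP // linearD /= addrK.
  by case: (bnd_kill (gP (pred1 0) e _)) => // a /eqP->; rewrite scale0r.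
have blin : linear (fun e => x ^+ c *: phi e).
  by move=> a u v; rewrite phi_lin scalerDr !scalerA mulrC.
have [|||h' hP'] := @injective_extension R (E i.+1) _ _ (tors I (E i.+1)) (d i.+1) (mklin blin).
- exact: ires_injective.
- exact: torsion_sub.
(* [x ^+ c] turns a torsion cocycle into the differential of a torsion element, on which [phi]
   vanishes. Each degree costs one such factor, whence the exponent [c * i.+1]. *)
- move=> e eT de; have := lc_killed idim xcI (e := e).
  rewrite inE eT /= de eqxx => /(_ isT) /asboolP[f fT df].
  have <- : phi (x ^+ c *: e) = x ^+ c *: phi e by apply: (linearZZ (mklin phi_lin)).
  by rewrite -df; apply: phid.
have g'lin : linear (fun e : E i.+1 => x ^+ c *: d i (h e)).
  by move=> a u v; rewrite (linearP h) (linearP (d i)) scalerDr !scalerA mulrC.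
exists (mklin g'lin), h'; split=> [J e Je|e eT]; rewrite mklinE.
  apply/asboolP; exists (x ^+ c *: h e); last by rewrite linearZ.
  by apply: killZ; apply: kill_linear.
by rewrite hP' // mklinE /phi -scalerDr [X in _ = _ *: X]addrC subrK scalerA -exprD -mulnS.
Qed.

(** As [u I^k] lies in [J], [u *: e] is torsion and the homotopy applies to it. For a cocycle [e]
    only the term in [g] survives, and it is a coboundary of [Hom(R / J, E)]. *)
Lemma kills_ext_torsion x i J u k : x \in I -> (i < dim)%N -> is_ideal J ->
  (forall y, y \in ideal_pow I k -> u * y \in J) ->
  kills_ext (x ^+ (c * i.+1) * u) i J.
Proof.
move=> xI idim sJ uk e /asboolP[de Je]; have [g [h [gP hP]]] := homotopy xI idim.
rewrite -scalerA hP; last first.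
  by apply/asboolP; exists k => y /uk uy; rewrite scalerA mulrC Je.
rewrite [d i _]linearZ /= de scaler0 linear0 addr0; apply: gP; exact: killZ.
Qed.

Variable M : {pred R}.
Hypothesis pM : is_prime M.
Hypothesis IM : {subset I <= M}.

Definition punctured q := [/\ is_prime q, {subset q <= M} & exists2 a, a \in I & a \notin q].

Lemma kills_ext_mem i J z : z \in J -> kills_ext z i J.
Proof. by move=> zJ e /asboolP[_ Je]; rewrite Je //; apply: sub0 (bnd_sub _ _). Qed.

Lemma psub_intro (p q : {pred R}) x : {subset p <= q} -> x \in q -> x \notin p -> psub p q.
Proof. by move=> pq xq xp; split=> //; exists x. Qed.

(* [Ext^i(R / J, R)] vanishes on the punctured spectrum as soon as [i] plus the
   length of the chains of punctured primes above [J] is less than [dim]. *)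
Lemma ext_negligible r i J q : is_ideal J -> (i + r < dim)%N ->
  (forall q, punctured q -> {subset J <= q} -> ~ up_ge punctured r q) ->
  punctured q -> exists2 z, z \notin q & kills_ext z i J.
Proof.
have easy i' (J' q' : {pred R}) : ~ {subset J' <= q'} -> exists2 z, z \notin q' & kills_ext z i' J'.
  move=> nJ; apply: contrapT => nz; apply: nJ => z zJ; apply: contrapT => /negP zq.
  by apply: nz; exists z => //; apply: kills_ext_mem.
elim: r i J q => [|r IHr] i J q sJ ir nJ Tq.
  by apply: easy => Jq; apply: (nJ q).
move: J sJ q nJ Tq; apply: (noeth_ind nR (Pr := fun J => forall q,
  (forall q, punctured q -> {subset J <= q} -> ~ up_ge punctured r.+1 q) ->
  punctured q -> exists2 z, z \notin q & kills_ext z i J)).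
move=> J sJ IHJ q nJ Tq; have [pq qM [a aI aq]] := Tq.
case: (boolP (1 \in J)) => [J1|J1].
  by exists 1; [exact: prime_not1 | exact: kills_ext_mem].
case: (pselect (forall u v, u * v \in J -> (u \in J) || (v \in J))) => [Jprime|]; last first.
  move/existsNP=> [u /existsNP[v /not_implyP[uvJ /negP]]]; rewrite negb_or => /andP[uJ vJ].
  have nJ' J' : {subset J <= J'} ->
      forall q, punctured q -> {subset J' <= q} -> ~ up_ge punctured r.+1 q.
    by move=> JJ' q' Tq' J'q; apply: nJ => // x /JJ' /J'q.
  have Jc : {subset J <= icolon J u} by move=> x xJ; rewrite icolonE mulrC idealM.
  have Ja : {subset J <= iadj J u} by move=> x; apply: iadjl.
  have [|z zq zk] := IHJ (icolon J u) (icolon_ideal u sJ) _ q (nJ' _ Jc) Tq.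
    by apply: (@psub_intro _ _ v) => //; rewrite icolonE mulrC.
  have [|z' z'q z'k] := IHJ (iadj J u) (iadj_ideal u sJ) _ q (nJ' _ Ja) Tq.
    by apply: (@psub_intro _ _ u) => //; apply: iadjr.
  exists (z' * z); first by rewrite primeM // negb_or z'q.
  exact: (kills_ext_split sJ zk z'k).
have pJ : is_prime J by [].
case: (pselect (punctured J)) => [TJ|nTJ]; last first.
  apply: easy => Jq; apply: nTJ; split=> // [x /Jq /qM //|].
  by exists a => //; apply: contra aq; apply: Jq.
have nJz z : z \notin J ->
    forall q, punctured q -> {subset iadj J z <= q} -> ~ up_ge punctured r q.
  move=> zJ q' Tq' Jq' uq'; apply: (nJ J TJ) => //; split=> //; exists q' => //.
  apply: (@psub_intro _ _ z) => //; last by apply: Jq'; apply: iadjr.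
  by move=> x xJ; apply: Jq'; apply: iadjl.
have [s sZ sP] := ext_ideal_fg i sJ.
(* One annihilator [z] outside the prime [J] is enough: the induction for [J + z] in degree [i.+1]
   gives [w] outside [q] that maps each cocycle to [z] times a cocycle, which is a coboundary. *)
suff [z zJ zk] : exists2 z, z \notin J & kills_ext z i J.
  have [||||w wq wk] := IHr i.+1 (iadj J z) q => //.
  - exact: iadj_ideal.
  - by rewrite addSnnS.
  - exact: nJz.
  exists w => // e eZ; have [v vZ ->] := kills_ext_connect pJ zJ wk eZ.
  exact: zk.
(* If a punctured prime [q''] lies strictly above [J], a multiplier outside [q''] sends Ext into its
   multiple by an element [x] of [q''], and Nakayama's lemma at [q''] applies; this is where finite
   generation of Ext enters. *)
case: (pselect (exists2 q'', punctured q'' & psub J q'')) => [[q'' Tq'' [Jq'' [x xq xJ]]]|nq''].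
  have [pq'' q''M _] := Tq''.
  have [||||z zq zk] := IHr i.+1 (iadj J x) q'' => //.
  - exact: iadj_ideal.
  - by rewrite addSnnS.
  - exact: nJz.
  have [|w wq wk] := @nakayama R (E i) q'' pq'' (coc i J) (bnd i J) s (bnd_sub _ _) sZ sP.
    move=> e eZ; exists z => //; have [v vZ ->] := kills_ext_connect pJ xJ zk eZ.
    apply: mem_span; apply/asboolP; right; exists x => //; by exists v.
  by exists w => //; apply: contra wq; apply: Jq''.
have [_ JM [x xI xJ]] := TJ; have xM := IM xI.
(* [C] is the exponent of the homotopy in degree [i.+1]. As [J] is maximal among the punctured
   primes, [I] is nilpotent near [M] modulo [J + x ^+ C.+1]. The homotopy costs only [x ^+ C]; the
   remaining factor [x] serves Nakayama's lemma at [M], applied to the multiples of cocycles by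
   [x ^+ C]. *)
set C := (c * i.+2)%N.
have xCJ k : x ^+ k \notin J by apply: contra xJ; apply: primeX.
have sJx := iadj_ideal (x ^+ C.+1) sJ.
have [[q' [pq' Jq' q'M Iq']]|[u uM [k uk]]] := radical nR I sJx pM.
  exfalso; apply: nq''; exists q'; first by split.
  apply: (@psub_intro _ _ (x ^+ C.+1)) => //; last by apply: Jq'; apply: iadjr.
  by move=> y yJ; apply: Jq'; apply: iadjl.
have i1dim : (i.+1 < dim)%N by apply: leq_ltn_trans ir; rewrite addnS ltnS leq_addr.
have zk := kills_ext_torsion xI i1dim sJx uk.
pose Z : {pred E i} := [pred w | `[< exists2 v, v \in coc i J & w = x ^+ C *: v >] ].
have [||||w wM wZ] := @nakayama R (E i) M pM Z (bnd i J) [seq x ^+ C *: v | v <- s].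
- exact: bnd_sub.
- by move=> v /mapP[t ts ->]; apply/asboolP; exists t => //; apply: sZ.
- move=> v /asboolP[t /sP[w ws tw] ->]; exists (x ^+ C *: w).
    move: w ws {tw}; apply: (@span_min R _ _ [pred w | x ^+ C *: w \in
      span [in [seq x ^+ C *: v | v <- s]]]).
      by apply: scale_preim_sub; apply: span_sub.
    move=> w ws; suff: x ^+ C *: w \in span [in [seq x ^+ C *: v | v <- s]] by [].
    by apply: mem_span; apply: (map_f (fun v => x ^+ C *: v)).
  by rewrite -scalerBr; apply: submodZ => //; apply: bnd_sub.
- move=> v /asboolP[e eZ ->]; exists u => //.
  have [t tZ te] := kills_ext_connect pJ (xCJ C.+1) zk eZ.
  rewrite scalerA mulrC te exprS -scalerA; apply: mem_span; apply/asboolP; right.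
  by exists x => //; exists (x ^+ C *: t) => //; apply/asboolP; exists t.
exists (w * x ^+ C).
  by rewrite primeM // negb_or xCJ andbT; apply: contra wM; apply: JM.
by move=> e eZ; rewrite -scalerA; apply: wZ; apply/asboolP; exists e.
Qed.

(** If chains above [p = (0 : w)] were shorter, [ext_negligible] in degree 0 would give [z] outside
    [p] annihilating [Hom(R / p, R)]. The homomorphism sending 1 to [w] then yields [z w = 0], that
    is, [z] in [p]. *)
Lemma associated_chain w : punctured (icolon (pred1 0) w) -> (0 < dim)%N ->
  up_ge punctured dim.-1 (icolon (pred1 0) w).
Proof.
move=> Tp dim0; apply: contrapT => nup; have [pp _ _] := Tp.
have [|||z zp zk] := @ext_negligible dim.-1 0 (icolon (pred1 0) w) _ _ _ _ Tp.
- exact: prime_sub.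
- by rewrite add0n prednK.
- move=> q pq qp uq; apply: nup; move: uq; case: (dim.-1) => [|n] /=; first by move=> _; split.
  move=> [_ [q' uq' qq']]; split=> //; exists q' => //; exact: psub_subl qq'.
case/negP: zp; rewrite icolonE.
have : ires_aug E (w : R^o) \in coc 0 (icolon (pred1 0) w).
  apply/asboolP; split=> [|a]; first exact: diff_aug.
  by rewrite icolonE -linearZ => /eqP aw; rewrite [a *: _]aw linear0.
move/zk => /eqP; rewrite -linearZ /= => zw; apply/eqP.
by apply: (@ires_aug_inj _ _ E); rewrite linear0.
Qed.

End Homotopy.
End ExtIdeal.

(** * The dimension of the Rees algebra *)

Section PolyPrime.
Variable B : comNzRingType.
Implicit Types (P : {pred B}).

Definition poly_pred P : {pred {poly B}} := [pred f : {poly B} | `[< forall i, f`_i \in P >] ].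

Lemma poly_predP P (f : {poly B}) : reflect (forall i, f`_i \in P) (f \in poly_pred P).
Proof. exact: asboolP. Qed.

Lemma poly_pred_prime P : is_prime P -> is_prime (poly_pred P).
Proof.
move=> pP; have sP := prime_sub pP; split.
- split=> [|a f g /poly_predP fP /poly_predP gP]; apply/poly_predP => i.
    by rewrite coef0 ideal0.
  rewrite coefD coefM; apply: idealD => //; apply: ideal_sum => // j _.
  exact: idealM.
- by apply/poly_predP => /(_ 0%N); rewrite coef1 (negbTE (prime_not1 pP)).
move=> f g fg; apply: contrapT => /negP; rewrite negb_or => /andP[fP gP].
have low (h : {poly B}) : h \notin poly_pred P ->
    exists i, h`_i \notin P /\ forall j, (j < i)%N -> h`_j \in P.
  move=> hP; have ex : exists i, h`_i \notin P.
    apply: contrapT => ne; case/negP: hP; apply/poly_predP => i.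
    by apply: contrapT => /negP hi; apply: ne; exists i.
  case: (ex_minnP ex) => i hi imin; exists i; split=> // j ji.
  by apply: contrapT => /negP /imin; rewrite leqNgt ji.
have [i [fi fmin]] := low f fP; have [j [gj gmin]] := low g gP.
have /poly_predP/(_ (i + j)%N) := fg.
have ilt : (i < (i + j).+1)%N by rewrite ltnS leq_addr.
rewrite coefM (bigD1 (Ordinal ilt)) //= addKn addrC (idealDl _ sP).
  by rewrite primeM // (negbTE fi) (negbTE gj).
apply: ideal_sum => // -[k klt] /= /eqP ki.
case: (ltngtP k i) => [lt|lt|e]; last by case: ki; apply: val_inj.
  by apply: idealrM => //; apply: fmin.
apply: idealM => //; apply: gmin; rewrite ltn_subLR //.
by rewrite ltn_add2r.
Qed.

Lemma ht_poly_pred n P : ht_ge n P -> ht_ge n (poly_pred P).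
Proof.
elim: n P => [|n IHn] P [pP]; first by split=> //; apply: poly_pred_prime.
case=> Q htQ [QP [x xP xQ]]; split; first exact: poly_pred_prime.
exists (poly_pred Q); first exact: IHn.
split=> [f /poly_predP fQ|]; first by apply/poly_predP => i; apply: QP.
exists x%:P; last by apply/poly_predP => /(_ 0%N); rewrite coefC (negbTE xQ).
apply/poly_predP => i; rewrite coefC; case: ifP => // _.
exact/ideal0/prime_sub.
Qed.

End PolyPrime.

Lemma ht_preim (R S : comNzRingType) (f : {rmorphism R -> S}) n k (P : {pred S}) :
  (forall y, exists x, f x = y) -> ht_ge k [pred x | f x == 0] -> ht_ge n P ->
  ht_ge (n + k) [pred x | f x \in P].
Proof.
move=> fs htk; elim: n P => [|n IHn] P.
  case=> pP _; apply: ht_ge_sub htk; last exact: preim_prime.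
  by move=> x; rewrite !inE => /eqP->; apply/ideal0/prime_sub.
case=> pP [Q /IHn htQ [QP [y yP yQ]]]; rewrite addSn; split; first exact: preim_prime.
exists ([pred x | f x \in Q] : {pred R}) => //; split=> [x|]; first by rewrite !inE => /QP.
by have [x xy] := fs y; exists x; rewrite inE xy.
Qed.

Section Tower.
Variables (A : idomainType) (m I : {pred A}) (dim : nat) (zs : seq A).
Hypothesis nA : noetherian A.
Hypothesis pm : is_prime m.
Hypothesis sI : is_ideal I.
Hypothesis zm : {subset zs <= m}.
Hypothesis zdim : size zs = dim.
Hypothesis zreg : reg_mod (pred1 0) zs.
Hypothesis htm : ~ ht_ge dim.+1 m.

Lemma fil_const (c : A) : c%:P \in fil_pred (adic_filtration I).
Proof.
apply/fil_predP => -[|i]; rewrite coefC /=; first exact: ideal_pow0.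
exact: (ideal_pow_submod _ _).1.
Qed.

Lemma fil_lin (a : A) : a \in I -> a%:P * 'X \in fil_pred (adic_filtration I).
Proof.
move=> aI; apply/fil_predP => i; rewrite coefCM coefX.
case: eqP => [->|_]; first by rewrite mulr1; apply: ideal_pow1.
by rewrite mulr0; apply: (ideal_pow_submod _ _).1.
Qed.

Lemma zero_prime : is_prime (pred1 (0 : A)).
Proof.
split=> [||x y]; last by rewrite !inE mulf_eq0.
  by split=> [|a x y /eqP-> /eqP->]; rewrite ?inE ?eqxx // scaler0 addr0.
by rewrite inE oner_eq0.
Qed.

(** A prime strictly below [m] containing the regular sequence [zs] has height at least [dim], and
    [m] would have height at least [dim.+1]. *)
Lemma sop_minimal P : is_prime P -> {subset zs <= P} -> {subset P <= m} -> {subset m <= P}.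
Proof.
move=> pP zP Pm x xm; apply: contrapT => /negP xP; apply: htm; split=> //.
exists P; last by split=> //; exists x.
rewrite -zdim; apply: (@reg_ht _ nA (pred1 0)) => //.
  exact: prime_sub zero_prime.
by move=> y /eqP->; apply/ideal0/prime_sub.
Qed.

(** [B] is the polynomial ring over [A] with one variable for each [a] in [s], sent to [a t]. Every
    variable after the first raises the height of the kernel, by the relation [a1 X - a X1], and
    every variable joins the elements [xs] over which the preimage of the irrelevant ideal is
    minimal. *)
Lemma tower (s : seq A) : {subset s <= I} -> 0 \notin s ->
  exists (B : comNzRingType) (phi : {rmorphism B -> {poly A}}),
  [/\ noetherian B,
      forall c, exists b, phi b = c%:P,
      forall a, a \in s -> exists b, phi b = a%:P * 'X,
      forall b, phi b \in fil_pred (adic_filtration I) &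
      ht_ge (size s).-1 [pred b | phi b == 0] /\
      exists xs : seq B, [/\ size xs = (dim + size s)%N,
        forall x, x \in xs -> (phi x)`_0 \in m &
        forall P, is_prime P -> {subset xs <= P} ->
          (forall b, b \in P -> (phi b)`_0 \in m) ->
          forall b, (phi b)`_0 \in m -> b \in P]].
Proof.
elim: s => [|a s IHs] sI' s0.
  exists A, polyC; split=> //.
  - by move=> c; exists c.
  - exact: fil_const.
  split.
    split=> //; apply: prime_eq zero_prime => x.
    by rewrite !inE polyC_eq0.
  exists zs; split; first by rewrite addn0.
    by move=> x xz; rewrite coefC; apply: zm.
  move=> P pP zP Pm b; rewrite coefC /=; apply: sop_minimal => // x /Pm.
  by rewrite coefC.
have [||B [phi [nB phiC phiL phiI [htk [xs [xsize xm xmin]]]]]] := IHs.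
- by move=> b bs; rewrite sI' // inE bs orbT.
- by move: s0; rewrite inE negb_or => /andP[].
have aI : a \in I by rewrite sI' ?mem_head.
have a0 : a != 0 by apply: contra s0 => /eqP->; rewrite mem_head.
pose u : {poly A} := a%:P * 'X.
pose psi : {rmorphism {poly B} -> {poly A}} := horner_eval u \o map_poly phi.
have psiC b : psi b%:P = phi b by rewrite /psi /= map_polyC /= /horner_eval hornerC.
have psiX : psi 'X = u by rewrite /psi /= map_polyX /horner_eval hornerX.
have psi0 (f : {poly B}) : (psi f)`_0 = (phi f`_0)`_0.
  elim/poly_ind: f => [|f c _]; first by rewrite !rmorph0 coef0 rmorph0.
  rewrite rmorphD rmorphM psiX psiC !coefD coefMX /= add0r coefC /=.
  by rewrite /u mulrA coefMX /= add0r.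
exists {poly B}, psi; split.
- exact: hilbert_basis.
- by move=> c; have [b bc] := phiC c; exists b%:P; rewrite psiC.
- move=> b; rewrite inE => /orP[/eqP->|bs]; first by exists 'X.
  by have [c cb] := phiL b bs; exists c%:P; rewrite psiC.
- elim/poly_ind => [|f c fI]; first by rewrite rmorph0 rpred0.
  rewrite rmorphD rmorphM psiX psiC; apply: rpredD => //.
  by apply: rpredM => //; apply: fil_lin.
have pker : is_prime [pred f | psi f == 0].
  have pz : is_prime (pred1 (0 : {poly A})).
    split=> [||x y]; last by rewrite !inE mulf_eq0.
      by split=> [|c x y /eqP-> /eqP->]; rewrite ?inE ?eqxx // scaler0 addr0.
    by rewrite inE oner_eq0.
  exact: (preim_prime psi pz).
split.
  case: s => [|a1 s] in IHs sI' s0 phiL htk xsize *; first by split.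
  split=> //; exists (poly_pred [pred b | phi b == 0]); first exact: ht_poly_pred.
  split=> [f /poly_predP fK|].
    rewrite inE; apply/eqP; rewrite -[f]coefK poly_def rmorph_sum big1 // => i _.
    rewrite -mul_polyC rmorphM psiC.
    by have := fK i; rewrite inE => /eqP->; rewrite mul0r.
  have [|b1 b1E] := phiL a1; first by rewrite mem_head.
  have [c1 c1E] := phiC a1; have [ca caE] := phiC a.
  (* The image is [a1 (a t) - a (a1 t) = 0], but the coefficient [c1] of ['X] maps to [a1], which is
     nonzero, so the element is not in the extension of the former kernel. *)
  exists (c1%:P * 'X - (ca * b1)%:P).
    rewrite inE rmorphB rmorphM psiX !psiC rmorphM c1E caE b1E /u.
    by apply/eqP; ring.
  apply/poly_predP => /(_ 1%N); rewrite coefB coefCM coefX coefC /= mulr1 subr0 inE c1E.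
  by rewrite polyC_eq0 => /eqP a10; case/negP: s0; rewrite -a10 !inE eqxx orbT.
exists ('X :: map polyC xs); split.
- by rewrite /= size_map xsize addnS.
- move=> x; rewrite inE psi0 => /orP[/eqP->|/mapP[b bxs ->]].
    by rewrite coefX rmorph0 coef0; apply/ideal0/prime_sub.
  by rewrite coefC; apply: xm.
move=> P pP xP Pm f; rewrite psi0 => fm.
have sP := prime_sub pP; have XP : 'X \in P by rewrite xP ?mem_head.
have f0P : (f`_0)%:P \in P.
  apply: (xmin [pred b | b%:P \in P]) => //.
  - exact: (preim_prime (@polyC B) pP).
  - by move=> x xxs; rewrite inE xP // inE map_f ?orbT.
  by move=> b bP; rewrite -psiC; apply: Pm.
elim/poly_ind: f fm f0P => [|f c _] _; first by rewrite ideal0.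
rewrite coefD coefMX coefC /= add0r => cP.
by apply: idealD => //; apply: idealM.
Qed.

Hypothesis I0 : exists2 b, b \in I & b != 0.

(** In [B] the preimage of the irrelevant ideal has height at most [dim + size s] by Krull's
    theorem, and a chain in [A[It]] pulls back to one that continues below the kernel by
    [(size s).-1] steps. *)
Lemma rees_ring : noetherian (rees I) /\
  ~ ht_ge dim.+2 [pred r : rees I | (fil_rees_val r)`_0 \in m].
Proof.
have [s0 sE0] := nA sI.
pose s := [seq x <- s0 | x != 0].
have sE : I =i @span A A^o [in s].
  move=> x; rewrite sE0; apply/idP/idP; move: x; apply: (@span_min A A^o).
  - exact: span_sub.
  - move=> x xs; case: (eqVneq x 0) => [->|x0]; first exact: sub0 (span_sub _).
    by apply: mem_span; rewrite inseqE mem_filter x0.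
  - exact: span_sub.
  by move=> x; rewrite inseqE mem_filter => /andP[_ xs]; apply: mem_span.
have sI' : {subset s <= I} by move=> x xs; rewrite sE; apply: mem_span.
have [|B [phi [nB phiC phiL phiI [htk [xs [xsize xm xmin]]]]]] := tower sI'.
  by rewrite mem_filter eqxx.
pose psi0 b : rees I := FilRees (phiI b).
have psi_add : zmod_morphism psi0.
  by move=> x y; apply: val_inj; rewrite /= rmorphB.
have psi_mul : monoid_morphism psi0.
  by split=> [|x y]; apply: val_inj; rewrite /= ?rmorph1 ?rmorphM.
pose psi : {rmorphism B -> rees I} := HB.pack psi0
  (GRing.isZmodMorphism.Build _ _ _ psi_add) (GRing.isMonoidMorphism.Build _ _ _ psi_mul).
have psiE b : fil_rees_val (psi b) = phi b by [].
pose im : {pred {poly A}} := [pred p | `[< exists b, phi b = p >] ].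
have im_add x y : x \in im -> y \in im -> x + y \in im.
  by move=> /asboolP[b <-] /asboolP[c <-]; apply/asboolP; exists (b + c); rewrite rmorphD.
have im_mul x y : x \in im -> y \in im -> x * y \in im.
  by move=> /asboolP[b <-] /asboolP[c <-]; apply/asboolP; exists (b * c); rewrite rmorphM.
have imC c : c%:P \in im by apply/asboolP/phiC.
have imS a : a \in s -> a%:P * 'X \in im by move=> as_; apply/asboolP; apply: phiL.
have imE p : p \in im -> exists b, phi b = p by move/asboolP.
clearbody im.
have imL a : a \in I -> a%:P * 'X \in im.
  rewrite sE => as_; move: a as_; apply: (@span_min A A^o _ [pred a | a%:P * 'X \in im]).
    split=> [|a x y]; rewrite !inE; first by rewrite mul0r; apply: (imC 0).
    move=> xi yi; rewrite polyCD mulrDl; apply: im_add => //.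
    by rewrite polyCM -mulrA; apply: im_mul.
  exact: imS.
have imP n a : a \in ideal_pow I n -> a%:P * 'X^n \in im.
  move: a; apply: (@ideal_pow_ind A I n [pred a | a%:P * 'X^n \in im]).
    split=> [|a x y]; rewrite !inE; first by rewrite mul0r; apply: (imC 0).
    move=> xi yi; rewrite polyCD mulrDl; apply: im_add => //.
    by rewrite polyCM -mulrA; apply: im_mul.
  move=> t <-; rewrite inE; elim: t => [|a t IHt] tI.
    by rewrite big_nil expr0 mulr1; apply: (imC 1).
  rewrite big_cons exprS polyCM mulrACA; apply: im_mul.
    by apply: imL; rewrite tI ?mem_head.
  by apply: IHt => x xt; rewrite tI // inE xt orbT.
have psi_surj r : exists b, psi b = r.
  have rI := valP r.
  suff /imE[b bE] : val r \in im by exists b; apply: val_inj.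
  rewrite -[val r]coefK poly_def; elim/big_ind: _ => [|//|i _]; first exact: (imC 0).
  by rewrite -mul_polyC; apply: imP; have /fil_predP := rI.
split; first exact: (noetherian_image (f := psi)).
move=> htM; have pMB := preim_prime psi (ht_prime htM).
have htk' : ht_ge (size s).-1 ([pred x | psi x == 0] : {pred B}).
  have e : [pred b | phi b == 0] =i [pred x | psi x == 0].
    by move=> b; rewrite !inE -val_eqE.
  have pk := prime_eq e (ht_prime htk).
  by apply: ht_ge_sub htk => // b; rewrite e.
have := ht_preim psi_surj htk' htM.
have s_gt0 : (0 < size s)%N.
  have [b bI b0] := I0; rewrite lt0n; apply: contra b0; rewrite size_eq0 => /eqP s0E.
  move: bI; rewrite sE s0E => /spanP[[|p c] cs ->]; first by rewrite big_nil.
  by have := cs p (mem_head _ _).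
have -> : (dim.+2 + (size s).-1 = (size xs).+1)%N.
  by rewrite xsize !addSn -addnS prednK.
apply: (@krull_height B nB xs [pred b | (phi b)`_0 \in m] pMB).
  by move=> x /xm.
by move=> P pP xP Pm b; apply: xmin.
Qed.

End Tower.

(** * Ratliff-Rush filtrations *)

Section RatliffRush.
Variables (A : comNzRingType) (I : {pred A}).

(** The closure of [I^n] is defined by powers of [I^n]; since for [n > 0] the ideal [I^(n (k + 1))]
    is [I^k] times a further power, powers of [I] itself serve as well. *)
Lemma ratliff_rush_powP n x :
  x \in ratliff_rush (ideal_pow I n) <->
  exists k, forall y, y \in ideal_pow I k -> x * y \in ideal_pow I (n + k).
Proof.
split=> [/ratliff_rushP[l _ xl]|[k xk]].
  exists (n * l)%N => y; rewrite -mulnS -!ideal_powX; exact: xl.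
apply/ratliff_rushP; exists k.+1 => // y; rewrite !ideal_powX [(n * k.+2)%N]mulnS.
case: n xk => [|n] xk; first by move=> _; rewrite !mul0n ?addn0 ideal_pow0.
have -> : (n.+1 * k.+1 = k + (n * k.+1).+1)%N by rewrite mulSn -addSnnS.
apply: (@ideal_pow_mul_in _ I _ x) => [|s ss sI'].
  exact: ideal_pow_submod.
have sk : (k <= size s)%N by rewrite ss leq_addr.
rewrite -(cat_take_drop k s) big_cat /= mulrA addnA; apply: ideal_powM.
  apply: xk; rewrite -[in X in ideal_pow _ X](size_takel sk).
  by apply: prod_ideal_pow => z /mem_take /sI'.
have <- : size (drop k s) = (n * k.+1).+1 by rewrite size_drop ss addKn.
by apply: prod_ideal_pow => z /mem_drop /sI'.
Qed.

End RatliffRush.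

Section Rees.
Variables (A : idomainType) (I : {pred A}).
Hypothesis sI : is_ideal I.

Local Notation R := (rees I).
Local Notation rr n := (ratliff_rush (ideal_pow I n)).

Lemma rr_sub n : is_ideal (rr n). Proof. exact: ratliff_rush_submod. Qed.

Lemma pow_sub n : is_ideal (ideal_pow I n). Proof. exact: ideal_pow_submod. Qed.

Lemma rrMpow i j x y : x \in ideal_pow I i -> y \in rr j -> x * y \in rr (i + j).
Proof. by move=> xI; apply: ratliff_rushM; apply: ideal_pow_ratliff_rush. Qed.

Definition constR (c : A) : R := FilRees (fil_const I c).

Lemma constR_zmod : zmod_morphism constR.
Proof. by move=> x y; apply: val_inj; rewrite /= rmorphB. Qed.

Lemma constR_monoid : monoid_morphism constR.
Proof. by split=> [|x y]; apply: val_inj; rewrite /= ?rmorph1 ?rmorphM. Qed.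

HB.instance Definition _ := GRing.isZmodMorphism.Build A R constR constR_zmod.
HB.instance Definition _ := GRing.isMonoidMorphism.Build A R constR constR_monoid.

(** The homogeneous element [c t^k], with default value 0 when [c] is not in [I^k]. *)
Definition homR k (c : A) : R := insubd (0 : R) (c%:P * 'X^k).

Lemma homRE k c : c \in ideal_pow I k -> fil_rees_val (homR k c) = c%:P * 'X^k.
Proof.
move=> cI; apply: (insubdK (0 : R)); apply/fil_predP => i; rewrite coefCM coefXn.
by case: eqP => [->|_]; rewrite ?mulr1 // mulr0 (ideal0 (pow_sub _)).
Qed.

Lemma coefR (r : R) k : (fil_rees_val r)`_k \in ideal_pow I k.
Proof. by have /fil_predP := valP r. Qed.

Lemma coef_homR k c (p : {poly A}) i : c \in ideal_pow I k ->
  (fil_rees_val (homR k c) * p)`_(k + i) = c * p`_i.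
Proof. by move=> cI; rewrite homRE // -mulrA coefCM coefXnM ltnNge leq_addr /= addKn. Qed.

Lemma homRM i j x y : x \in ideal_pow I i -> y \in ideal_pow I j ->
  homR i x * homR j y = homR (i + j) (x * y).
Proof.
move=> xI yI; apply: val_inj; rewrite /= -[val _]/(fil_rees_val _) !homRE //.
  by rewrite polyCM mulrACA exprD.
exact: ideal_powM.
Qed.

Lemma homR0 c : homR 0 c = constR c.
Proof. by apply: val_inj; rewrite /= homRE ?ideal_pow0 // expr0 mulr1. Qed.

Lemma homRX k c e : c \in ideal_pow I k -> homR k c ^+ e = homR (k * e) (c ^+ e).
Proof.
move=> cI; have cX j : c ^+ j \in ideal_pow I (k * j).
  by rewrite -ideal_powX; apply: expr_ideal_pow.
elim: e => [|e IHe]; first by rewrite !expr0 muln0 homR0 rmorph1.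
by rewrite !exprS IHe homRM // mulnS.
Qed.

Lemma rees_sum (r : R) : r = \sum_(k < size (fil_rees_val r)) homR k (fil_rees_val r)`_k.
Proof.
apply: val_inj; rewrite /= -[val (\sum_(k < _) _)]/(fil_rees_val _).
rewrite -[LHS]coefK poly_def.
transitivity (\sum_(k < size (fil_rees_val r)) fil_rees_val (homR k (fil_rees_val r)`_k)).
  by apply: eq_bigr => k _; rewrite homRE ?mul_polyC ?coefR.
by apply/esym/(big_morph (fun r : R => fil_rees_val r)).
Qed.

Lemma mem_homR (J : {pred R}) (r : R) : is_ideal J ->
  (forall k, homR k (fil_rees_val r)`_k \in J) -> r \in J.
Proof. by move=> sJ rJ; rewrite [r]rees_sum; apply: ideal_sum => // k _; apply: rJ. Qed.

Hypothesis nR : noetherian R.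

(* The degrees of finitely many generators of a graded ideal bound the degrees
   in which it has to be known. *)
Lemma graded_bound (G : nat -> {pred A}) : (forall n, is_ideal (G n)) ->
  (forall i j x y, x \in ideal_pow I i -> y \in G j -> x * y \in G (i + j)%N) ->
  (forall n, {subset G n <= ideal_pow I n}) ->
  exists D, forall n (N : {pred A}), is_ideal N ->
    (forall i j x y, (j <= D)%N -> (i + j)%N = n -> x \in ideal_pow I i ->
        y \in G j -> x * y \in N) -> {subset G n <= N}.
Proof.
move=> sG GM GI.
pose L : {pred R} := [pred r : R | `[< forall i, (fil_rees_val r)`_i \in G i >] ].
have sL : is_ideal L.
  split=> [|a r s /asboolP rL /asboolP sL]; apply/asboolP => i.
    by rewrite coef0 ideal0.
  rewrite coefD coefM; apply: idealD => //; apply: ideal_sum => // j _.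
  have := GM _ _ _ _ (coefR a j) (rL (i - j)%N); rewrite subnKC // -ltnS.
  exact: ltn_ord.
have [s sE] := nR sL.
have [D sD] : exists D, forall r, r \in s -> (size (fil_rees_val r) <= D)%N.
  elim: (s) => [|r t [D tD]]; first by exists 0%N.
  exists (maxn (size (fil_rees_val r)) D) => q; rewrite inE => /orP[/eqP->|/tD qD].
    exact: leq_maxl.
  by rewrite (leq_trans qD) ?leq_maxr.
exists D => n N sN GN x xG; have xI := GI n x xG.
have : homR n x \in L.
  apply/asboolP => i; rewrite homRE // coefCM coefXn.
  by case: eqP => [->|_]; rewrite ?mulr1 // mulr0 ideal0.
rewrite sE => /spanP[c cs xE].
have -> : x = (fil_rees_val (homR n x))`_n by rewrite homRE // coefCM coefXn eqxx mulr1.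
rewrite xE; elim: c cs {xE} => [|p c IHc] cs; first by rewrite big_nil coef0 ideal0.
rewrite big_cons coefD; apply: idealD => //; last first.
  by apply: IHc => q qc; rewrite cs // inE qc orbT.
have ps : p.2 \in s by apply: cs; rewrite mem_head.
have : (p.2 : R) \in L by rewrite sE; apply: mem_span.
move=> /asboolP pL; rewrite -[p.1 *: p.2]/(p.1 * (p.2 : R)) /= coefMr.
apply: ideal_sum => // j _; case: (leqP j D) => jD.
  apply: (GN (n - j)%N j) => //; last exact: coefR.
  by rewrite subnK // -ltnS ltn_ord.
by rewrite [X in _ * X]nth_default ?mulr0 ?ideal0 // (leq_trans (sD _ ps)) // ltnW.
Qed.

Hypothesis I0 : exists2 b, b \in I & b != 0.

Lemma pow_leq m n : (m <= n)%N -> {subset ideal_pow I n <= ideal_pow I m}.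
Proof. exact: ideal_pow_leq. Qed.

(* Above the degrees of the generators of the ideals [(I^(n+2) : I)] and
   [I^n :&: b A] of the Rees algebra, [I^n] is Ratliff-Rush closed. *)
Lemma ratliff_rush_stable : exists N, forall n, (N <= n)%N -> {subset rr n <= ideal_pow I n}.
Proof.
have [b bI b0] := I0.
(* For [n > D1] an element of [G n] is a sum of terms [u v] with [v] in some [G j], [j <= D1], and
   [u] in a positive power of [I]; one factor of [u] carries [v] into [I^(j + 2)] and so gains a
   degree. *)
have [D1 D1P] : exists D, forall n, (D < n)%N -> forall x, x \in ideal_pow I n ->
    (forall c, c \in I -> c * x \in ideal_pow I n.+2) -> x \in ideal_pow I n.+1.
  pose G n : {pred A} := [pred x | (x \in ideal_pow I n) &&
    `[< forall c, c \in I -> c * x \in ideal_pow I n.+2 >] ].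
  have [|||D DP] := @graded_bound G.
  - move=> n; split=> [|a x y /andP[xI /asboolP xG] /andP[yI /asboolP yG]]; apply/andP.
      split; first exact: ideal0 (pow_sub _).
      by apply/asboolP => c _; rewrite mulr0 ideal0 //; apply: pow_sub.
    split; first exact: (pow_sub n).2.
    apply/asboolP => c cI; rewrite mulrDr mulrCA.
    by apply: (pow_sub n.+2).2; [apply: xG | apply: yG].
  - move=> i j x y xI /andP[yI /asboolP yG]; rewrite inE ideal_powM //=.
    by apply/asboolP => c /yG cy; rewrite mulrCA -addnS -addnS ideal_powM.
  - by move=> n x /andP[].
  exists D => n Dn x xI xG; apply: (DP n (ideal_pow I n.+1)).
  - exact: pow_sub.
  - move=> i j u v jD ij uI /andP[vI /asboolP vG].
    have ij1 : i = i.-1.+1 by rewrite prednK // -(ltn_add2r j) ij (leq_ltn_trans jD).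
    have nE : (n.+1 = i.-1 + j.+2)%N by rewrite -ij ij1 /= !addnS.
    rewrite nE; rewrite ij1 -add1n in uI; move: u uI.
    apply: (@ideal_pow_split A I 1 i.-1 (icolon (ideal_pow I (i.-1 + j.+2)) v)).
      exact/icolon_ideal/pow_sub.
    move=> u w uI wI; rewrite icolonE mulrAC mulrC; apply: ideal_powM => //; move: u uI.
    apply: (@ideal_pow_ind A I 1 (icolon (ideal_pow I j.+2) v)); first exact/icolon_ideal/pow_sub.
    move=> [|c [|//]] // _ cI; rewrite big_seq1 icolonE; apply: vG.
    by rewrite cI ?mem_head.
  by apply/andP; split=> //; apply/asboolP.
(* The Artin-Rees lemma for the ideal [b A], with [b] cancelled. *)
have [D2 D2P] : exists D, forall n x, b * x \in ideal_pow I n -> x \in ideal_pow I (n - D).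
  pose G n : {pred A} := [pred x | (x \in ideal_pow I n) && `[< exists y, x = b * y >] ].
  have [|||D DP] := @graded_bound G.
  - move=> n; split=> [|a x y /andP[xI /asboolP[x' xE]] /andP[yI /asboolP[y' yE]]].
      by apply/andP; split; [exact: ideal0 (pow_sub _) | apply/asboolP; exists 0; rewrite mulr0].
    apply/andP; split; first exact: (pow_sub n).2.
    apply/asboolP; exists (a * x' + y').
    by rewrite mulrDr [b * (a * _)]mulrCA -yE -xE.
  - move=> i j x y xI /andP[yI /asboolP[z yE]]; rewrite inE ideal_powM //=.
    by apply/asboolP; exists (x * z); rewrite yE mulrCA.
  - by move=> n x /andP[].
  exists D => n x bx; have sN : is_ideal [pred x | `[< exists2 y, y \in ideal_pow I (n - D) & x = b * y >] ].
    split=> [|a u v /asboolP[u' uI uE] /asboolP[v' vI vE]]; apply/asboolP.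
      by exists 0; rewrite ?mulr0 // ideal0 //; apply: pow_sub.
    exists (a * u' + v'); last by rewrite mulrDr [b * (a * _)]mulrCA -uE -vE.
    exact: (pow_sub (n - D)).2.
  have [y yI /(mulfI b0) -> //] : exists2 y, y \in ideal_pow I (n - D) & b * x = b * y.
  apply/asboolP; apply: (DP n _ sN) => [i j u v jD ij uI /andP[vI /asboolP[w vE]]|]; last first.
    by apply/andP; split=> //; apply/asboolP; exists x.
  apply/asboolP; exists (u * w); last by rewrite vE mulrCA.
  rewrite mulrC; apply: ideal_powMl; apply: pow_leq uI.
  by rewrite -ij leq_subLR addnC leq_add2r.
(* Division by [b] loses at most [D2] degrees, which [D1P] regains one at a time. *)
have quot n x : (D1 + D2 < n)%N -> (forall c, c \in I -> c * x \in ideal_pow I n.+1) ->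
    x \in ideal_pow I n.
  move=> nD xI; have climb t : x \in ideal_pow I (minn (n.+1 - D2 + t) n).
    elim: t => [|t IHt].
      by apply: pow_leq (D2P _ _ (xI b bI)); rewrite addn0 geq_minl.
    case: (leqP n (n.+1 - D2 + t)) => nt.
      by apply: pow_leq IHt; rewrite (minn_idPr nt) geq_minr.
    have -> : minn (n.+1 - D2 + t.+1) n = (n.+1 - D2 + t).+1.
      by rewrite addnS; apply/minn_idPl.
    move: IHt; rewrite (minn_idPl (ltnW nt)) => IHt; apply: D1P => //.
      apply: leq_trans (leq_addr _ _); rewrite ltn_subRL addnC.
      by apply: ltn_trans nD _.
    by move=> c /xI; apply: pow_leq.
  by apply: pow_leq (climb D2); rewrite leq_min leqnn andbT subnK ?leqnSn // ltnW // ltnS ltnW // (leq_ltn_trans (leq_addl D1 D2)).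
exists (D1 + D2).+1 => n nD x /ratliff_rush_powP[k].
elim: k => [|k IHk] xk; first by have := xk 1 (ideal_pow0 _ _); rewrite mulr1 addn0.
apply: IHk => y yI; apply: quot; first by apply: leq_trans nD (leq_addr _ _).
move=> c cI; rewrite mulrCA -addnS; apply: xk.
by rewrite -add1n; apply: ideal_powM => //; apply: ideal_pow1.
Qed.

(** From the degree [N] of stability on, any multiplier will do; below it, [b^N] lies in [I^N] and
    hence in [I^n]. *)
Lemma conductor : exists2 c, c != 0 & forall n x, x \in rr n -> c * x \in ideal_pow I n.
Proof.
have [N NP] := ratliff_rush_stable; have [b bI b0] := I0.
exists (b ^+ N) => [|n x xn]; first exact: expf_neq0.
case: (leqP N n) => nN; first by apply: ideal_powMl; apply: NP.
rewrite mulrC; apply: ideal_powMl; apply: pow_leq (ltnW nN) _ _.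
exact: expr_ideal_pow.
Qed.

End Rees.

Lemma preim_mul_ideal (R : comNzRingType) (J : {pred R}) x : is_ideal J ->
  is_ideal [pred y | x * y \in J].
Proof.
move=> sJ; split=> [|a y z]; rewrite !inE; first by rewrite mulr0 ideal0.
by move=> yJ zJ; rewrite mulrDr mulrCA; apply: idealD => //; apply: idealM.
Qed.

(** * Associated primes of quotients of the Ratliff-Rush Rees algebra *)

Section BadPrimes.
Variables (A : idomainType) (m I : {pred A}).
Hypothesis nA : noetherian A.
Hypothesis pm : is_prime m.
Hypothesis hm : forall J, is_ideal J -> 1 \notin J -> {subset J <= m}.
Hypothesis sI : is_ideal I.
Hypothesis Im : {subset I <= m}.
Hypothesis mI : forall x, x \in m -> exists k, x ^+ k \in I.
Hypothesis I0 : exists2 b, b \in I & b != 0.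
Hypothesis nR : noetherian (rees I).

Local Notation R := (rees I).
Local Notation rr n := (ratliff_rush (ideal_pow I n)).
Local Notation v := (@fil_rees_val A (adic_filtration I)).
Local Notation S := (fil_pred (ratliff_rush_filtration I)).
Implicit Types (P q : {pred R}) (r : R).

Definition irrelevant : {pred R} := [pred r : R | (v r)`_0 \in m].

Definition rees_prime q := is_prime q /\ {subset q <= irrelevant}.

(* The annihilator of [y / a * t ^ n] in [A[t] / S]. *)
Definition hcolon (a y : A) n : {pred R} := [pred r : R |
  `[< forall k, exists2 z, z \in rr (n + k)%N & (v r)`_k * y = a * z >] ].

Lemma hcolonP a y n r : reflect (forall k, exists2 z, z \in rr (n + k)%N & (v r)`_k * y = a * z)
  (r \in hcolon a y n).
Proof. exact: asboolP. Qed.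

Lemma hcolon_hom a y n k c : c \in ideal_pow I k ->
  (homR I k c \in hcolon a y n) <-> exists2 z, z \in rr (n + k)%N & c * y = a * z.
Proof.
move=> cI; split=> [/hcolonP/(_ k)|cy].
  by rewrite homRE // coefCM coefXn eqxx mulr1.
apply/hcolonP => i; rewrite homRE // coefCM coefXn.
case: eqP => [->|_]; first by rewrite mulr1.
by exists 0; rewrite ?mulr0 ?mul0r //; apply/ideal0/rr_sub.
Qed.

Lemma irrelevant_prime : is_prime irrelevant.
Proof.
split.
- split=> [|a x y]; rewrite !inE; first by rewrite coef0; apply/ideal0/prime_sub.
  move=> xm ym; rewrite coefD coef0M; have sm := prime_sub pm.
  by apply: idealD => //; apply: idealM.
- by rewrite inE coef1 prime_not1.
by move=> x y; rewrite !inE coef0M primeM.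
Qed.

Lemma const_m P : is_prime P -> (forall c, c \in I -> constR I c \in P) ->
  forall c, c \in m -> constR I c \in P.
Proof.
move=> pP IP c /mI[k /IP]; rewrite rmorphXn; exact: primeX.
Qed.

Lemma prime_local (p : {pred A}) : is_prime p -> {subset p <= m}.
Proof. by move=> pp; apply: hm; [exact: prime_sub | exact: prime_not1]. Qed.

Lemma prime_I (p : {pred A}) : is_prime p -> psub p m -> exists2 b, b \in I & b \notin p.
Proof.
move=> pp [_ [x xm xp]]; have [k xk] := mI xm; exists (x ^+ k) => //.
by apply: contra xp; apply: primeX.
Qed.

Definition ext (p : {pred A}) : {pred R} := [pred r : R | v r \in poly_pred p].

Definition ext0 (p : {pred A}) : {pred R} := [pred r : R | (v r)`_0 \in p].

Lemma ext_prime p : is_prime p -> is_prime (ext p).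
Proof.
move/poly_pred_prime => -[sp p1 pM]; split=> [||x y]; last exact: pM.
  split=> [|a x y]; first exact: (ideal0 sp).
  by move=> xp yp; apply: (idealD sp) => //; apply: (idealM _ sp).
exact: p1.
Qed.

Lemma ext0_prime p : is_prime p -> is_prime (ext0 p).
Proof.
case=> sp p1 pM; split=> [||x y]; last by rewrite !inE coef0M => /pM.
  split=> [|a x y]; rewrite !inE; first by rewrite coef0 ideal0.
  by move=> xm ym; rewrite coefD coef0M; apply: idealD => //; apply: idealM.
by rewrite inE coef1.
Qed.

(** The extended chain stops at the last prime but one, [p'], which differs from [m], and then takes
    two steps: from [ext p'] to [ext0 p'], strict because [I] is not inside [p'], and on to
    [irrelevant]. *)
Lemma ext_chain n p : up_ge (@is_prime A) n.+1 p -> up_ge rees_prime n.+2 (ext p).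
Proof.
elim: n p => [|n IHn] p [pp [q uq pq]]; last first.
  split; last first.
    exists (ext q); first exact: IHn.
    case: pq => pq [x xq xp]; split=> [r /poly_predP rp|].
      by apply/poly_predP => i; apply: pq.
    exists (constR I x); last by apply/poly_predP => /(_ 0%N); rewrite coefC (negbTE xp).
    apply/poly_predP => i; rewrite coefC; case: ifP => // _.
    by apply/ideal0/prime_sub; case: uq.
  split; first exact: ext_prime.
  by move=> r /poly_predP/(_ 0%N); rewrite inE; apply: prime_local.
have pq' : psub p m by apply: psub_subr pq; apply: prime_local; case: uq.
split; first split; first exact: ext_prime.
  by move=> r /poly_predP/(_ 0%N); rewrite inE; apply: prime_local.
exists (ext0 p); last first.
  split=> [r /poly_predP/(_ 0%N) //|].
  have [b bI bp] := prime_I pp pq'; have bI1 := ideal_pow1 bI.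
  exists (homR I 1 b); first by rewrite inE homRE // coefMX /=; apply/ideal0/prime_sub.
  apply/poly_predP => /(_ 1%N).
  by rewrite -[(homR I 1 b : {poly A})]/(v _) homRE // coefMX coefC /= (negbTE bp).
split; first split; first exact: ext0_prime.
  by move=> r; rewrite !inE; apply: prime_local.
exists irrelevant; first by split; [split; [exact: irrelevant_prime|]|].
split=> [r|]; first by rewrite !inE; apply: prime_local.
case: pq' => _ [x xm xp]; exists (constR I x); first by rewrite inE coefC.
by rewrite inE coefC.
Qed.

Variable dim : nat.
Hypothesis dim2 : (2 <= dim)%N.
Variable zs : seq A.
Hypothesis zm : {subset zs <= m}.
Hypothesis zdim : size zs = dim.
Hypothesis zreg : reg_mod (pred1 0) zs.
Hypothesis htM : ~ ht_ge dim.+2 irrelevant.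

Lemma no_long_chain P : ht_ge 2 P -> ~ up_ge rees_prime dim P.
Proof.
move=> htP uP; have [|Q [pQ QM]] := up_ht _ uP htP; first by move=> ? [].
rewrite addn2 => htQ; apply: htM; apply: ht_ge_sub htQ => //; exact: irrelevant_prime.
Qed.

Lemma cm_chain (a y : A) (p : {pred A}) : a != 0 -> is_prime p ->
  p =i icolon (iadj (pred1 0) a) y -> up_ge (@is_prime A) dim.-1 p.
Proof.
move=> a0 pp /eq_pred pE; rewrite pE in pp *; rewrite -zdim.
apply: (@icolon_adj_chain A nA m pm hm (pred1 0)) => //.
- exact: prime_sub (zero_prime A).
- by move=> x /eqP/eqP; rewrite mulf_eq0 (negbTE a0).
by rewrite icolonE; apply/iadjP; exists y; rewrite mulrC subrr; apply: eqxx.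
Qed.

Lemma iadj0 (a y : A) : (y \in iadj (pred1 0) a) <-> exists e, y = a * e.
Proof.
split=> [/iadjP[e /eqP/eqP]|[e ->]].
  by rewrite subr_eq0 => /eqP->; exists e; rewrite mulrC.
by apply/iadjP; exists e; rewrite mulrC subrr; apply: eqxx.
Qed.

(** Powers of [b], which is outside [P], bring any element into the required closures. So [P] is
    [ext p] for the associated prime [p = (a A : y)] of [A / a A], and the chains of [p] are long
    because [A] is Cohen-Macaulay. *)
Lemma hcolon_noI P (a y : A) n (b : A) : is_prime P -> a != 0 -> P =i hcolon a y n ->
  b \in I -> constR I b \notin P -> up_ge rees_prime dim P.
Proof.
move=> pP a0 PE bI bP.
have powP k c : c \in ideal_pow I k -> (homR I k c \in P) <->
    exists2 z, z \in rr (n + k)%N & c * y = a * z.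
  by move=> cI; rewrite PE; apply: hcolon_hom.
pose p : {pred A} := [pred c | constR I c \in P].
have pp : is_prime p by apply: (preim_prime (constR I) pP).
have bX k : b ^+ k \in ideal_pow I k by apply: expr_ideal_pow.
have bpP k r : constR I (b ^+ k) * r \in P -> r \in P.
  by rewrite primeM // rmorphXn => /orP[/(primeX pP)|//]; rewrite (negbTE bP).
have constE c : (c \in p) <-> exists2 z, z \in rr n & c * y = a * z.
  by rewrite inE -homR0 powP ?ideal_pow0 // addn0.
have pE : p =i icolon (iadj (pred1 0) a) y.
  move=> c; apply/idP/idP => [/constE[z _ cy]|].
    by rewrite icolonE; apply/iadj0; exists z.
  rewrite icolonE => /iadj0[e cy]; suff : b ^+ n * c \in p.
    by rewrite inE rmorphM; apply: bpP.
  apply/constE; exists (b ^+ n * e); last by rewrite -mulrA cy mulrCA.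
  by rewrite mulrC; apply: (idealM _ (rr_sub I n)); apply: ideal_pow_ratliff_rush.
suff /eq_pred -> : P =i ext p.
  have := cm_chain a0 pp pE; case: (dim) dim2 => [|[|d]] // _; exact: ext_chain.
move=> r; apply/idP/idP => [|/poly_predP rp].
  rewrite PE => /hcolonP rP; apply/poly_predP => k.
  by have [z _ rk] := rP k; rewrite pE icolonE; apply/iadj0; exists z.
apply: mem_homR => [|k]; first exact: prime_sub.
have rk := coefR r k; have rkp : constR I (v r)`_k \in P := rp k.
apply: (bpP k); have -> : constR I (b ^+ k) * homR I k (v r)`_k =
    homR I k (b ^+ k) * constR I (v r)`_k.
  by rewrite -!homR0 !homRM ?ideal_pow0 // add0n addn0 mulrC.
by apply: idealM => //; apply: prime_sub.
Qed.

Lemma pow_extend n k l (x : A) : (k <= l)%N ->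
  (forall y, y \in ideal_pow I k -> x * y \in ideal_pow I (n + k)) ->
  forall y, y \in ideal_pow I l -> x * y \in ideal_pow I (n + l).
Proof.
move/subnKC => <- xj y.
apply: (@ideal_pow_split A I k _ [pred y | x * y \in ideal_pow I (n + (k + (l - k)))]).
  exact/preim_mul_ideal/pow_sub.
move=> w z wI zI; suff: x * (w * z) \in ideal_pow I (n + (k + (l - k))) by [].
by rewrite mulrA addnA; apply: ideal_powM => //; apply: xj.
Qed.

(** Finitely many generators of [I] admit a common exponent [k], and [I^(k+1)] is [I] times
    [I^k]. *)
Lemma rr_colon n (e : A) : (forall b, b \in I -> b * e \in rr n.+1) -> e \in rr n.
Proof.
move=> be; have [s sE] := nA sI.
have [k sk] : exists k, forall b, b \in s -> forall y, y \in ideal_pow I k ->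
    b * e * y \in ideal_pow I (n.+1 + k).
  have : {subset s <= I} by move=> b bs; rewrite sE; apply: mem_span.
  elim: (s) => [|b t IHt] tI; first by exists 0%N.
  have [|k tk] := IHt; first by move=> c ct; rewrite tI // inE ct orbT.
  have [|l bl] := (ratliff_rush_powP I n.+1 (b * e)).1; first by rewrite be ?tI ?mem_head.
  exists (maxn k l) => c; rewrite inE => /orP[/eqP->|ct].
    by apply: pow_extend bl; rewrite leq_maxr.
  by apply: pow_extend (tk c ct); rewrite leq_maxl.
apply/ratliff_rush_powP; exists k.+1 => y; rewrite -add1n; move: y.
have sN : is_ideal (icolon (ideal_pow I (n + (1 + k))) e) by apply/icolon_ideal/pow_sub.
have swap y : (e * y \in ideal_pow I (n + (1 + k))) = (y \in icolon (ideal_pow I (n + (1 + k))) e).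
  by rewrite icolonE mulrC.
move=> y yI; rewrite swap; move: y yI; apply: (@ideal_pow_split A I 1 k) => // y z yI zI.
have {yI} : y \in I.
  move: y yI; apply: (@ideal_pow_ind A I 1 I) => // -[|c [|//]] // _ cI.
  by rewrite big_seq1 cI ?mem_head.
rewrite sE => ys; move: y ys.
apply: (@span_min A A^o _ [pred y | y * z \in icolon (ideal_pow I (n + (1 + k))) e]).
  exact: (icolon_ideal z sN).
move=> b bs; suff: b * z * e \in ideal_pow I (n + (1 + k)) by [].
rewrite mulrAC addnA addn1; exact: sk.
Qed.

(** If [a] divides [y], the quotient is in the closure by [rr_colon], and [P] contains 1. If not,
    [m] is associated to [A / a A], and [cm_chain] with [dim >= 2] produces a prime strictly above
    [m]. *)
Lemma hcolon_irrelevant P (a y : A) n : is_prime P -> a != 0 -> P =i hcolon a y n ->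
  (forall b, b \in I -> constR I b \in P) -> (forall b, b \in I -> homR I 1 b \in P) -> False.
Proof.
move=> pP a0 PE IP tP; have mP := const_m pP IP.
have constE c : constR I c \in P -> exists2 z, z \in rr n & c * y = a * z.
  by rewrite -homR0 PE => /(hcolon_hom a y n (ideal_pow0 I c)); rewrite addn0.
case: (pselect (exists e, y = a * e)) => [[e ye]|ny].
  have : e \in rr n.
    apply: rr_colon => b bI; have := tP b bI; rewrite PE => /(hcolon_hom a y n (ideal_pow1 bI)).
    by rewrite addn1 => -[z zr]; rewrite ye mulrCA => /(mulfI a0) ->.
  move=> er; case/negP: (prime_not1 pP).
  have -> : 1 = homR I 0 1 by rewrite homR0 rmorph1.
  rewrite PE.
  by apply/(hcolon_hom a y n (ideal_pow0 I 1)); exists e; rewrite ?addn0 // mul1r.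
have sK : is_ideal (icolon (iadj (pred1 0) a) y).
  by apply/icolon_ideal/iadj_ideal/prime_sub/zero_prime.
have mE : m =i icolon (iadj (pred1 0) a) y.
  move=> c; apply/idP/idP => [/mP/constE[z _ cy]|].
    by rewrite icolonE; apply/iadj0; exists z.
  apply: hm => //; rewrite icolonE mul1r; apply/negP => /iadj0[e ye]; apply: ny.
  by exists e.
have := cm_chain a0 pm mE; case: (dim) dim2 => [|[|d]] // _ [_ [q uq [mq [x xq /negP]]]].
apply; apply: (@prime_local q) => //; by case: (d) uq => [|?] [].
Qed.

(* The only consequence of the hypothesis on [G(I)] that the proof needs; unlike
   that hypothesis, it passes from [I] to its powers. *)
Definition punctured_chains := forall P (a y : A) n (b : A), is_prime P -> a != 0 ->
  y \in rr n -> P =i hcolon a y n -> (forall c, c \in I -> constR I c \in P) ->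
  b \in I -> homR I 1 b \notin P -> up_ge rees_prime dim P.

Hypothesis hchains : punctured_chains.

Lemma hcolon_not_prime P (a y : A) n : is_prime P -> a != 0 -> y \in rr n ->
  P =i hcolon a y n -> ~ ht_ge 2 P.
Proof.
move=> pP a0 yr PE htP; apply: (no_long_chain htP).
case: (pselect (exists2 b, b \in I & constR I b \notin P)) => [[b bI bP]|nb].
  exact: hcolon_noI PE bI bP.
have IP b : b \in I -> constR I b \in P.
  by move=> bI; apply: contrapT => /negP bP; apply: nb; exists b.
case: (pselect (exists2 b, b \in I & homR I 1 b \notin P)) => [[b bI bP]|nb'].
  exact: (hchains pP a0 yr PE IP bI bP).
exfalso; apply: (hcolon_irrelevant pP a0 PE IP) => b bI.
by apply: contrapT => /negP bP; apply: nb'; exists b.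
Qed.

(** The component of degree [i] of [a S]. *)
Definition amul (a : A) i : {pred A} := [pred x | `[< exists2 z, z \in rr i & x = a * z >] ].

Lemma amul_ideal a i : is_ideal (amul a i).
Proof.
split=> [|c x x' /asboolP[z zr xE] /asboolP[z' zr' xE']]; apply/asboolP.
  by exists 0; rewrite ?mulr0 //; apply/ideal0/rr_sub.
exists (c * z + z'); first exact: (rr_sub I i).2.
by rewrite mulrDr mulrCA -xE -xE'.
Qed.

Lemma amulM a i j x w : x \in ideal_pow I i -> w \in amul a j -> x * w \in amul a (i + j).
Proof.
move=> xI /asboolP[z zr ->]; apply/asboolP; exists (x * z); last by rewrite mulrCA.
exact: rrMpow.
Qed.

Lemma coef_trunc r k i :
  (v (\sum_(0 <= j < k) homR I j (v r)`_j))`_i = if (i < k)%N then (v r)`_i else 0.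
Proof.
elim: k => [|k IHk]; first by rewrite big_nil coef0.
rewrite big_nat_recr //= coefD IHk homRE ?coefR // coefCM coefXn ltnS.
by case: ltngtP => [_|_|->]; rewrite ?mulr0 ?mulr1 ?addr0 ?add0r.
Qed.

Section Homogeneous.
Variables (P : {pred R}) (a : A) (s : {poly A}).
Hypothesis pP : is_prime P.
Hypothesis PE : forall r, r \in P <-> forall i, (v r * s)`_i \in amul a i.

(* Associated primes of graded modules are homogeneous: the lowest component
   of an annihilating element annihilates up to a power. *)
Lemma lowest_component r k : r \in P -> (forall j, (j < k)%N -> (v r)`_j = 0) ->
  homR I k (v r)`_k \in P.
Proof.
move=> rP r0; set c := (v r)`_k; have cI : c \in ideal_pow I k by apply: coefR.
have cX e : c ^+ e \in ideal_pow I (k * e).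
  by rewrite -ideal_powX; apply: expr_ideal_pow.
(* In [c^i] times the coefficient of [r s] of degree [k + i], the terms other than the wanted one
   involve coefficients of [s] of degree [j < i], for which the smaller power [c^(j+1)] is enough by
   induction. *)
have main i : c ^+ i.+1 * s`_i \in amul a (k * i.+1 + i).
  have [N] := ubnP i; elim: N i => // N IHN i; rewrite ltnS => iN.
  have rs := (PE r).1 rP (k + i)%N.
  have sumE : (v r * s)`_(k + i) = c * s`_i + \sum_(0 <= j < i) (v r)`_(k + i - j) * s`_j.
    rewrite coefMr -(big_mkord xpredT (fun j => (v r)`_(k + i - j) * s`_j)).
    rewrite (big_cat_nat (n := i)) //=; last by rewrite ltnW // ltnS leq_addl.
    rewrite (big_ltn (m := i)) ?ltnS ?leq_addl // addnK addrC; congr (_ + _).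
    rewrite big_nat big1 ?addr0 // => j /andP[ij jk]; rewrite r0 ?mul0r //.
    by rewrite ltn_subLR // addnC ltn_add2r.
  have -> : c ^+ i.+1 * s`_i = c ^+ i * (v r * s)`_(k + i) -
      \sum_(0 <= j < i) c ^+ i * ((v r)`_(k + i - j) * s`_j).
    by rewrite sumE mulrDr -mulr_sumr addrK exprSr mulrA.
  have -> : (k * i.+1 + i = k * i + (k + i))%N by rewrite mulnS addnA [(k + _)%N]addnC.
  apply: (idealB (amul_ideal _ _)); first exact: amulM.
  rewrite big_nat; apply: (ideal_sum _ (amul_ideal _ _)) => j /= ji.
  have -> : c ^+ i * ((v r)`_(k + i - j) * s`_j) =
      (c ^+ (i - j.+1) * (v r)`_(k + i - j)) * (c ^+ j.+1 * s`_j).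
    by rewrite -{1}(subnK ji) exprD; ring.
  have -> : (k * i + (k + i) = (k * (i - j.+1) + (k + i - j)) + (k * j.+1 + j))%N.
    rewrite -{1}(subnK ji) mulnDr -!addnA; congr (_ + _)%N.
    by rewrite [RHS]addnCA subnK // (leq_trans (ltnW ji)) // leq_addl.
  apply: amulM; first by apply: ideal_powM; [exact: cX | exact: coefR].
  by apply: IHN; apply: leq_trans iN.
apply: (primeX (n := size s) pP); rewrite homRX //; apply/PE => j.
have cN : c ^+ size s \in ideal_pow I (k * size s) by exact: cX.
case: (ltnP j (k * size s)) => [jk|/subnKC <-].
  by rewrite homRE // -mulrA coefCM coefXnM jk mulr0; apply/ideal0/amul_ideal.
set i := (j - _)%N; rewrite coef_homR //.
case: (ltnP i (size s)) => si; last by rewrite nth_default ?mulr0 //; apply/ideal0/amul_ideal.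
rewrite -{1 2}(subnK si) exprD -mulrA mulnDr -addnA.
exact: amulM.
Qed.

Lemma component r k : r \in P -> homR I k (v r)`_k \in P.
Proof.
have [N] := ubnP k; elim: N k r => // N IHN k r; rewrite ltnS => kN rP.
have sP := prime_sub pP; pose q := \sum_(0 <= j < k) homR I j (v r)`_j.
have rq i : (v (r - q))`_i = (v r)`_i - (if (i < k)%N then (v r)`_i else 0).
  by rewrite -coef_trunc -coefB.
have -> : (v r)`_k = (v (r - q))`_k by rewrite rq ltnn subr0.
apply: lowest_component => [|j jk]; last by rewrite rq jk subrr.
apply: idealB => //; rewrite /q big_nat; apply: ideal_sum => // j jk.
by apply: IHN => //; apply: leq_trans kN.
Qed.

(** Otherwise, for each [n] some homogeneous element outside [P] multiplies the component of [s] of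
    degree [n] into [a S]. The product of finitely many of these does so for all of [s], yet it is
    outside the prime [P]. *)
Lemma single_component : exists n, P =i hcolon a s`_n n.
Proof.
have sP := prime_sub pP.
suff [n nP] : exists n, forall k c, c \in ideal_pow I k ->
    c * s`_n \in amul a (n + k) -> homR I k c \in P.
  exists n => r; apply/idP/idP => [rP|/hcolonP rP].
    apply/hcolonP => k; have rk := coefR r k.
    have := (PE _).1 (component k rP) (k + n)%N; rewrite coef_homR // addnC.
    by move=> /asboolP.
  by apply: mem_homR => // k; apply: nP; [exact: coefR | apply/asboolP].
apply: contrapT => nn.
have ex n : exists k c, [/\ c \in ideal_pow I k, c * s`_n \in amul a (n + k) & homR I k c \notin P].
  apply: contrapT => nk; apply: nn; exists n => k c cI cs; apply: contrapT => /negP cP.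
  by apply: nk; exists k, c.
have [k [c [cI cs /negP]]] : exists k c, [/\ c \in ideal_pow I k,
    forall n, (n < size s)%N -> c * s`_n \in amul a (n + k) & homR I k c \notin P].
  elim: (size s) => [|N [k [c [cI cs cP]]]].
    exists 0%N, 1; split=> //; first exact: ideal_pow0.
    by rewrite homR0 rmorph1 prime_not1.
  have [l [e [eI es eP]]] := ex N; exists (k + l)%N, (c * e); split.
  - exact: ideal_powM.
  - move=> n; rewrite ltnS leq_eqVlt => /orP[/eqP->|/cs cn].
      by rewrite -mulrA addnCA; apply: amulM.
    by rewrite mulrAC mulrC addnA addnC; apply: amulM.
  by rewrite -homRM // primeM // negb_or cP.
apply; apply/PE => j; case: (ltnP j k) => [jk|/subnKC <-].
  by rewrite homRE // -mulrA coefCM coefXnM jk mulr0; apply/ideal0/amul_ideal.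
rewrite coef_homR // addnC; case: (ltnP (j - k) (size s)) => [/cs //|si].
by rewrite nth_default ?mulr0 //; apply/ideal0/amul_ideal.
Qed.

End Homogeneous.

Lemma clear_denominators (p : {poly A}) : exists2 c, c != 0 & exists r : R, v r = c%:P * p.
Proof.
have [b bI b0] := I0; exists (b ^+ size p); first exact: expf_neq0.
suff pI : (b ^+ size p)%:P * p \in fil_pred (adic_filtration I) by exists (FilRees pI).
apply/fil_predP => i; rewrite coefCM; case: (leqP (size p) i) => pi.
  by rewrite nth_default ?mulr0 //; apply/ideal0/pow_sub.
rewrite mulrC; apply: ideal_powMl; apply: pow_leq (ltnW pi) _ _.
exact: expr_ideal_pow.
Qed.

(* Over the field of fractions of [A] the localisation of [R] is [F[t]], of
   dimension one. *)
Lemma generic_prime P : is_prime P -> (forall c, c != 0 -> constR I c \notin P) ->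
  ~ ht_ge 2 P.
Proof.
move=> pP Pc [_ [Q [pQ [Q0 [pQ0 _] [_ [h0 h0Q h0Q0]]]] [QP [r rP rQ]]]].
have h0n : v h0 != 0.
  apply: contra h0Q0 => /eqP h00; have -> : h0 = 0 by apply: val_inj.
  exact/ideal0/prime_sub.
have minimal (K : {pred R}) f : f \in K -> v f != 0 -> exists g, [/\ g \in K, v g != 0 &
    forall h, h \in K -> v h != 0 -> (size (v g) <= size (v h))%N].
  move=> fK f0; have ex : exists n, `[< exists2 g, g \in K & v g != 0 /\ size (v g) = n >].
    by exists (size (v f)); apply/asboolP; exists f.
  case: (ex_minnP ex) => n /asboolP[g gK [g0 gn]] nmin; exists g; split=> // h hK h0'.
  by rewrite gn; apply: nmin; apply/asboolP; exists h.
have [g [gP g0 gmin]] := minimal P h0 (QP _ h0Q) h0n.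
have [sP sQ] := (prime_sub pP, prime_sub pQ).
(* Pseudo-division by [g]: once its denominators are cleared, the remainder is in [P] and has
   smaller degree than [g], so it is 0. *)
have divg f : f \in P -> exists2 c, c != 0 & exists q : R, c%:P * v f = v q * v g.
  move=> fP; have := Pdiv.Idomain.divp_eq (v f) (v g).
  set e := _ ^+ _; set q := _ %/ _; set rem := _ %% _ => fE.
  have e0 : e != 0 by rewrite expf_neq0 // lead_coef_eq0.
  have [c1 c10 [q1 q1E]] := clear_denominators q.
  have [c2 c20 [r2 r2E]] := clear_denominators rem.
  exists (c2 * c1 * e); first by rewrite !mulf_neq0.
  exists (constR I c2 * q1).
  have r3E : v (constR I c1 * r2) = v (constR I (c2 * c1 * e) * f - constR I c2 * q1 * g).
    rewrite /= r2E q1E.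
    have -> : (c2 * c1 * e)%:P * v f = c2%:P * c1%:P * (e *: v f).
      by rewrite -mul_polyC !polyCM !mulrA.
    by rewrite fE; ring.
  have r30 : v (constR I c1 * r2) == 0.
    apply: contraT => n0; have := gmin (constR I c1 * r2) _ n0.
    have -> : constR I c1 * r2 \in P.
      rewrite (_ : constR I c1 * r2 = constR I (c2 * c1 * e) * f - constR I c2 * q1 * g).
        by apply: idealB => //; apply: idealM.
      exact: val_inj.
    move=> /(_ isT); rewrite leqNgt => /negP; case.
    have -> : v (constR I c1 * r2) = c1 *: (c2 *: rem) by rewrite -!mul_polyC -r2E.
    rewrite (leq_ltn_trans (size_scale_leq _ _)) //.
    by rewrite (leq_ltn_trans (size_scale_leq _ _)) // ltn_modp.
  by apply/eqP; rewrite -subr_eq0; move: r30; rewrite r3E.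
have gQ : g \notin Q.
  apply: contra rQ => gQ; have [c c0 [q cr]] := divg r rP.
  have : constR I c * r \in Q.
    have -> : constR I c * r = q * g by apply: val_inj.
    exact: idealM.
  rewrite primeM // => /orP[/QP|//]; by rewrite (negbTE (Pc c c0)).
have g1 : (1 < size (v g))%N.
  rewrite ltnNge; apply/negP => /size1_polyC gC.
  have gc : g = constR I (v g)`_0 by apply: val_inj.
  have := Pc (v g)`_0; rewrite -polyC_eq0 -gC => /(_ g0).
  by rewrite -gc gP.
(* Up to a constant, [h] is [q g]. As [g] is outside [Q] and of positive degree, [q] is in [Q] and
   of smaller degree than [h]. *)
have [h [hQ h0' hmin]] := minimal Q h0 h0Q h0n.
have [c c0 [q ch]] := divg h (QP _ hQ).
have q0 : v q != 0.
  apply: contraNneq h0' => q0; move: ch; rewrite q0 mul0r => /eqP.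
  by rewrite mulf_eq0 polyC_eq0 (negbTE c0).
have qQ : q \in Q.
  have : q * g \in Q.
    have -> : q * g = constR I c * h by apply: val_inj.
    exact: idealM.
  by rewrite primeM // (negbTE gQ) orbF.
have := hmin q qQ q0; have : size (c%:P * v h) = size (v h) by rewrite mul_polyC size_scale.
rewrite ch size_mul // => <-; rewrite leqNgt => /negP; apply.
by rewrite -ltnS prednK ?addn_gt0 ?size_poly_gt0 ?q0 // -addn2 leq_add2l.
Qed.

Theorem not_associated P x (s : {poly A}) : is_prime P -> x \in P -> x != 0 -> s \in S ->
  (forall r, r \in P <-> exists2 q, q \in S & v r * s = v x * q) -> ~ ht_ge 2 P.
Proof.
move=> pP xP x0 sS PE.
case: (pselect (exists2 c, c != 0 & constR I c \in P)) => [[a a0 aP]|nc]; last first.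
  by apply: generic_prime => // c c0; apply/negP => cP; apply: nc; exists c.
(* From [a s = x q], cancelling [x] turns [(x S : s)] into [(a S : q)]; membership in [a S] is
   tested coefficient by coefficient. *)
have [q qS aq] := (PE _).1 aP; have vx0 : v x != 0 by [].
have PE' r : r \in P <-> forall i, (v r * q)`_i \in amul a i.
  rewrite PE; split=> [[q' q'S rs] i|rq].
    apply/asboolP; exists q'`_i; first by have /fil_predP := q'S.
    rewrite -coefCM; have -> // : v r * q = a%:P * q'.
    by apply: (mulfI vx0); rewrite mulrCA -aq /= mulrCA rs mulrCA.
  have /choice[z zP] i : exists z, z \in rr i /\ (v r * q)`_i = a * z.
    by have /asboolP[z zr zE] := rq i; exists z.
  pose q' := \poly_(i < size (v r * q)) z i.
  have q'E : v r * q = a%:P * q'.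
    apply/polyP => i; rewrite coefCM coef_poly; case: ltnP => [_|si].
      by case: (zP i).
    by rewrite mulr0 nth_default.
  exists q'; first apply/fil_predP => i.
    by rewrite coef_poly; case: ifP => _; [case: (zP i) | apply/ideal0/rr_sub].
  have aP0 : a%:P != 0 by rewrite polyC_eq0.
  apply: (mulfI aP0); rewrite mulrCA; have -> : a%:P * s = v x * q by [].
  by rewrite mulrCA q'E mulrCA.
have [n PEn] := single_component pP PE'.
by apply: hcolon_not_prime PEn => //; have /fil_predP := qS.
Qed.

End BadPrimes.

(** * Local cohomology of the associated graded ring *)

Section Comparison.
Variables (R : comNzRingType) (I : {pred R}) (M : lmodType R).
Variables E E' : injective_resolution M.

Local Notation d := (ires_diff E).
Local Notation d' := (ires_diff E').
Local Notation tors N := (@torsion _ I N).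
Local Notation cyc := (@lc_cycles R I M _).
Local Notation bnd := (@lc_boundaries R I M _).

Lemma lc_boundaries_sub (F : injective_resolution M) i : submod_closed (@lc_boundaries R I M F i).
Proof.
case: i => [|i] /=.
  split=> [|c e f /eqP-> /eqP->]; first exact: eqxx.
  by rewrite scaler0 addr0; apply: eqxx.
split=> [|c e f /asboolP[x xT <-] /asboolP[y yT <-]]; apply/asboolP.
  by exists 0; [exact: sub0 (torsion_sub _ _) | exact: linear0].
by exists (c *: x + y); [exact: (torsion_sub I _).2 | rewrite linearP].
Qed.

Lemma resolution_diff2 (F : injective_resolution M) i (e : F i) :
  ires_diff F i.+1 (ires_diff F i e) = 0.
Proof. by apply/ires_exact; exists e. Qed.

Lemma predT_sub (V : lmodType R) : submod_closed (predT : {pred V}).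
Proof. by split. Qed.

(* Two injective resolutions of a module are homotopy equivalent. *)
Lemma comparison i : exists (f : {linear E i -> E' i}) (g : {linear E' i -> E i})
    (h : {linear E i.+1 -> E i}) (b : E i -> E i),
  [/\ forall e, d i e = 0 -> d' i (f e) = 0,
      forall e, d' i e = 0 -> d i (g e) = 0,
      forall e, e \in @lc_boundaries R I M E' i -> g e \in @lc_boundaries R I M E i,
      forall e, g (f e) - e = b e + h (d i e) &
      forall e, d i (b e) = 0 /\ (e \in tors (E i) -> b e \in @lc_boundaries R I M E i)].
Proof.
elim: i => [|i [f [g [h [b [Fker Gker Gbnd gfE bP]]]]]].
  have [|||f fP] := @injective_extension R (E' 0%N) M (E 0%N) predT (ires_aug E) (ires_aug E').
  - exact: ires_injective.
  - exact: predT_sub.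
  - by move=> x _ x0; rewrite (_ : x = 0) ?linear0 //; apply: (@ires_aug_inj _ _ E); rewrite linear0.
  have [|||g gP] := @injective_extension R (E 0%N) M (E' 0%N) predT (ires_aug E') (ires_aug E).
  - exact: ires_injective.
  - exact: predT_sub.
  - by move=> x _ x0; rewrite (_ : x = 0) ?linear0 //; apply: (@ires_aug_inj _ _ E'); rewrite linear0.
  have klin : linear (fun e => g (f e) - e).
    by move=> a u w; rewrite (linearP f) (linearP g) scalerBr opprD addrACA.
  have [|||h hP] := @injective_extension R (E 0%N) _ _ predT (d 0%N) (mklin klin).
  - exact: ires_injective.
  - exact: predT_sub.
  - by move=> e _ /ires_exact0[x <-]; rewrite mklinE fP // gP // subrr.
  exists f, g, h, (fun=> 0); split.
  - by move=> e /ires_exact0[x <-]; rewrite fP //; apply/ires_exact0; exists x.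
  - by move=> e /ires_exact0[x <-]; rewrite gP //; apply/ires_exact0; exists x.
  - by move=> e /eqP->; rewrite linear0; apply: eqxx.
  - by move=> e; rewrite add0r hP.
  by move=> e; split; [exact: linear0 | move=> _; exact: eqxx].
have blin : linear (fun e => d' i (f e)) by move=> a u w; rewrite !linearP.
have [|||f' fP'] := @injective_extension R (E' i.+1) _ _ predT (d i) (mklin blin).
- exact: ires_injective.
- exact: predT_sub.
- by move=> e _; apply: Fker.
have blin' : linear (fun e => d i (g e)) by move=> a u w; rewrite !linearP.
have [|||g' gP'] := @injective_extension R (E i.+1) _ _ predT (d' i) (mklin blin').
- exact: ires_injective.
- exact: predT_sub.
- by move=> e _; apply: Gker.
have fd e : f' (d i e) = d' i (f e) by apply: fP'.
have gd e : g' (d' i e) = d i (g e) by apply: gP'.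
have klin : linear (fun e => g' (f' e) - e - d i (h e)).
  move=> a u w; rewrite (linearP h) (linearP (d i)) (linearP f') (linearP g') !scalerBr.
  by rewrite !opprD [_ + (- (a *: u) - w)]addrACA [LHS]addrACA.
have [|||h' hP'] := @injective_extension R (E i.+1) _ _ predT (d i.+1) (mklin klin).
- exact: ires_injective.
- exact: predT_sub.
- move=> e _ /ires_exact[x <-]; rewrite mklinE fd gd -!linearB /= gfE addrK.
  by case: (bP x).
(* [b] is the part of the homotopy that comes from the degree below; it is 0 in degree 0. *)
exists f', g', h', (fun e => d i (h e)); split.
- by move=> e /ires_exact[x <-]; rewrite fd resolution_diff2.
- by move=> e /ires_exact[x <-]; rewrite gd resolution_diff2.
- move=> e /asboolP[x xT <-]; rewrite gd; apply/asboolP; exists (g x) => //.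
  exact: torsion_linear.
- by move=> e; rewrite hP' // mklinE [RHS]addrC subrK.
move=> e; split; first exact: resolution_diff2.
by move=> eT; apply/asboolP; exists (h e) => //; apply: torsion_linear.
Qed.

(** The hypothesis on [G(I)] supplies a resolution for each degree separately, while the homotopy
    needs the same one in all degrees. The comparison maps, being linear, preserve torsion. *)
Lemma lc_killed_transfer i y :
  (forall e, e \in @lc_cycles R I M E' i -> y *: e \in @lc_boundaries R I M E' i) ->
  forall e, e \in @lc_cycles R I M E i -> y *: e \in @lc_boundaries R I M E i.
Proof.
move=> yk e /andP[eT /eqP de].
have [f [g [h [b [Fker Gker Gbnd gfE bP]]]]] := comparison i.
have fe : f e \in @lc_cycles R I M E' i.
  by rewrite inE torsion_linear //=; apply/eqP/Fker.
have -> : y *: e = g (y *: f e) - y *: b e.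
  have := gfE e; rewrite de linear0 addr0 => <-.
  by rewrite linearZ /= -scalerBr subKr.
have sB := lc_boundaries_sub E i.
apply: subB => //; first by apply: Gbnd; apply: yk.
by apply: submodZ => //; apply: (bP e).2.
Qed.

End Comparison.

Section AssociatedGraded.
Variables (A : idomainType) (m : {pred A}) (I : idealr A) (dim : nat).
Hypothesis pm : is_prime m.
Hypothesis hm : forall J, is_ideal J -> 1 \notin J -> {subset J <= m}.
Hypothesis Im : {subset (I : {pred A}) <= m}.
Hypothesis I0 : exists2 b, b \in I & b != 0.
Hypothesis nR : noetherian (rees I).
Hypothesis dim_gt0 : (0 < dim)%N.
Hypothesis hgr : gr_generalized_CM I dim.

Local Notation R := (rees I).
Local Notation rr n := (ratliff_rush (ideal_pow I n)).
Local Notation v := (@fil_rees_val A (adic_filtration I)).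
Let sI : is_ideal (I : {pred A}) := idealr_is_ideal I.

Lemma gr_proj_zmod : zmod_morphism (@gr_proj A I).
Proof. by move=> x y; rewrite /gr_proj rmorphB. Qed.

Lemma gr_proj_monoid : monoid_morphism (@gr_proj A I).
Proof. by split=> [|x y]; rewrite /gr_proj ?rmorph1 ?rmorphM. Qed.

Definition grm : {rmorphism R -> gr I} := HB.pack (@gr_proj A I)
  (GRing.isZmodMorphism.Build R (gr I) (@gr_proj A I) gr_proj_zmod)
  (GRing.isMonoidMorphism.Build R (gr I) (@gr_proj A I) gr_proj_monoid).

Lemma grm_surj z : exists r, grm r = z.
Proof. by elim/quotW: z => r; exists r. Qed.

Lemma grm_eq0 r : (grm r = 0) <-> (forall k, (v r)`_k \in ideal_pow I k.+1).
Proof.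
have -> : (0 : gr I) = grm 0 by rewrite rmorph0.
split=> [/eqP|rk].
  by rewrite -[grm r == _]Quotient.idealrBE subr0 => /asboolP.
apply/eqP; rewrite -[grm r == _]Quotient.idealrBE subr0; exact/asboolP.
Qed.

Lemma gr_noetherian : noetherian (gr I).
Proof. exact: noetherian_image nR grm_surj. Qed.

Definition gr_max : {pred gr I} :=
  [pred z | `[< exists2 r, r \in @irrelevant A m I & z = grm r >] ].

Lemma gr_maxE r : (grm r \in gr_max) = (r \in @irrelevant A m I).
Proof.
apply/idP/idP => [/asboolP[s sM e]|rM]; last by apply/asboolP; exists r.
have : grm (r - s) = 0 by rewrite rmorphB e subrr.
move/grm_eq0 => /(_ 0%N); rewrite coefB => rs; rewrite inE.
have : (v r)`_0 - (v s)`_0 \in m by apply: Im; apply: ideal_pow_sub rs.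
by rewrite (idealBK _ (prime_sub pm)).
Qed.

Lemma gr_max_prime : is_prime gr_max.
Proof.
have [sM M1 MM] := irrelevant_prime I pm; split.
- split=> [|a x y].
    by have -> : 0 = grm 0; [rewrite rmorph0 | rewrite gr_maxE ideal0].
  have [[r <-] [[s <-] [t <-]]] := (grm_surj a, (grm_surj x, grm_surj y)).
  rewrite !gr_maxE => sm tm; rewrite -[_ *: _]/(grm r * grm s).
  by rewrite -rmorphM -rmorphD gr_maxE; apply: sM.2.
- by have -> : 1 = grm 1; [rewrite rmorph1 | rewrite gr_maxE].
move=> x y; have [[r <-] [s <-]] := (grm_surj x, grm_surj y).
by rewrite -rmorphM !gr_maxE => /MM.
Qed.

Lemma gr_plus_max : {subset @gr_plus A I <= gr_max}.
Proof.
move=> z /asboolP[r r0 ->]; rewrite -[gr_proj r]/(grm r) gr_maxE inE r0.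
exact/ideal0/prime_sub.
Qed.

Lemma gr_lc_killed : exists (E : injective_resolution ((gr I)^o : lmodType (gr I))) c,
  forall i y e, (i < dim)%N -> y \in ideal_pow (@gr_plus A I) c ->
    e \in @lc_cycles (gr I) (@gr_plus A I) (gr I)^o E i ->
    y *: e \in @lc_boundaries (gr I) (@gr_plus A I) (gr I)^o E i.
Proof.
have [E _] := hgr dim_gt0; exists E.
have [c cP] : exists c : nat -> nat, forall i, (i < dim)%N ->
    forall y e, y \in ideal_pow (@gr_plus A I) (c i) ->
    e \in @lc_cycles (gr I) (@gr_plus A I) (gr I)^o E i ->
    y *: e \in @lc_boundaries (gr I) (@gr_plus A I) (gr I)^o E i.
  suff /choice[c cP] i : exists c, (i < dim)%N -> forall y e,
      y \in ideal_pow (@gr_plus A I) c ->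
      e \in @lc_cycles (gr I) (@gr_plus A I) (gr I)^o E i ->
      y *: e \in @lc_boundaries (gr I) (@gr_plus A I) (gr I)^o E i by exists c.
  case: (ltnP i dim) => [idim|]; last by exists 0%N.
  have [E' fl] := hgr idim; have [|c cP] := @finite_length_torsion _ _ (@gr_plus A I) _ _ fl.
    by move=> e /andP[].
  exists c => _ y e yI; apply: lc_killed_transfer => e' e'Z; exact: cP.
exists (\max_(i < dim) c i) => i y e idim yI; apply: cP => //.
apply: ideal_pow_leq yI; exact: (leq_bigmax (Ordinal idim)).
Qed.

(** The last prime omits an element of [gr_plus], so its preimage is strictly below [irrelevant],
    which provides the additional step. *)
Lemma punctured_pull n q : up_ge (punctured (@gr_plus A I) gr_max) n q ->
  up_ge (rees_prime m (I := I)) n.+1 [pred r | grm r \in q].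
Proof.
elim: n q => [|n IHn] q.
  case=> -[pq qM [z /asboolP[r r0 ->] zq]] _; split.
    split; first exact: (preim_prime grm).
    by move=> s; rewrite inE => /qM; rewrite gr_maxE.
  exists (@irrelevant A m I).
    by split=> //; split=> //; apply: irrelevant_prime.
  split=> [s|]; first by rewrite inE => /qM; rewrite gr_maxE.
  by exists r; rewrite // inE r0; apply/ideal0/prime_sub.
case=> -[pq qM _] [q' /IHn uq' [qq' [z zq' zq]]]; split.
  split; first exact: (preim_prime grm).
  by move=> s; rewrite inE => /qM; rewrite gr_maxE.
exists ([pred r | grm r \in q'] : {pred R}) => //; split=> [s|].
  by rewrite !inE => /qq'.
by have [r rz] := grm_surj z; exists r; rewrite inE rz.
Qed.

(** As [b t] is outside [P], multiplying [y t^n / a] by [(b t)^(l + 1)] leaves its annihilator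
    unchanged. As [b] is in [P], [b y = a w], and the product is [u t^(n + l + 1)] with [u = b^l w].
    For [l >= N] the closures involved are powers of [I], so [u] is in [I^(n + l)] and [P] is the
    preimage of the annihilator of the class [W] of [u t^(n + l)] in [G(I)]. *)
Theorem gr_punctured_chains : punctured_chains m (I : {pred A}) dim.
Proof.
move=> P a y n b pP a0 yr PE IP bI bP.
have sP := prime_sub pP.
have bI1 : b \in ideal_pow I 1 by apply: ideal_pow1.
have bX k : b ^+ k \in ideal_pow I k by apply: expr_ideal_pow.
have bPX k r : homR I k (b ^+ k) * r \in P -> r \in P.
  have -> : homR I k (b ^+ k) = homR I 1 b ^+ k by rewrite homRX // mul1n.
  by rewrite primeM // => /orP[/(primeX pP)|//]; rewrite (negbTE bP).
have homP k c : c \in ideal_pow I k -> (homR I k c \in P) <->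
    exists2 z, z \in rr (n + k)%N & c * y = a * z.
  by move=> cI; rewrite PE; apply: hcolon_hom.
have compP r : r \in P <-> forall k, homR I k (v r)`_k \in P.
  split=> [|rk]; last exact: mem_homR.
  by rewrite PE => /hcolonP rP k; apply/(homP k); [exact: coefR | exact: rP].
have [N NP] := ratliff_rush_stable nR I0.
pose l := maxn N n.
have ln : (n <= l)%N by rewrite leq_maxr.
have bconst : constR I b \in P by apply: IP.
have [w wr byw] : exists2 w, w \in rr n & b * y = a * w.
  by move: bconst; rewrite -homR0 => /(homP 0%N b (ideal_pow0 I b)); rewrite addn0.
pose u := b ^+ l * w.
have uI : u \in ideal_pow I (n + l).
  rewrite addnC; apply: NP; last by apply: rrMpow.
  by apply: leq_trans (leq_addr _ _); rewrite leq_maxl.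
have keyP k c : c \in ideal_pow I k -> (homR I k c \in P) <-> c * u \in ideal_pow I (n + l + k).+1.
  move=> cI; split=> [/(homP k c cI)[z zr cz]|cu].
    have -> : c * u = b ^+ l.+1 * z.
      apply: (mulfI a0); rewrite /u mulrCA [a * (_ * w)]mulrCA -byw.
      by rewrite exprS mulrCA [RHS]mulrCA -cz; ring.
    apply: NP; last first.
      have -> : (n + l + k).+1 = (l.+1 + (n + k))%N by rewrite addSn addnA [(n + l)%N]addnC.
      exact: rrMpow.
    by rewrite (leq_trans (leq_maxl N n)) // ltnW // ltnS addnAC leq_addl.
  have e : homR I l.+1 (b ^+ l.+1) * homR I k c \in P.
    rewrite homRM //; apply/homP; first exact: ideal_powM.
    exists (c * u); last by rewrite /u exprS -!mulrA [c * y]mulrC; rewrite mulrCA [a * _]mulrCA; rewrite [b * (y * c)]mulrA byw; ring.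
    apply: ideal_pow_ratliff_rush.
    by have -> : (n + (l.+1 + k) = (n + l + k).+1)%N by rewrite addSn addnS addnA.
  exact: bPX e.
pose W := grm (homR I (n + l) u).
have WP r : (grm r * W == 0) = (r \in P).
  apply/eqP/idP => [|rP]; rewrite -rmorphM.
    move/grm_eq0 => rW; apply/compP => k; apply/keyP; first exact: coefR.
    by have := rW (n + l + k)%N; rewrite /= mulrC coef_homR // mulrC.
  apply/grm_eq0 => k; rewrite /= mulrC; case: (ltnP k (n + l)) => [kn|/subnKC <-].
    by rewrite -[(homR _ _ _ : {poly A})]/(v _) homRE // -mulrA coefCM coefXnM kn mulr0; apply/ideal0/pow_sub.
  rewrite coef_homR // mulrC; apply/keyP; first exact: coefR.
  by move/compP: rP; apply.
pose p := icolon (pred1 0) W.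
have pE r : (grm r \in p) = (r \in P) by rewrite icolonE inE WP.
have pp : is_prime p.
  split.
  - apply: icolon_ideal; split=> [|c x x' /eqP-> /eqP->]; first exact: eqxx.
    by rewrite scaler0 addr0; apply: eqxx.
  - by have -> : 1 = grm 1; [rewrite rmorph1 | rewrite pE prime_not1].
  move=> x x'; have [[r <-] [s <-]] := (grm_surj x, grm_surj x').
  by rewrite -rmorphM !pE primeM.
have PM : {subset P <= @irrelevant A m I}.
  move=> r /compP /(_ 0%N); rewrite homR0 inE => r0P.
  have pc := preim_prime (constR I) pP.
  by apply: (prime_local hm pc); rewrite inE.
have Tp : punctured (@gr_plus A I) gr_max p.
  split=> // [z|].
    by have [r <-] := grm_surj z; rewrite pE gr_maxE => /PM.
  exists (grm (homR I 1 b)); last by rewrite pE.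
  apply/asboolP; exists (homR I 1 b) => //.
  by rewrite -[(homR I 1 b : {poly A})]/(v _) homRE // coefMX.
have [E [c lc]] := gr_lc_killed.
have := associated_chain gr_noetherian lc gr_max_prime gr_plus_max Tp dim_gt0.
move/punctured_pull; rewrite prednK //.
have /eq_pred -> : [pred r | grm r \in p] =i P by move=> r; rewrite inE pE.
by [].
Qed.

End AssociatedGraded.

(** Read modulo [q], a monic equation of [x] loses its constant term as long as that term is in [q],
    and [x] can be divided out. The first constant term outside [q] lies in [q'], since [x] does. *)
Lemma incomparable (R S : comNzRingType) (f : {rmorphism R -> S}) (q q' : {pred S}) :
  (forall x, integralOver f x) -> is_prime q -> is_prime q' -> psub q q' ->
  psub [pred x | f x \in q] [pred x | f x \in q'].
Proof.
move=> fint pq pq' [qq' [x xq' xq]]; split=> [y|]; first by rewrite !inE => /qq'.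
have [p pmon /rootP px] := fint x; have [sq sq'] := (prime_sub pq, prime_sub pq').
have {px} : (map_poly f p).[x] \in q by rewrite px ideal0.
elim/poly_ind: p pmon => [|p c IHp].
  by rewrite monicE lead_coef0 eq_sym oner_eq0.
rewrite rmorphD rmorphM /= map_polyX map_polyC hornerMXaddC /=.
case: (eqVneq p 0) => [->|p0] pmon.
  move: pmon; rewrite mul0r add0r monicE lead_coefC => /eqP->.
  by rewrite rmorph0 horner0 mul0r add0r rmorph1 (negbTE (prime_not1 pq)).
move=> px; case: (boolP (f c \in q)) => cq; last first.
  have pxq' := idealM (map_poly f p).[x] sq' xq'.
  by exists c; rewrite ?inE // -(idealDl _ sq' pxq') qq'.
apply: IHp; last by move: px; rewrite addrC (idealDl _ sq cq) primeM // (negbTE xq) orbF.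
move: pmon; rewrite !monicE lead_coefDl ?lead_coefMX // size_mulX //.
by rewrite ltnS (leq_trans (size_polyC_leq1 _)) // size_poly_gt0.
Qed.

Section Swap.
Variables (R : comNzRingType) (H : {pred R}) (e f x r : R).
Hypothesis sH : is_ideal H.
Lemma ideal_mul_swapl : e * (x * r) \in H -> x * (e * f * r) \in H.
Proof.
have -> : x * (e * f * r) = f * (e * (x * r)) by ring.
exact: idealM.
Qed.
Lemma ideal_mul_swapr : x * (f * r) \in H -> x * (e * f * r) \in H.
Proof.
have -> : x * (e * f * r) = e * (x * (f * r)) by ring.
exact: idealM.
Qed.
End Swap.

(** * Veronese subrings *)

Section Veronese.
Variables (A : idomainType) (m I : {pred A}) (dim n : nat).
Hypothesis nR : noetherian (rees I).
Hypothesis n0 : (0 < n)%N.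
Hypothesis hchains : punctured_chains m I dim.

Local Notation In := (ideal_pow I n).
Local Notation R := (rees I).
Local Notation R' := (rees In).
Local Notation rr k := (ratliff_rush (ideal_pow I k)).
Local Notation v := (@fil_rees_val A (adic_filtration I)).
Local Notation v' := (@fil_rees_val A (adic_filtration In)).

Lemma pow_powE k : ideal_pow In k = ideal_pow I (n * k).
Proof. by apply: eq_pred => x; apply: ideal_powX. Qed.

Lemma coef_comp_Xn (p : {poly A}) i :
  (p \Po 'X^n)`_i = if (n %| i)%N then p`_(i %/ n) else 0.
Proof.
elim/poly_ind: p i => [|p c IHp] i; first by rewrite comp_poly0 !coef0 if_same.
rewrite comp_poly_MXaddC coefD coefMXn coefC; case: (ltnP i n) => ni.
  rewrite add0r; case: eqP => [->|/eqP i0].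
    by rewrite dvdn0 div0n coefD coefMX coefC /= add0r.
  by rewrite gtnNdvd // lt0n.
rewrite IHp; have -> : (i == 0%N) = false by apply: gtn_eqF; apply: leq_trans ni.
rewrite addr0 -(subnKC ni); set j := (i - n)%N.
rewrite addKn dvdn_addr // divnDl // divnn n0 add1n.
by case: ifP => // _; rewrite coefD coefMX coefC /= addr0.
Qed.

Lemma veronese_subproof (r : R') : v' r \Po 'X^n \in fil_pred (adic_filtration I).
Proof.
apply/fil_predP => i; rewrite coef_comp_Xn; case: ifP => [/divnK {2}<-|_].
  by rewrite mulnC /= -pow_powE; apply: coefR.
exact/ideal0/pow_sub.
Qed.

Definition veronese (r : R') : R := FilRees (veronese_subproof r).

Lemma veronese_zmod : zmod_morphism veronese.
Proof. by move=> x y; apply: val_inj; rewrite /= rmorphB. Qed.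

Lemma veronese_monoid : monoid_morphism veronese.
Proof. by split=> [|x y]; apply: val_inj; rewrite /= ?rmorph1 ?rmorphM. Qed.

HB.instance Definition _ := GRing.isZmodMorphism.Build R' R veronese veronese_zmod.
HB.instance Definition _ := GRing.isMonoidMorphism.Build R' R veronese veronese_monoid.

Lemma veronese_hom k c : c \in ideal_pow In k -> veronese (homR In k c) = homR I (n * k) c.
Proof.
move=> cI; apply: val_inj; rewrite /= !homRE -?pow_powE //.
by rewrite comp_polyM comp_polyC comp_Xn_poly -exprM.
Qed.

Lemma veronese_integral (r : R) : integralOver veronese r.
Proof.
have hom k c : c \in ideal_pow I k -> integralOver veronese (homR I k c).
  move=> cI; have cn : c ^+ n \in ideal_pow In k.
    by rewrite pow_powE mulnC -ideal_powX; apply: expr_ideal_pow.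
  exists ('X^n - (homR In k (c ^+ n))%:P); first exact: monicXnsubC.
  apply/rootP; rewrite rmorphB /= map_polyXn map_polyC hornerD hornerN hornerXn hornerC /=.
  by rewrite veronese_hom // homRX // mulnC subrr.
rewrite [r]rees_sum; elim/big_ind: _ => [|x y xi yi|k _].
- exact: (integral0 veronese).
- exact: (integral_add (RtoK := veronese)).
by apply: hom; apply: coefR.
Qed.

Lemma amul_hcolon (J : {pred A}) (a y : A) N (r : rees J) :
  r \in hcolon a y N <-> forall k, (fil_rees_val r)`_k * y \in amul J a (N + k).
Proof.
split=> [/hcolonP rP k|rP]; first by apply/asboolP; apply: rP.
by apply/hcolonP => k; have /asboolP := rP k.
Qed.

Lemma hcolon_ideal (J : {pred A}) (a y : A) N : is_ideal (@hcolon A J a y N).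
Proof.
split=> [|c r s /amul_hcolon rP /amul_hcolon sP]; apply/amul_hcolon => k.
  by rewrite coef0 mul0r; apply/ideal0/amul_ideal.
rewrite coefD mulrDl; apply: (idealD (amul_ideal _ _ _)) => //.
rewrite coefM mulr_suml; apply: (ideal_sum _ (amul_ideal _ _ _)) => j _.
rewrite -mulrA; have -> : (N + k = j + (N + (k - j)))%N.
  by rewrite addnCA subnKC // -ltnS.
by apply: amulM; [exact: coefR | exact: rP].
Qed.

Lemma veronese_hcolon a y k r : (veronese r \in hcolon a y (n * k)) <-> (r \in hcolon a y k).
Proof.
have amulE j : amul In a j = amul I a (n * j) by rewrite /amul pow_powE.
split=> /amul_hcolon rP; apply/amul_hcolon => j.
  have := rP (n * j)%N; rewrite -mulnDr -amulE.
  by have -> : (fil_rees_val (veronese r))`_(n * j) = (v' r)`_j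
    by rewrite coef_comp_Xn dvdn_mulr // mulKn.
have := coef_comp_Xn (v' r) j; case: ifP => [/dvdnP[i ->] ->|_ ->].
  by have := rP i; rewrite amulE mulnDr [(n * i)%N]mulnC (mulnK i n0).
by rewrite mul0r; apply/ideal0/amul_ideal.
Qed.

Lemma rees_prime_pull k q : {subset (I : {pred A}) <= m} ->
  up_ge (rees_prime m (I := I)) k q -> 
  up_ge (rees_prime m (I := In)) k [pred r | veronese r \in q].
Proof.
move=> Im; have pull q' : rees_prime m q' ->
    rees_prime m (I := In) ([pred r | veronese r \in q'] : {pred R'}).
  case=> pq qM; split; first exact: (preim_prime veronese).
  by move=> r; rewrite inE => /qM; rewrite !inE /= coef_comp_Xn dvdn0 div0n.
elim: k q => [|k IHk] q; first by case=> /pull pq _; split.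
case=> Tq [q' uq' qq']; split; first exact: pull.
exists ([pred r | veronese r \in q'] : {pred R'}); first exact: IHk.
have pq' : is_prime q' by case: (k) uq' => [|?] [[]].
by apply: incomparable => //; [exact: veronese_integral | case: Tq].
Qed.

Hypothesis Im : {subset I <= m}.

(** [P] is the contraction of [H = hcolon a y (n * k)], which need not be prime in [A[It]].
    Saturating [H] by some [b t] with [b^n t] outside [P] keeps it proper, and an associated prime
    [q] of the saturation contracts to a prime containing [P]. A chain above [q] contracts to one
    whose first member may be replaced by [P]. *)
Theorem veronese_punctured_chains : punctured_chains m In dim.
Proof.
move=> P a y k b' pP a0 yr PE IP b'I b'P; have sP := prime_sub pP.
have In1 c : c \in In -> c \in ideal_pow In 1 by apply: ideal_pow1.
(* If all [b^n t] were in [P], so would be the [n]-th power of each [c_1 ... c_n t], which is the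
   product of the [c_i^n t]; then [P] would contain [I^n t]. *)
have [b bI bP] : exists2 b, b \in I & homR In 1 (b ^+ n) \notin P.
  apply: contrapT => nb; case/negP: b'P.
  have bP b : b \in I -> homR In 1 (b ^+ n) \in P.
    by move=> bI; apply: contrapT => /negP bP; apply: nb; exists b.
  suff bN : {subset In <= [pred c | (c \in In) && (homR In 1 c \in P)]}.
    by have /andP[] := bN b' b'I.
  apply: (@ideal_pow_ind A I n) => [|s sn sI].
    split=> [|c x z /andP[xI xP] /andP[zI zP]]; apply/andP; split.
    - exact/ideal0/pow_sub.
    - have -> : homR In 1 0 = 0; last exact: ideal0.
      by apply: val_inj; rewrite /= homRE ?mul0r //; apply/ideal0/pow_sub.
    - exact: (pow_sub I n).2.
    have -> : homR In 1 (c *: (x : A^o) + z) = constR In c * homR In 1 x + homR In 1 z.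
      apply: val_inj; rewrite /= !homRE ?In1 //.
        by rewrite polyCD polyCM mulrDl mulrA.
      exact: (pow_sub I n).2.
    by apply: idealD => //; apply: idealM.
  have sIn : \prod_(c <- s) c \in In by rewrite -sn; apply: prod_ideal_pow.
  apply/andP; split=> //; apply: (primeX (n := n) pP); rewrite homRX ?In1 // mul1n.
  have hprod (t : seq A) : {subset t <= I} ->
      homR In (size t) ((\prod_(c <- t) c) ^+ n) = \prod_(c <- t) homR In 1 (c ^+ n).
    elim: t => [|c t IHt] tI; first by rewrite !big_nil expr1n homR0 rmorph1.
    have cI : c ^+ n \in ideal_pow In 1.
      by apply: In1; apply: expr_ideal_pow; rewrite tI ?mem_head.
    have tI' : {subset t <= I} by move=> x xt; rewrite tI // inE xt orbT.
    rewrite !big_cons -IHt // exprMn homRM ?add1n //.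
    by rewrite pow_powE mulnC -ideal_powX; apply/expr_ideal_pow/prod_ideal_pow.
  have := hprod s sI; rewrite sn => ->.
  have : exists2 c, c \in s & c \in I.
    by case: (s) sn sI => [|c t] sn sI; [move: n0; rewrite -sn | exists c; rewrite ?sI ?mem_head].
  case=> c cs cI; rewrite (big_rem c) //=; apply: idealrM => //; exact: bP.
have sH := hcolon_ideal I a y (n * k).
have bI1 : b \in ideal_pow I 1 by apply: ideal_pow1.
have bXP j : homR In 1 (b ^+ n) ^+ j \notin P by apply: contra bP; apply: primeX.
have bnI : b ^+ n \in ideal_pow In 1 by apply/In1/expr_ideal_pow.
pose H : {pred R} := hcolon a y (n * k).
pose Sat : {pred R} := [pred x | `[< exists j, homR I 1 b ^+ j * x \in H >] ].
have sSat : is_ideal Sat.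
  split=> [|c x z /asboolP[i xi] /asboolP[j zj]]; apply/asboolP.
    by exists 0%N; rewrite mulr0 ideal0.
  exists (i + j)%N; rewrite exprD mulrDr; move: xi zj.
  move: (homR I 1 b ^+ i) (homR I 1 b ^+ j) => e f ex fz.
  have -> : e * f * (c *: (x : R^o)) = (f * c) * (e * x).
    by rewrite [e * f]mulrC -mulrACA.
  rewrite -[e * f * z]mulrA.
  apply: (idealD sH); [exact: (idealM _ sH ex) | exact: (idealM _ sH fz)].
have HSat : {subset H <= Sat}.
  by move=> x xH; apply/asboolP; exists 0%N; rewrite expr0 mul1r.
have Sat1 : 1 \notin Sat.
  apply/asboolP => -[j]; rewrite mulr1 => bj.
  have : veronese (homR In 1 (b ^+ n) ^+ j) \in H.
    rewrite rmorphXn /= veronese_hom // muln1.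
    have -> : homR I n (b ^+ n) = homR I 1 b ^+ n by rewrite homRX // mul1n.
    by rewrite exprAC -[in X in _ ^+ X](prednK n0) exprS; apply: idealrM.
  by move/veronese_hcolon; rewrite -PE (negbTE (bXP j)).
have [r [rSat]] := icolon_above nR sSat Sat1; rewrite mulr1 in rSat *.
set q := icolon Sat r => pq; have sq := prime_sub pq.
have Satq : {subset Sat <= q}.
  by move=> x xS; rewrite icolonE mulrC; apply: idealM.
have bq : homR I 1 b \notin q.
  apply: contra rSat; rewrite icolonE => /asboolP[j bj]; apply/asboolP.
  by exists j.+1; rewrite exprSr -mulrA.
have PHq s : s \in P -> veronese s \in q.
  by rewrite PE => sP'; apply/Satq/HSat/(veronese_hcolon a y k s).2.
have Iq c : c \in I -> constR I c \in q.
  move=> cI; have cn : c ^+ n \in In by apply: expr_ideal_pow.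
  have := PHq _ (IP _ cn).
  have -> : veronese (constR In (c ^+ n)) = constR I c ^+ n.
    rewrite -rmorphXn; apply: val_inj; rewrite /= comp_polyC //.
  exact: primeX.
have sHr j : is_ideal (icolon H (homR I 1 b ^+ j * r)) by apply: icolon_ideal.
(* One exponent [J] serves for finitely many generators of [q]. So [q] is the colon of [H] itself by
   [w], an annihilator to which [single_component] applies. *)
have [J qJ] : exists J, {subset q <= icolon H (homR I 1 b ^+ J * r)}.
  have [s sE] := nR sq.
  have [J sJ] : exists J, {subset s <= icolon H (homR I 1 b ^+ J * r)}.
    have : {subset s <= q} by move=> x xs; rewrite sE; apply: mem_span.
    elim: (s) => [|x t IHt] tq; first by exists 0%N.
    have [|J tJ] := IHt; first by move=> z zt; rewrite tq // inE zt orbT.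
    have : x \in q by rewrite tq ?mem_head.
    rewrite icolonE => /asboolP[i xi]; exists (i + J)%N => z.
    rewrite inE exprD icolonE => /orP[/eqP->|/tJ].
      exact: ideal_mul_swapl sH xi.
    rewrite icolonE => zJ; exact: ideal_mul_swapr sH zJ.
  exists J => x; rewrite sE; apply: span_min => //; exact: sHr.
pose w := homR I 1 b ^+ J * r.
pose s : {poly A} := v w * (y%:P * 'X^(n * k)).
have ryI : y \in rr (n * k) by move: yr; rewrite pow_powE.
have wq x : (x \in q) = (x * w \in H).
  apply/idP/idP => [/qJ //|xw].
  by rewrite icolonE; apply/asboolP; exists J; rewrite mulrCA.
have qE x : x \in q <-> forall i, (v x * s)`_i \in amul I a i.
  have vxs : v x * s = v (x * w) * (y%:P * 'X^(n * k)) by rewrite /s mulrA.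
  rewrite wq amul_hcolon vxs; split=> xP i.
    rewrite mulrA coefMXn; case: ltnP => [_|/subnKC {2}<-].
      exact/ideal0/amul_ideal.
    by rewrite coefMC.
  by have := xP (n * k + i)%N; rewrite mulrA coefMXn ltnNge leq_addr /= addKn coefMC.
have [N qN] := single_component pq qE.
have srr : s`_N \in rr N.
  rewrite /s mulrA coefMXn; case: ltnP => [_|/subnKC {2}<-].
    exact/ideal0/rr_sub.
  by rewrite coefMC addnC; apply: rrMpow => //; apply: coefR.
have := rees_prime_pull Im (hchains pq a0 srr qN Iq bI bq).
have PQ : {subset P <= [pred r | veronese r \in q]} by move=> x /PHq.
have PM : rees_prime m (I := In) ([pred r | veronese r \in q] : {pred R'}) -> rees_prime m P.
  by case=> _ qM; split=> // x /PQ /qM.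
case: (dim) => [|d'] /=; first by case=> /PM.
by case=> /PM TP [Q uQ qQ]; split=> //; exists Q => //; apply: psub_subl qQ.
Qed.

End Veronese.

(** * Serre's condition and the S2-ification *)

Section Localization.
Variables (R : comNzRingType) (P : prime_idealr R).

Definition frac (r : R) : loc_ring P := @mkfrac R P R^o r 1 (notin1 P).

Lemma scale_mkfrac (V : lmodType R) (r s t : R) (v : V) (sP : s \notin P) (tP : t \notin P) :
  (@mkfrac R P R^o r s sP : loc_ring P) *: mkfrac v tP =
  mkfrac (r *: v) (notinM sP tP).
Proof. exact: loc_scaleE. Qed.

Lemma add_mkfrac (V : lmodType R) (v w : V) (s t : R) (sP : s \notin P) (tP : t \notin P) :
  mkfrac v sP + mkfrac w tP =  mkfrac (t *: v + s *: w) (notinM sP tP).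
Proof. exact: loc_addE. Qed.

Lemma frac_zmod : zmod_morphism frac.
Proof.
move=> x y; rewrite -[RHS]/(loc_add _ (loc_opp _)) loc_oppE loc_addE.
by apply/eq_mkfrac; exists 1; rewrite ?notin1 // !mulr1 !scale1r.
Qed.

Lemma frac_monoid : monoid_morphism frac.
Proof.
split=> // x y; rewrite -[RHS]/(loc_scale _ _) loc_scaleE.
by apply/eq_mkfrac; exists 1; rewrite ?notin1 // !mulr1 !scale1r.
Qed.

HB.instance Definition _ := GRing.isZmodMorphism.Build R (loc_ring P) frac frac_zmod.
HB.instance Definition _ := GRing.isMonoidMorphism.Build R (loc_ring P) frac frac_monoid.

Lemma mkfrac_mul (x s : R) (sP : s \notin P) :
  (@mkfrac R P R^o x s sP : loc_ring P) = (@mkfrac R P R^o 1 s sP : loc_ring P) * frac x.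
Proof.
rewrite -[RHS]/(loc_scale _ _) loc_scaleE; apply/eq_mkfrac.
by exists 1; rewrite ?notin1 // /GRing.scale /=; ring.
Qed.

Lemma mkfrac_frac (x s : R) (sP : s \notin P) :
  frac x = frac s * (@mkfrac R P R^o x s sP : loc_ring P).
Proof.
rewrite -[RHS]/(loc_scale _ _) loc_scaleE; apply/eq_mkfrac.
by exists 1; rewrite ?notin1 // /GRing.scale /=; ring.
Qed.

Lemma loc_prime_sub (q : {pred loc_ring P}) : is_prime q ->
  {subset [pred r | frac r \in q] <= P}.
Proof.
move=> pq r rq; apply: contraT => rP; case/negP: (prime_not1 pq).
have <- : (@mkfrac R P R^o 1 r rP : loc_ring P) * frac r = 1.
  rewrite mulrC -mkfrac_frac; exact: rmorph1.
by apply: idealM => //; apply: prime_sub.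
Qed.

Lemma loc_ht k (q : {pred loc_ring P}) : ht_ge k q -> ht_ge k [pred r | frac r \in q].
Proof.
elim: k q => [|k IHk] q; first by case=> pq _; split=> //; apply: (preim_prime frac pq).
case=> pq [q' hq' [q'q [z zq zq']]]; split; first exact: (preim_prime frac pq).
exists ([pred r | frac r \in q'] : {pred R}); first exact: IHk.
have pq' : is_prime q' by case: (k) hq' => [|?] [].
split=> [r /q'q //|]; move: z zq zq'; elim/locW => x s sP xq xq'; exists x.
  suff : frac x \in q by [].
  by rewrite (mkfrac_frac x sP); apply: idealM => //; apply: prime_sub.
apply: contra xq' => xq'; rewrite mkfrac_mul; apply: idealM => //; exact: prime_sub.
Qed.

(** Chains in the local ring contract to primes inside [P]. The zero module would be annihilated by
    1, which lies in no prime. *)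
Lemma loc_ht_ge (V : lmodType R) k : mod_dim_ge (loc P V) k ->
  ht_ge k (P : {pred R}) /\ exists v : V, v != 0.
Proof.
case=> Q QC aQ; split.
  have htQ := loc_ht (prime_chain_ht QC).
  apply: ht_ge_sub htQ; last exact: prime_idealr_is_prime.
  exact/loc_prime_sub/prime_idealr_is_prime.
apply: contrapT => nv; have : (1 : loc_ring P) \in Q 0%N.
  apply: aQ; apply/asboolP; elim/locW => v s sP; rewrite scale1r.
  apply/eq_mkfrac; exists 1; rewrite ?notin1 //.
  have -> : v = 0 by apply: contrapT => /eqP v0; apply: nv; exists v.
  by rewrite !scaler0.
by rewrite idealr1.
Qed.

End Localization.

Section Serre.
Variables (R : idomainType) (V : lmodType R).
Hypothesis nR : noetherian R.
Hypothesis nV : noetherian_module V.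
Hypothesis tf : forall r (v : V), r *: v = 0 -> r = 0 \/ v = 0.
Hypothesis nass : forall (p : {pred R}) x (w : V), is_prime p -> x \in p -> x != 0 ->
  (forall r, r \in p <-> exists u, r *: w = x *: u) -> ~ ht_ge 2 p.
Variable P : prime_idealr R.

Let pP : is_prime P := prime_idealr_is_prime P.
Let sP : is_ideal P := prime_sub pP.

(** The preimage in [V] of [x V_P]. *)
Definition loc_mult (x : R) : {pred V} :=
  [pred v | `[< exists2 u, u \notin P & exists w, u *: v = x *: w >] ].

Lemma loc_mult_sub x : submod_closed (loc_mult x).
Proof.
split=> [|a v w /asboolP[u uP [v' uv]] /asboolP[u' uP' [w' uw]]]; apply/asboolP.
  by exists 1; rewrite ?notin1 //; exists 0; rewrite !scaler0.
exists (u * u'); first exact: notinM.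
exists (u' * a *: v' + u *: w').
have swap (a1 b : R) (z : V) : a1 *: (b *: z) = b *: (a1 *: z) by rewrite !scalerA mulrC.
rewrite !scalerDr; congr (_ + _).
  by rewrite [RHS]swap -uv !scalerA; congr (_ *: _); ring.
by rewrite [RHS]swap -uw scalerA.
Qed.

Lemma frac_max x : x \in P -> frac P x \in loc_max P.
Proof. by move=> xP; apply/asboolP; exists x, 1, (notin1 P). Qed.

Lemma ideal_smul0 (M : lmodType (loc_ring P)) (z : M) : z \in @ideal_smul _ M [::] -> z = 0.
Proof.
move=> /span_min zs; apply/eqP; apply: (zs (pred1 0)); last first.
  by move=> v /asboolP[].
by split=> [|a u v /eqP-> /eqP->]; rewrite ?inE ?eqxx // scaler0 addr0.
Qed.

Lemma ideal_smul1 (M : lmodType (loc_ring P)) (a : loc_ring P) (z : M) :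
  z \in @ideal_smul _ M [:: a] -> exists w, z = a *: w.
Proof.
move=> /span_min zs; apply/asboolP.
apply: (zs [pred z | `[< exists w, z = a *: w >] ]).
  split=> [|b u v /asboolP[u' ->] /asboolP[v' ->]]; apply/asboolP.
    by exists 0; rewrite scaler0.
  by exists (b *: u' + v'); rewrite scalerDr !scalerA mulrC.
by move=> v /asboolP[x]; rewrite inE => /eqP-> [w ->]; apply/asboolP; exists w.
Qed.

(** Otherwise [V_P = P V_P], and Nakayama's lemma gives [w] outside [P] that kills the torsion-free
    module [V]. *)
Lemma loc_nontrivial (xs : seq (loc_ring P)) (v0 : V) : v0 != 0 ->
  {subset xs <= loc_max P} -> exists v : loc P V, v \notin @ideal_smul _ (loc P V) xs.
Proof.
move=> v00 xsP; apply: contrapT => nv.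
have all (z : loc P V) : z \in @ideal_smul _ (loc P V) xs.
  by apply: contrapT => /negP zn; apply: nv; exists z.
pose PV : {pred V} := span [pred w | `[< (w \in pred1 0) \/
        exists2 q, q \in (P : {pred R}) & exists2 v' : V, v' \in predT & w = q *: v' >] ].
have sPV : submod_closed PV by apply: span_sub.
have zPV (z : loc P V) : exists v s (sP : s \notin P), v \in PV /\ z = mkfrac v sP.
  apply/asboolP; move: z (all z).
  apply: (@span_min _ _ _ [pred z : loc P V | `[< exists v s (sP : s \notin P), v \in PV /\ z = mkfrac v sP >] ]).
    split=> [|a u v /asboolP[u' [s [us [uPV ->]]]] /asboolP[v' [t [vt [vPV ->]]]]]; apply/asboolP.
      by exists 0, 1, (notin1 P); split=> //; apply: sub0.
    elim/locW: a => a r ar; rewrite scale_mkfrac add_mkfrac.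
    do 3 eexists; split; last by [].
    by apply: subD => //; rewrite !submodZ.
  move=> z /asboolP[x /xsP/asboolP[p [s [ps [pP' ->]]]] [w ->]]; apply/asboolP.
  elim/locW: w => v t vt; rewrite scale_mkfrac.
  do 3 eexists; split; last by [].
  by apply: mem_span; apply/asboolP; right; exists p => //; exists v.
have [s sV Vs] := noeth_gen predT nV.
have [||||w wP wV] := @nakayama R V P pP predT (pred1 0) s.
- by split=> [|a u v /eqP-> /eqP->]; rewrite ?inE ?eqxx // scaler0 addr0.
- by [].
- by move=> v _; exists v; [apply: Vs | rewrite subrr inE].
- move=> v _; have [v' [t [vt [vPV /eq_mkfrac[u uP uv]]]]] := zPV (mkfrac v (notin1 P)).
  exists (u * t); first exact: notinM.
  by rewrite -scalerA uv scale1r submodZ.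
have /eqP/tf[w0|v0'] := wV v0 isT; last by rewrite v0' eqxx in v00.
by move: wP; rewrite w0 idealr0.
Qed.

Lemma loc_regular0 x (z : loc P V) : x != 0 -> frac P x *: z = 0 -> z = 0.
Proof.
move=> x0; elim/locW: z => v s vs; rewrite scale_mkfrac => /eq_mkfrac[u uP].
rewrite scaler0 scale1r scalerA => uv; have [ux|->] := tf (etrans uv (scaler0 _ _)).
  move/eqP: ux; rewrite mulf_eq0 (negbTE x0) orbF => /eqP u0.
  by move: uP; rewrite u0 idealr0.
by apply/eq_mkfrac; exists 1; rewrite ?notin1 // !scaler0.
Qed.

Lemma loc_regular1 x y : (forall v, y *: v \in loc_mult x -> v \in loc_mult x) ->
  forall z w : loc P V, frac P y *: z = frac P x *: w -> exists w', z = frac P x *: w'.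
Proof.
move=> yx z w; elim/locW: z => v s vs; elim/locW: w => w t wt.
rewrite !scale_mkfrac => /eq_mkfrac[u uP]; rewrite !mul1r => e.
have /asboolP[u' uP' [w' uv]] : v \in loc_mult x.
  apply: yx; apply/asboolP; exists (u * t); first exact: notinM.
  exists (u * s *: w); rewrite -(scalerA u t) e !scalerA; congr (_ *: _); ring.
exists (mkfrac w' (notinM uP' vs)); rewrite scale_mkfrac; apply/eq_mkfrac.
exists 1; rewrite ?notin1 // !scale1r mul1r -[x *: w']uv !scalerA; congr (_ *: _); ring.
Qed.

(** If [P] killed a nonzero element of [V_P / x V_P], clearing denominators over generators of [P]
    would make it the annihilator of some [u v] modulo [x V], against [nass]. Hence
    [regular_element] applies. *)
Lemma second_element x : x \in P -> x != 0 -> ht_ge 2 (P : {pred R}) ->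
  exists2 y, y \in P & forall v, y *: v \in loc_mult x -> v \in loc_mult x.
Proof.
move=> xP x0 htP; apply: (regular_element nR nV (loc_mult_sub x) sP) => v Pv.
apply: contraT => vN; have [s sE] := nR sP.
have [u uP us] : exists2 u, u \notin P & forall p, p \in s -> exists w, p *: (u *: v) = x *: w.
  have : {subset s <= P} by move=> p ps; rewrite sE; apply: mem_span.
  elim: (s) => [|p t IHt] tP; first by exists 1; rewrite ?notin1.
  have [|u uP ut] := IHt; first by move=> q qt; rewrite tP // inE qt orbT.
  have /asboolP[u' uP' [w uw]] := Pv p (tP p (mem_head _ _)).
  exists (u' * u) => [|q]; first exact: notinM.
  rewrite inE => /orP[/eqP->|/ut[w' qw]].
    exists (u *: w); rewrite [x *: (_ *: _)]scalerA [x * u]mulrC -(scalerA u x) -uw !scalerA.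
    by congr (_ *: _); ring.
  exists (u' *: w'); rewrite [x *: (_ *: _)]scalerA [x * u']mulrC -(scalerA u' x) -qw !scalerA.
  by congr (_ *: _); ring.
case: (@nass P x (u *: v)) => // r; split=> [|[w rw]].
  rewrite sE => rs; apply/asboolP; move: r rs.
  apply: (@span_min R R^o _ [pred r | `[< exists w, r *: (u *: v) = x *: w >] ]).
    split=> [|a b c /asboolP[b' be] /asboolP[c' ce]]; apply/asboolP.
      by exists 0; rewrite scale0r scaler0.
    exists (a *: b' + c'); rewrite scalerDl scalerDr -[a *: b]/(a * b) -scalerA be ce.
    by rewrite !scalerA mulrC.
  by move=> p ps; apply/asboolP; apply: us.
apply: contraT => rP; case/negP: vN; apply/asboolP; exists (r * u); first exact: notinM.
by exists w; rewrite -scalerA.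
Qed.

Lemma depth_loc k : (k <= 2)%N -> mod_dim_ge (loc P V) k ->
  depth_ge (loc P V) (loc_max P) k.
Proof.
move=> k2 /loc_ht_ge[htP [v0 v00]].
have nontriv xs := @loc_nontrivial xs v0 v00.
case: k k2 htP => [|k] k2 htP.
  by exists [::]; split=> //; split=> //; apply: nontriv.
have [x xP x0] : exists2 x, x \in P & x != 0.
  case: htP => _ [q hq [_ [x xP xq]]]; exists x => //; apply: contraNneq xq => ->.
  by apply/ideal0/prime_sub; case: (k) hq => [|?] [].
have reg1 v : frac P x *: v \in @ideal_smul _ (loc P V) [::] -> v \in @ideal_smul _ (loc P V) [::].
  move=> /ideal_smul0/(loc_regular0 x0)->; apply: sub0; exact: span_sub.
case: k k2 htP => [|[|//]] _ htP.
  have xsP : {subset [:: frac P x] <= loc_max P}.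
    by move=> z; rewrite inE => /eqP->; apply: frac_max.
  exists [:: frac P x]; split=> //; split; last exact: nontriv.
  case=> [_ v|i i1]; last by exfalso; move: i1.
  rewrite take0; exact: reg1.
have [y yP yx] := second_element xP x0 htP.
have xsP : {subset [:: frac P x; frac P y] <= loc_max P}.
  by move=> z; rewrite mem_seq2 => /orP[]/eqP->; apply: frac_max.
exists [:: frac P x; frac P y]; split=> //; split; last exact: nontriv.
case=> [_ v|[_ v|i i1]]; last by exfalso; move: i1.
  rewrite take0; exact: reg1.
move=> /ideal_smul1[w /(loc_regular1 yx)[w' ->]].
by apply: mem_span; apply/asboolP; exists (frac P x); rewrite ?mem_head //; exists w'.
Qed.

End Serre.

Theorem serre2 (R : idomainType) (V : lmodType R) : noetherian R -> noetherian_module V ->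
  (forall r (v : V), r *: v = 0 -> r = 0 \/ v = 0) ->
  (forall (p : {pred R}) x (w : V), is_prime p -> x \in p -> x != 0 ->
    (forall r, r \in p <-> exists u, r *: w = x *: u) -> ~ ht_ge 2 p) ->
  serre 2 V.
Proof. by move=> nR nV tf nass P k; apply: depth_loc. Qed.

(** * The Ratliff-Rush Rees algebra over the Rees algebra *)

Section Ext.
Variables (A : idomainType) (I : {pred A}).
Hypothesis sI : is_ideal I.
Hypothesis I0 : exists2 b, b \in I & b != 0.
Hypothesis nR : noetherian (rees I).

Local Notation R := (rees I).
Local Notation S := (ratliff_rush_rees I).
Local Notation rr n := (ratliff_rush (ideal_pow I n)).
Local Notation v := (@fil_rees_val A (adic_filtration I)).
Local Notation FS := (fil_pred (ratliff_rush_filtration I)).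

Section Module.
Variables (V : lmodType R) (phi : V -> {poly A}).
Hypothesis phiB : forall x y, phi (x - y) = phi x - phi y.
Hypothesis phiZ : forall r x, phi (r *: x) = v r * phi x.
Hypothesis phi_inj : injective phi.
Hypothesis phiS : forall s, s \in FS <-> exists x, phi x = s.

Let phi0 : phi 0 = 0. Proof. by rewrite -(subrr 0) phiB subrr. Qed.
Let phiD x y : phi (x + y) = phi x + phi y.
Proof. by rewrite -[y in LHS]opprK phiB -[- y]sub0r phiB phi0 sub0r opprK. Qed.

(** Multiplication by the conductor identifies submodules of [V] with ideals of [R]. The abstract
    [V] stands both for [S] over [R] and, for high powers of the ideal, for the Rees algebra over
    itself. *)
Lemma rees_noetherian_module : noetherian_module V.
Proof.
move=> N sN; have [c c0 cP] := conductor nR I0.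
pose J : {pred R} := [pred r : R | `[< exists2 x, x \in N & v r = c%:P * phi x >] ].
have sJ : is_ideal J.
  split=> [|a r s /asboolP[x xN rx] /asboolP[y yN sy]]; apply/asboolP.
    by exists 0; rewrite ?sub0 // phi0 mulr0.
  exists (a *: x + y); first by rewrite subD ?submodZ.
  by rewrite phiD phiZ mulrDr mulrCA -rx -sy.
have [s sE] := nR sJ.
have /choice[g gP] (r : R) : exists x, r \in J -> x \in N /\ v r = c%:P * phi x.
  case: (boolP (r \in J)) => [/asboolP[x xN rx]|_]; by [exists x | exists 0].
exists (map g s) => x; apply/idP/idP => [xN|].
  have cx : c%:P * phi x \in fil_pred (adic_filtration I).
    apply/fil_predP => i; rewrite coefCM; apply: cP.
    by have /fil_predP := (phiS _).2 (ex_intro _ x erefl).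
  have : FilRees cx \in J by apply/asboolP; exists x.
  rewrite sE => xs; suff [y ys] : exists2 y, y \in span [in map g s] & v (FilRees cx) = c%:P * phi y.
    move/mulfI; rewrite polyC_eq0 => /(_ c0) /phi_inj -> //.
  apply/asboolP; move: (FilRees cx) xs.
  apply: (@span_min R R^o _ [pred r : R | `[< exists2 y, y \in span [in map g s] & v r = c%:P * phi y >] ]).
    split=> [|a r q /asboolP[y yN ry] /asboolP[z zN qz]]; apply/asboolP.
      by exists 0; rewrite ?phi0 ?mulr0 // sub0 //; apply: span_sub.
    exists (a *: y + z); first by rewrite subD ?submodZ //; apply: span_sub.
    by rewrite phiD phiZ mulrDr mulrCA -ry -qz.
  move=> r rs; apply/asboolP; have [|_ rg] := gP r; first by rewrite sE; apply: mem_span.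
  by exists (g r) => //; apply: mem_span; apply: map_f.
apply: span_min => // _ /mapP[r rs ->]; have [|//] := gP r; rewrite sE; exact: mem_span.
Qed.

Section Serre.
Variables (m : {pred A}) (dim : nat) (zs : seq A).
Hypothesis nA : noetherian A.
Hypothesis pm : is_prime m.
Hypothesis hm : forall J, is_ideal J -> 1 \notin J -> {subset J <= m}.
Hypothesis mI : forall x, x \in m -> exists k, x ^+ k \in I.
Hypothesis dim2 : (2 <= dim)%N.
Hypothesis zm : {subset zs <= m}.
Hypothesis zdim : size zs = dim.
Hypothesis zreg : reg_mod (pred1 0) zs.
Hypothesis htM : ~ ht_ge dim.+2 (irrelevant m (I := I)).
Hypothesis hchains : punctured_chains m I dim.

Theorem rees_serre2 : serre 2 V.
Proof.
apply: serre2 => //; first exact: rees_noetherian_module.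
  move=> r x /(congr1 phi)/eqP; rewrite phiZ phi0 mulf_eq0 => /orP[]/eqP r0.
    by left; apply: val_inj.
  by right; apply: phi_inj; rewrite phi0.
move=> p x w pp xp x0 pE.
apply: (not_associated nA pm hm sI mI I0 dim2 zm zdim zreg htM hchains (s := phi w) pp xp x0).
  by apply/phiS; exists w.
move=> r; rewrite pE; split=> [[u rw]|[q /phiS[u <-] rw]].
  by exists (phi u); [apply/phiS; exists u | rewrite -phiZ rw phiZ].
by exists u; apply: phi_inj; rewrite !phiZ.
Qed.

End Serre.

End Module.

Lemma homR_pow (P : {pred R}) k c : is_ideal P -> (forall b, b \in I -> homR I 1 b \in P) ->
  (0 < k)%N -> c \in ideal_pow I k -> homR I k c \in P.
Proof.
move=> sP bP; case: k => // k _; rewrite -add1n => cI.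
suff : c \in [pred c | (c \in ideal_pow I (1 + k)) && (homR I (1 + k) c \in P)] by case/andP.
move: c cI; apply: ideal_pow_split => [|x y xI yI].
  split=> [|c x z /andP[xI xP] /andP[zI zP]]; apply/andP; split.
  - exact/ideal0/pow_sub.
  - have -> : homR I (1 + k) 0 = 0; last exact: ideal0.
    by apply: val_inj; rewrite /= homRE ?mul0r //; apply/ideal0/pow_sub.
  - exact: (pow_sub I (1 + k)).2.
  have -> : homR I (1 + k) (c *: (x : A^o) + z) = constR I c * homR I (1 + k) x + homR I (1 + k) z.
    apply: val_inj; rewrite /= !homRE //; first by rewrite polyCD polyCM mulrDl mulrA.
    exact: (pow_sub I (1 + k)).2.
  by apply: idealD => //; apply: idealM.
apply/andP; split; first exact: ideal_powM.
rewrite -homRM //; apply: idealrM => //; apply: bP; move: x xI.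
by apply: (@ideal_pow_ind A I 1 I) => // -[|c [|//]] // _ cI; rewrite big_seq1 cI ?mem_head.
Qed.

(** The chain consists of 0, the ideal of elements without constant term, and [P]; the steps are
    strict by [b t] and by [b]. *)
Lemma irrelevant_ht (P : {pred R}) b : is_prime P -> b \in I -> b != 0 ->
  constR I b \in P -> (forall c, c \in I -> homR I 1 c \in P) -> ht_ge 2 P.
Proof.
move=> pP bI b0 bP tP; have sP := prime_sub pP; split=> //.
have bI1 := ideal_pow1 bI.
have pQ : is_prime ([pred r : R | (v r)`_0 \in pred1 0] : {pred R}).
  split; [split=> [|a x y] | | move=> x y]; rewrite ?inE ?coef0 ?coef1 ?oner_eq0 //.
    by move=> /eqP x0 /eqP y0; rewrite coefD coef0M x0 y0 mulr0 addr0.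
  by rewrite coef0M mulf_eq0.
exists ([pred r : R | (v r)`_0 \in pred1 0] : {pred R}); last first.
  split=> [r r0|]; last by exists (constR I b); rewrite // inE coefC.
  apply: mem_homR => // -[|k]; last by apply: homR_pow => //; apply: coefR.
  by move/eqP: r0 => ->; rewrite homR0 rmorph0 ideal0.
split=> //; exists (pred1 0 : {pred R}); first by split=> //; exact: zero_prime.
split=> [r /eqP->|]; first by rewrite inE coef0 inE.
exists (homR I 1 b); first by rewrite inE homRE // coefMX inE.
rewrite inE; apply/eqP => /(congr1 v); rewrite homRE // => /eqP.
by rewrite mulf_eq0 polyC_eq0 (negbTE b0) (negbTE (monic_neq0 (monicXn A 1))).
Qed.

(** With [N] from [ratliff_rush_stable] and [c] in [I], both [c^N] and [(c t)^N] multiply [s] into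
    [R]: the first lies in [I^i] for the degrees [i < N] that are not yet stable, the second shifts
    everything to degrees at least [N]. *)
Lemma denominators_ht (s : S) :
  height_ge [pred r : R | `[< exists r', rees_incl r * s = rees_incl r' >] ] 2.
Proof.
move=> P PJ; apply: ht_prime_chain; have pP := prime_idealr_is_prime P.
have [N NP] := ratliff_rush_stable nR I0; have [b bI b0] := I0.
have srr i : (fil_rees_val s)`_i \in rr i by have /fil_predP := valP s.
have bN c : c \in I -> c ^+ N \in ideal_pow I N by apply: expr_ideal_pow.
have memP (r : R) : v r * fil_rees_val s \in fil_pred (adic_filtration I) -> r \in P.
  by move=> rs; apply: PJ; apply/asboolP; exists (FilRees rs); apply: val_inj.
apply: (@irrelevant_ht _ b) => // [|c cI].
  apply: (primeX (n := N) pP); rewrite -rmorphXn; apply: memP; apply/fil_predP => i.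
  rewrite coefCM; case: (leqP N i) => Ni; first by apply/ideal_powMl/NP.
  by rewrite mulrC; apply/ideal_powMl/(pow_leq (ltnW Ni))/bN.
apply: (primeX (n := N) pP); rewrite homRX ?mul1n; last exact: ideal_pow1.
apply: memP; rewrite homRE ?bN //; apply/fil_predP => i.
rewrite -mulrA coefCM coefXnM; case: ltnP => Ni; first by rewrite mulr0; apply/ideal0/pow_sub.
apply: NP => //; rewrite -(subnKC Ni); apply: rrMpow => //; first exact: bN.
rewrite addKn; exact: srr.
Qed.

Section Fractions.
Variable c : A.
Hypothesis hc : c != 0 /\ forall n x, x \in rr n -> c * x \in ideal_pow I n.

Lemma cmul_subproof (s : S) : c%:P * fil_rees_val s \in fil_pred (adic_filtration I).
Proof.
apply/fil_predP => i; rewrite coefCM; apply: hc.2.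
by have /fil_predP := valP s.
Qed.

Definition cmul (s : S) : R := FilRees (cmul_subproof s).

(** The conductor is a common denominator: [s] is [(c s) / c]. *)
Definition rees_fraction (s : S) : {fraction R} :=
  FracField.tofrac (cmul s) / FracField.tofrac (constR I c).

Let c0' : @FracField.tofrac R (constR I c) != 0.
Proof. by rewrite tofrac_eq0; apply/eqP => /(congr1 v)/eqP; rewrite /= polyC_eq0 (negbTE hc.1). Qed.

Lemma rees_fraction_zmod : zmod_morphism rees_fraction.
Proof.
move=> x y; rewrite /rees_fraction -mulrBl -rmorphB (_ : cmul (x - y) = cmul x - cmul y) //.
by apply: val_inj; rewrite /= mulrBr.
Qed.

Lemma rees_fractionE r : rees_fraction (rees_incl r) = FracField.tofrac r.
Proof.
rewrite /rees_fraction (_ : cmul _ = constR I c * r); last exact: val_inj.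
by rewrite rmorphM /= mulrAC divff // mul1r.
Qed.

Lemma rees_fraction_monoid : monoid_morphism rees_fraction.
Proof.
split=> [|x y].
  by rewrite -(rmorph1 (@rees_incl A I)) rees_fractionE rmorph1.
have xy : @FracField.tofrac R (cmul (x * y)) * FracField.tofrac (constR I c) =
    FracField.tofrac (cmul x) * FracField.tofrac (cmul y).
  rewrite -!rmorphM (_ : cmul (x * y) * constR I c = cmul x * cmul y) //.
  by apply: val_inj; rewrite /=; ring.
by rewrite /rees_fraction mulrACA -xy mulrA mulfK.
Qed.

HB.instance Definition _ :=
  GRing.isZmodMorphism.Build S {fraction R} rees_fraction rees_fraction_zmod.
HB.instance Definition _ :=
  GRing.isMonoidMorphism.Build S {fraction R} rees_fraction rees_fraction_monoid.

Lemma rees_fraction_inj : injective rees_fraction.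
Proof.
apply: raddf_inj => s /eqP; rewrite mulf_eq0 invr_eq0 (negbTE c0') orbF tofrac_eq0.
move=> /eqP/(congr1 v)/eqP; rewrite /= mulf_eq0 polyC_eq0 (negbTE hc.1) => /eqP s0.
exact: val_inj.
Qed.

End Fractions.

Lemma rees_S2ification : serre 2 (restrict_scalars (@rees_incl A I)) ->
  is_S2ification (@rees_incl A I : {rmorphism R -> S}).
Proof.
move=> S2; split=> //.
- have [c c0 cP] := conductor nR I0; exists (rees_fraction (conj c0 cP)).
    exact: rees_fraction_inj.
  by move=> r; apply: rees_fractionE.
- have nV : noetherian_module (restrict_scalars (@rees_incl A I)).
    apply: (@rees_noetherian_module _ (fun x : restrict_scalars (@rees_incl A I) =>
      fil_rees_val (x : S))) => //; first exact: val_inj.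
    move=> s; split=> [sS|[x <-]]; last exact: (valP x).
    by exists (FilRees sS).
  have [s _ sV] := noeth_gen predT nV; exists s => x; exact: sV.
by move=> s _; apply: denominators_ht.
Qed.
End Ext.

(** * Local rings, and assembly of the theorem *)

Section MkIdeal.
Variables (R : comNzRingType) (J : {pred R}) (hJ : is_ideal J) (J1 : 1 \notin J).
Let J' : R -> bool := fun x => x \in J.
Let J'_ideal : idealr_closed (J' : {pred R}).
Proof. by case: hJ => J0 sJ; split. Qed.
HB.instance Definition _ := isIdealr.Build R J' J'_ideal.
Definition mkideal : idealr R := J'.
End MkIdeal.

(** [local_ring] speaks of maximal ideals only; noetherianity places every proper ideal in one. *)
Lemma local_proper (R : comNzRingType) (m : idealr R) : noetherian R -> local_ring m ->
  forall J, is_ideal J -> 1 \notin J -> {subset J <= m}.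
Proof.
move=> nR [_ mm] J sJ J1.
have [N [[sN N1] JN Nmax]] := @noeth_max R R^o (fun K => is_ideal K /\ 1 \notin K) J nR
  (fun K h => h.1) (conj sJ J1).
have NM : maximal_ideal (mkideal sN N1).
  move=> K NK x xK; apply: (Nmax K) => //; split; first exact: idealr_is_ideal.
  by rewrite idealr1.
by move=> x /JN xN; rewrite -(mm _ NM).
Qed.

Lemma local_prime (R : comNzRingType) (m : idealr R) :
  (forall J, is_ideal J -> 1 \notin J -> {subset J <= m}) -> is_prime m.
Proof.
move=> hm; have sm := idealr_is_ideal m; split=> // [|x y xym]; first by rewrite idealr1.
case: (boolP (x \in m)) => //= xm.
have [a a1] : exists a, 1 - a * x \in m.
  apply/iadjP; apply: contraT => n1; case/negP: xm.
  by apply: (hm _ (iadj_ideal _ sm) n1); apply: iadjr.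
have -> : y = (1 - a * x) * y + a * (x * y) by ring.
by apply: (idealD sm); [apply: idealrM | apply: idealM].
Qed.

Lemma ring_dim_unique (R : comNzRingType) d d' : ring_dim R d -> ring_dim R d' -> d = d'.
Proof.
have mono i j : (i <= j)%N -> ring_dim_ge R j -> ring_dim_ge R i.
  by move=> ij /ring_dim_geP[P htP]; apply/ring_dim_geP; exists P; apply: ht_ge_leq htP.
move=> [dd nd] [dd' nd']; case: (ltngtP d d') => // lt.
  by case: nd; apply: mono dd'.
by case: nd'; apply: mono dd.
Qed.

Theorem corollary1p3 (A : idomainType) (m I : idealr A) (d : nat)
    (hnoeth : noetherian A)
    (hlocal : local_ring m)
    (hCM : cohen_macaulay m)
    (hdim : ring_dim A d)
    (hd : (2 <= d)%N)
    (hres : infinite_set [set: {ideal_quot m}])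
    (hunram : analytically_unramified m)
    (hI : primary_to m I)
    (hgr : gr_generalized_CM I d) :
  is_S2ification (@rees_incl A I : {rmorphism rees I -> ratliff_rush_rees I}) /\
  exists N : nat, forall n : nat, (N <= n)%N ->
    serre 2 (rees (ideal_pow I n))^o.
Proof.
have hm := local_proper hnoeth hlocal; have pm := local_prime hm.
have sI := idealr_is_ideal I.
have Im : {subset (I : {pred A}) <= m} by move=> x xI; apply/hI.2; exists 1%N.
have mI x : x \in m -> exists k, x ^+ k \in I by move/hI.2.
(* [cohen_macaulay] comes with its own dimension [d'], equal to [d] by uniqueness; so the sequence
   [zs] has length [d]. *)
have [d' [hdim' [zs [zdim zm zreg]] _]] := hCM.
rewrite (ring_dim_unique hdim' hdim) in zdim.
have {}zreg := regular_seq_mod zreg.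
have htm : ~ ht_ge d.+1 (m : {pred A}).
  by move=> htm; case: hdim => _; apply; apply/ring_dim_geP; exists (m : {pred A}).
have I0 : exists2 b, b \in (I : {pred A}) & b != 0.
  have /ring_dim_geP[P htP] := hdim.1; have [pP [Q hQ [QP [x xP xQ]]]] := ht_ge_leq (ltnW hd) htP.
  have [k xk] := mI x (hm _ (prime_sub pP) (prime_not1 pP) x xP); exists (x ^+ k) => //.
  apply: expf_neq0; apply: contraNneq xQ => ->; apply/ideal0/prime_sub.
  by case: hQ.
have [nR htM] := rees_ring hnoeth pm sI zm zdim zreg htm I0.
have hchains := gr_punctured_chains pm hm Im I0 nR (ltnW hd) hgr.
have Sfil (J : {pred A}) (s : {poly A}) : s \in fil_pred (ratliff_rush_filtration J) <->
    exists x : ratliff_rush_rees J, fil_rees_val x = s.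
  by split=> [sS|[x <-]]; [exists (FilRees sS) | exact: (valP x)].
split.
  apply: rees_S2ification => //.
  apply: (rees_serre2 (phi := fun x : restrict_scalars (@rees_incl A I) =>
    fil_rees_val (x : ratliff_rush_rees I)) sI I0 nR _ _ val_inj (Sfil I)
    hnoeth pm hm mI hd zm zdim zreg htM hchains) => //.
(* For [n >= N] the positive powers of [I^n] are Ratliff-Rush closed, so [A[I^n t]] is its own
   Ratliff-Rush Rees algebra; [n >= 1] serves the substitution of [t^n] for [t]. *)
have [N NP] := ratliff_rush_stable nR I0; exists (maxn N 1) => n.
rewrite geq_max => /andP[Nn n0]; pose J : {pred A} := ideal_pow I n.
have sJ : is_ideal J by apply: pow_sub.
have powJ x : x \in (I : {pred A}) -> x ^+ n \in J by apply: expr_ideal_pow.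
have mJ x : x \in m -> exists k, x ^+ k \in J.
  by move/mI=> [k xk]; exists (k * n)%N; rewrite exprM; apply: powJ.
have J0 : exists2 b, b \in J & b != 0.
  by have [b bI b0] := I0; exists (b ^+ n); [apply: powJ | apply: expf_neq0].
have [nRJ htMJ] := rees_ring hnoeth pm sJ zm zdim zreg htm J0.
have chainsJ := veronese_punctured_chains nR n0 hchains Im.
have rrJ k : {subset ratliff_rush (ideal_pow J k) <= ideal_pow J k}.
  case: k => [|k] x; first by rewrite ideal_pow0.
  by rewrite pow_powE; apply: NP; rewrite (leq_trans Nn) // leq_pmulr.
apply: (rees_serre2 (V := (rees J)^o) (phi := fun x : (rees J)^o => fil_rees_val (x : rees J))
  sJ J0 nRJ _ _ val_inj _ hnoeth pm hm mJ hd zm zdim zreg htMJ chainsJ) => // s.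
split=> [/fil_predP sS|[x <-]].
  have sJs : s \in fil_pred (adic_filtration J) by apply/fil_predP => k; apply/rrJ/sS.
  by exists (FilRees sJs).
by apply/fil_predP => k; apply/ideal_pow_ratliff_rush/coefR.
Qed.
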